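(* Let $n\ge2$, $1\le i\le n-1$, $\zeta\in D^n_i$ and $f\in\mathrm{Conv}(\mathbb{R}^n,\mathbb{R})$. Then $$V^*_{i,\zeta}(f)=\lim_{\epsilon\to0}\int_{\mathbb{R}^n\setminus B_\epsilon(0)}\zeta(|x|)\,d\Phi_i(f,x).$$ Moreover, the convergence is uniform on $\{f\in\mathrm{Conv}(\mathbb{R}^n,\mathbb{R}):\sup_{|x|<r}|f(x)|\le M\}$ for every $r>1$, $M>0$; in particular it is uniform on compact subsets of $\mathrm{Conv}(\mathbb{R}^n,\mathbb{R})$.
   Context: $\mathrm{Conv}(\mathbb{R}^n,\mathbb{R})$ is the space of finite-valued convex functions on $\mathbb{R}^n$ with the topology of epi-convergence (equivalently locally uniform convergence). The Hessian measures: for $0\le i\le n$ there is a unique map $f\mapsto\Phi_i(f,\cdot)$ from $\mathrm{Conv}(\mathbb{R}^n,\mathbb{R})$ to non-negative Radon measures on $\mathbb{R}^n$, continuous w.r.t. weak convergence of measures, with $d\Phi_i(f,x)=[D^2f(x)]_i\,dx$ for $f\in C^2$ ($[A]_i$ = $i$-th elementary symmetric polynomial of the eigenvalues of $A$). $C_b(0,\infty)$ = continuous functions on $(0,\infty)$ with support bounded from above; $D^n_i=\{\zeta\in C_b(0,\infty): \lim_{t\to0}t^{n-i}\zeta(t)=0,\ \lim_{t\to0}\int_t^\infty\zeta(s)s^{n-i-1}ds\text{ exists and is finite}\}$. A valuation on $\mathrm{Conv}(\mathbb{R}^n,\mathbb{R})$ is a map $\mu$ with $\mu(f\vee h)+\mu(f\wedge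 h)=\mu(f)+\mu(h)$ whenever $f\vee h, f\wedge h$ are convex; it is dually epi-translation invariant if $\mu(f+\lambda+c)=\mu(f)$ for linear $\lambda$ and constants $c$. For $\zeta\in D^n_i$, the functional intrinsic volume $V^*_{i,\zeta}$ is the unique continuous, dually epi-translation invariant, $\mathrm{SO}(n)$-invariant, $i$-homogeneous valuation on $\mathrm{Conv}(\mathbb{R}^n,\mathbb{R})$ such that $V^*_{i,\zeta}(f)=\int_{\mathbb{R}^n}\zeta(|x|)[D^2f(x)]_i\,dx$ for all $f\in\mathrm{Conv}(\mathbb{R}^n,\mathbb{R})\cap C^2(\mathbb{R}^n)$ (its existence and uniqueness are known). *)

(* Defs.v *)
From HB Require Import structures.
From mathcomp Require Import all_boot all_order all_algebra.
From mathcomp Require Import all_classical all_reals all_analysis.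
Set Implicit Arguments. Unset Strict Implicit. Unset Printing Implicit Defensive.
Import Order.TTheory GRing.Theory Num.Theory.
Import numFieldNormedType.Exports.
Local Open Scope classical_set_scope.
Local Open Scope ring_scope.

Definition enorm (R : realType) (n : nat) (x : 'rV[R]_n) : R :=
  Num.sqrt (\sum_(j < n) x 0 j ^+ 2).

Definition eball0 (R : realType) (n : nat) (eps : R) : set 'rV[R]_n :=
  [set x | enorm x < eps].

Definition convex_fun (R : realType) (n : nat) (f : 'rV[R]_n -> R) : Prop :=
  forall (x y : 'rV[R]_n) (t : R), 0 <= t <= 1 ->
    f ((1 - t) *: x + t *: y) <= (1 - t) * f x + t * f y.

(* epi-convergence = locally uniform convergence of finite convex functions *)
Definition lu_cvg (R : realType) (n : nat) (fk : nat -> 'rV[R]_n -> R)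
  (f : 'rV[R]_n -> R) : Prop :=
  forall r e : R, 0 < r -> 0 < e ->
    \forall k \near \oo, forall x, enorm x <= r -> `|fk k x - f x| < e.

Definition evec (R : realType) {n : nat} (j : 'I_n) : 'rV[R]_n := delta_mx 0 j.

Definition C2 (R : realType) (n : nat) (f : 'rV[R]_n -> R) : Prop :=
  (forall x (j : 'I_n), derivable f x (evec R j)) /\
  (forall (j k : 'I_n) x, derivable ('D_(evec R k) f) x (evec R j)) /\
  (forall (j k : 'I_n), continuous ('D_(evec R j) ('D_(evec R k) f))).

Definition hessian (R : realType) (n : nat) (f : 'rV[R]_n -> R) (x : 'rV[R]_n)
  : 'M[R]_n :=
  \matrix_(j, k) 'D_(evec R j) ('D_(evec R k) f) x.

(* [A]_i : i-th elementary symmetric polynomial of the eigenvalues of A,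
   read off the characteristic polynomial det(X - A) = prod (X - lambda_j) *)
Definition esym_eig (R : realType) (n : nat) (i : nat) (A : 'M[R]_n) : R :=
  (-1) ^+ i * (char_poly A)`_(n - i).

(* Lebesgue integral over R^n, written as an iterated integral over the
   coordinates (Fubini/Tonelli); R^0 is a point *)
Fixpoint leb_int (R : realType) (n : nat) : ('rV[R]_n -> \bar R) -> \bar R :=
  match n return ('rV[R]_n -> \bar R) -> \bar R with
  | 0 => fun F => F 0
  | m.+1 => fun F =>
      (\int[@lebesgue_measure R]_(t in [set: R])
         leb_int (fun v : 'rV[R]_m => F (row_mx (t%:M : 'M[R]_1) v)))%E
  end.

Definition Rn (R : realType) (n : nat) := g_sigma_algebraType (@open 'rV[R]_n).

Definition D_class (R : realType) (n i : nat) (zeta : R -> R) : Prop :=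
  (forall t : R, 0 < t -> {for t, continuous zeta}) /\
  (exists T : R, forall t, T < t -> zeta t = 0) /\
  ((fun t => t ^+ (n - i) * zeta t) @ 0^'+ --> (0 : R)) /\
  (exists L : R,
     (fun t => (\int[@lebesgue_measure R]_(s in `[t, +oo[%classic)
                  (zeta s * s ^+ (n - i - 1))%:E)%E) @ 0^'+ --> L%:E).

(* Phi is the i-th Hessian measure: for convex f, Phi f is a non-negative
   Radon (Borel, finite on compacts) measure on R^n; f |-> Phi f is continuous
   (epi-convergence -> weak convergence of measures, tested on continuous
   compactly supported functions); dPhi(f,x) = [D^2 f(x)]_i dx for C^2 f. *)
Definition hessian_measure (R : realType) (n i : nat)
  (Phi : ('rV[R]_n -> R) -> {measure set (Rn R n) -> \bar R}) : Prop :=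
  (forall f, convex_fun f -> forall K : set 'rV[R]_n, compact K ->
     (Phi f K < +oo)%E) /\
  (forall (fk : nat -> 'rV[R]_n -> R) f,
     (forall k, convex_fun (fk k)) -> convex_fun f -> lu_cvg fk f ->
     forall g : 'rV[R]_n -> R, continuous g ->
       (exists r : R, forall x, r < enorm x -> g x = 0) ->
       (fun k => (\int[Phi (fk k)]_x (g x)%:E)%E) @ \oo -->
         (\int[Phi f]_x (g x)%:E)%E) /\
  (forall f, convex_fun f -> C2 f -> forall A : set (Rn R n), measurable A ->
     Phi f A = leb_int (fun x => ((\1_A x : R) * esym_eig i (hessian f x))%:E)).

Definition fiv (R : realType) (n i : nat) (zeta : R -> R)
  (V : ('rV[R]_n -> R) -> R) : Prop :=
  (forall f h, convex_fun f -> convex_fun h ->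
     convex_fun (fun x => Num.max (f x) (h x)) ->
     convex_fun (fun x => Num.min (f x) (h x)) ->
     V (fun x => Num.max (f x) (h x)) + V (fun x => Num.min (f x) (h x))
       = V f + V h) /\
  (forall f (c : 'rV[R]_n) (a : R), convex_fun f ->
     V (fun x => f x + \sum_(j < n) c 0 j * x 0 j + a) = V f) /\
  (forall f (th : 'M[R]_n), convex_fun f -> th *m th^T = 1%:M -> \det th = 1 ->
     V (fun x => f (x *m th)) = V f) /\
  (forall f (l : R), convex_fun f -> 0 < l ->
     V (fun x => l * f x) = l ^+ i * V f) /\
  (forall (fk : nat -> 'rV[R]_n -> R) f,
     (forall k, convex_fun (fk k)) -> convex_fun f -> lu_cvg fk f ->
     (fun k => V (fk k)) @ \oo --> V f) /\
  (forall f, convex_fun f -> C2 f ->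
     (V f)%:E = leb_int (fun x => (zeta (enorm x) * esym_eig i (hessian f x))%:E)).

Definition trunc_int (R : realType) (n : nat) (zeta : R -> R)
  (mu : {measure set (Rn R n) -> \bar R}) (eps : R) : \bar R :=
  (\int[mu]_(x in (~` @eball0 R n eps : set (Rn R n))) (zeta (enorm x))%:E)%E.

(* Main.v *)
Require Import Defs.
From HB Require Import structures.
From mathcomp Require Import all_boot all_order all_algebra all_fingroup.
From mathcomp Require Import all_classical all_reals all_analysis.
From mathcomp Require Import ring lra zify.
Import Order.TTheory GRing.Theory Num.Theory.
Import numFieldNormedType.Exports.
Local Open Scope classical_set_scope.
Local Open Scope ring_scope.
Set Implicit Arguments. Unset Strict Implicit. Unset Printing Implicit Defensive.

(** For a smooth convex F that is affine near 0, put w = [D^2 F]_i and m = n - i.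
The Newton transformations of D^2 F are divergence free; testing this against
radial fields yields w = |x|^m A + |x|^(m-1) B with A, B >= 0 such that
m * int G(|x|) A + int G'(|x|) B = 0 for every G vanishing at infinity.  With G a
cutoff times the primitive E of zeta t^(m-1) that tends to 0 at 0, this bounds the
integral of zeta(|x|) w over a small ball by the supremum of |E| and |t^m zeta|
there, times the Hessian mass of a fixed ball, which a bound on |F| controls.
Approximation by such F transfers the estimate to every convex f, and dominated
convergence replaces smooth cutoffs by the truncation. *)

(** * Newton transformations of symmetric matrices *)

(** Near 0 the density zeta may be integrable against t^(m-1) only conditionally, so zeta(|x|) need
    not be absolutely integrable for the Hessian measure: the truncated integrals converge by
    cancellation, and an estimate has to pass from zeta to a primitive before absolute values are
    taken. The parts A and B make this possible: they are the weighted tangential and radial parts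
    of w, tied together by testing with the weight |x|^(-m). Affineness near 0 makes every integrand
    continuous with compact support, so that no boundary term arises at 0; the radius of the flat
    ball never enters an estimate. Two facts are drawn from the Hessian measure itself instead of
    from eigenvalues: [B]_i >= 0 for B >= 0, by measuring a box for a quadratic form, and the mass
    bound, by weak continuity and homogeneity. The latter argument needs functions controlled on the
    whole space, whereas F is controlled only near 0; hence the detour through a globally Lipschitz
    function with the same Hessian near 0. *)

Lemma det_rank1 (S : idomainType) n (M : 'M[S]_n) (p : 'cV[S]_n) (q : 'rV[S]_n) :
  \det M != 0 ->
  \det (M + p *m q) = \det M + (q *m \adj M *m p) 0 0.
Proof.
move=> dM.
(* One block matrix is triangularised in two ways. The adjugate replaces the inverse of M, so that
   the identity holds over a domain; it is applied to characteristic matrices, with polynomial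
   entries. *)
pose B := block_mx M (- p) q (1%:M : 'M[S]_1).
have dB : \det B = \det (M + p *m q).
  have := det_mulmx B (block_mx 1%:M 0 (- q) 1%:M).
  rewrite det_lblock !det1 !mulr1 => <-.
  rewrite mulmx_block !mulmx1 !mulmx0 !add0r mulNmx mulmxN opprK mul1mx.
  by rewrite addrN det_ublock det1 mulr1.
rewrite -dB.
have dA : \det (\adj M) != 0.
  apply: contra dM => /eqP h.
  have : \det M ^+ n == 0 by rewrite -det_scalar -mul_mx_adj det_mulmx h mulr0.
  by rewrite expf_eq0 => /andP[].
have := det_mulmx B (block_mx (\adj M) (\adj M *m p) 0 (\det M)%:M).
rewrite mulmx_block !mulmx0 !addr0 !mulmxA mul_mx_adj mul_scalar_mx.
rewrite mulNmx mul_mx_scalar addrN det_lblock det_ublock mul1mx.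
rewrite -[X in \det X * _]mul_mx_adj det_mulmx.
rewrite det_scalar1 [X in _ * X = _]det_mx11 [fun_of_matrix (_ + _) _ _]mxE [fun_of_matrix _%:M _ _]mxE eqxx mulr1n.
rewrite [\det M * \det (\adj M)]mulrC [\det B * _]mulrC.
move=> /(mulfI (mulf_neq0 dA dM)) <-.
by rewrite addrC.
Qed.

(** * Jacobi's formula for a derivation of a commutative ring *)

Section Derivation.
Variables (S : comNzRingType) (D : {additive S -> S}).
Hypothesis DM : forall x y, D (x * y) = D x * y + x * D y.

Lemma derivation1 : D 1 = 0.
Proof. by apply: (addrI (D 1)); rewrite addr0 -{3}(mulr1 1) DM mulr1 mul1r. Qed.

Lemma derivation_prod n (P : pred 'I_n) (F : 'I_n -> S) :
  D (\prod_(a | P a) F a) =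
  \sum_(a | P a) D (F a) * \prod_(c | P c && (c != a)) F c.
Proof.
rewrite -[in LHS]big_filter -[RHS]big_filter.
have := filter_uniq P (index_enum_uniq 'I_n).
have ->: \sum_(i <- [seq a <- index_enum 'I_n | P a])
           D (F i) * \prod_(c | P c && (c != i)) F c =
         \sum_(i <- [seq a <- index_enum 'I_n | P a])
           D (F i) * \prod_(c <- [seq a <- index_enum 'I_n | P a] | c != i) F c.
  by apply: eq_bigr => a _; rewrite big_filter_cond.
elim: [seq a <- _ | _] => [|a s IH] /=; first by rewrite !big_nil derivation1.
move=> /andP[nas us]; rewrite !big_cons DM IH //= eqxx /=; congr (_ * _ + _).
  rewrite [in RHS]big_seq_cond [in LHS]big_seq; apply: eq_bigl => c.
  case: (boolP (c \in s)) => //= cs; apply/esym.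
  by apply: contraNneq nas => <-.
rewrite big_distrr /= big_seq [RHS]big_seq; apply: eq_bigr => b bs.
rewrite big_cons ifT; last by apply: contraNneq nas => ->.
by rewrite mulrCA.
Qed.

(** Differentiating the Leibniz expansion hits one factor of row j at a time; grouping the
    permutations by k = s j rebuilds the cofactors. *)
Lemma derivation_det n (M : 'M[S]_n) :
  D (\det M) = \sum_j \sum_k D (M j k) * cofactor M j k.
Proof.
rewrite /determinant raddf_sum /=.
have Dsign (b : bool) x : D ((-1) ^+ b * x) = (-1) ^+ b * D x.
  by case: b; rewrite ?expr1 ?expr0 ?mulN1r ?mul1r ?raddfN.
under eq_bigr => s _.
  rewrite Dsign derivation_prod big_distrr /=.
  over.
rewrite exchange_big /=; apply: eq_bigr => j _.
under [RHS]eq_bigr => k _ do rewrite expand_cofactor big_distrr /=.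
rewrite (exchange_big_dep xpredT) //=; apply: eq_bigr => s _.
rewrite [RHS](big_pred1 (s j)) => [|k]; last by rewrite /= eq_sym.
rewrite mulrCA; congr (_ * (_ * _)).
by apply: eq_bigl => k; rewrite eq_sym.
Qed.

End Derivation.

(* Interchanging the roles of j and a, with s replaced by s * (j a), flips the
   sign of every term. *)
Lemma piola_cancel (R : numDomainType) n (M : 'M[R]_n) (dM : 'I_n -> 'M[R]_n) k :
  (forall l a b, dM l a b = dM a l b) ->
  \sum_j \sum_(s : 'S_n | s j == k) (-1) ^+ s *
     (\sum_(a | j != a) dM j a (s a) * \prod_(c | (j != c) && (c != a)) M c (s c)) = 0.
Proof.
move=> sym; set E := LHS.
suff h : E = - E.
  by apply/eqP; move/eqP: h; rewrite -addr_eq0 -mulr2n mulrn_eq0.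
pose T j a (s : 'S_n) := (-1) ^+ s *
   (dM j a (s a) * \prod_(c | (j != c) && (c != a)) M c (s c)).
have EE : E = \sum_j \sum_(a | j != a) \sum_(s : 'S_n | s j == k) T j a s.
  rewrite /E; apply: eq_bigr => j _.
  under eq_bigr => s _ do rewrite big_distrr /=.
  by rewrite exchange_big.
rewrite {2}EE EE [LHS](exchange_big_dep xpredT) //= -sumrN; apply: eq_bigr => a _.
rewrite -sumrN; apply: eq_big => [j|j ja]; first by rewrite eq_sym.
rewrite [LHS](reindex_inj (mulgI (tperm j a))) /= -sumrN.
apply: eq_big => [s|s _]; first by rewrite permM tpermL.
rewrite /T odd_mul_tperm ja permM tpermR signr_addb mulN1r mulNr sym.
congr (- (_ * (_ * _))); apply: eq_big => [c|c /andP[jc ca]].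
  by rewrite andbC eq_sym; congr (_ && _); rewrite eq_sym.
by rewrite permM tpermD // eq_sym.
Qed.

(* newton i A is the matrix T_i(A) of the derivatives of [A]_(i+1). *)
Definition newton (R : comNzRingType) n i (A : 'M[R]_n) : 'M[R]_n :=
  \matrix_(j, k) ((-1) ^+ i * (cofactor (char_poly_mx A) j k)`_(n.-1 - i)).

(** Same formula as [esym_eig], over any commutative ring. Over a [realType] the two are
    convertible, so facts about [Phi] and [V] transfer without rewriting. *)
Definition elsym (R : comNzRingType) n i (A : 'M[R]_n) : R :=
  (-1) ^+ i * (char_poly A)`_(n - i).

Lemma char_poly_deriv (R : comNzRingType) n (A : 'M[R]_n) :
  (char_poly A)^`() = \sum_j cofactor (char_poly_mx A) j j.
Proof.
rewrite /char_poly (derivation_det (@derivM R)).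
apply: eq_bigr => j _; rewrite (bigD1 j) //= big1 ?addr0 => [|k kj].
  by rewrite !mxE eqxx mulr1n derivB derivX derivC subr0 mul1r.
by rewrite !mxE eq_sym (negbTE kj) mulr0n derivB derivC deriv0 subr0 mul0r.
Qed.

(** Differentiating the characteristic polynomial multiplies its coefficient of degree n - i by n -
    i; the constant m of the integral identity comes from here. *)
Lemma tr_newton (R : comNzRingType) n i (A : 'M[R]_n) : (i < n)%N ->
  \tr (newton i A) = (n - i)%:R * elsym i A.
Proof.
move=> ilt; have := congr1 (fun p : {poly R} => (-1) ^+ i * p`_(n.-1 - i))
  (char_poly_deriv A).
rewrite coef_deriv [X in _ = _ * X]coef_sum [X in _ = X]mulr_sumr /mxtrace.
have -> : ((n.-1 - i).+1 = n - i)%N by case: n ilt {A} => // n; rewrite ltnS => h; rewrite subSn.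
rewrite mulrnAr -mulr_natl /elsym => ->.
by apply: eq_bigr => j _; rewrite !mxE.
Qed.

Lemma char_poly_neq0 (R : nzRingType) n (A : 'M[R]_n) : char_poly A != 0.
Proof. by rewrite -size_poly_eq0 size_char_poly. Qed.

(** * Rank-one perturbations and bounds for the Newton form *)

Section Rank1.
Variables (R : realFieldType) (n : nat).
Implicit Types (A S : 'M[R]_n) (v : 'rV[R]_n).

Definition qform v A : R := (v *m A *m v^T) 0 0.

Lemma qformE v A : qform v A = \sum_j \sum_k v 0 j * v 0 k * A j k.
Proof.
rewrite /qform mxE exchange_big /=; apply: eq_bigr => k _.
rewrite !mxE big_distrl /=; apply: eq_bigr => j _; ring.
Qed.

(** A rank-one perturbation makes [.]_i exactly affine in c. With M the characteristic matrix, A = X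
    - M, so v adj(M) A v^T = X v adj(M) v^T - det M for a unit vector v, and the two terms yield the
    Newton form and [A]_i. *)
Lemma elsym_rank1 i A v c : (i < n)%N -> qform v 1%:M = 1 ->
  elsym i (A *m (1%:M - c *: (v^T *m v))) =
  elsym i A + c * (qform v (newton i A) - elsym i A).
Proof.
move=> ilt v1; set M := char_poly_mx A.
pose vP := map_mx polyC v.
have vP1 : (vP *m vP^T) 0 0 = 1.
  have h : (v *m v^T) 0 0 = 1 by move: v1; rewrite /qform mulmx1.
  by rewrite /vP map_trmx -map_mxM mxE h.
have MA : map_mx polyC A = 'X%:M - M by rewrite /M /char_poly_mx opprB addrCA addrN addr0.
have -> : elsym i (A *m (1%:M - c *: (v^T *m v))) =
   (-1) ^+ i * (\det (M + (c%:P *: (map_mx polyC A *m vP^T)) *m vP))`_(n - i).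
  suff h : char_poly_mx (A *m (1%:M - c *: (v^T *m v))) =
      M + (c%:P *: (map_mx polyC A *m vP^T)) *m vP by rewrite /elsym /char_poly h.
  rewrite /char_poly_mx mulmxBr mulmx1 raddfB /= opprB addrCA addrC -scalemxAr.
  congr (_ + _); rewrite map_mxZ !map_mxM /= map_trmx.
  by rewrite -scalemxAl mulmxA.
rewrite det_rank1; last exact: char_poly_neq0.
have -> : (vP *m \adj M *m (c%:P *: (map_mx polyC A *m vP^T))) 0 0 =
   c%:P * ('X * (vP *m \adj M *m vP^T) 0 0 - \det M).
  rewrite -scalemxAr mxE; congr (_ * _).
  rewrite MA mulmxBl mulmxBr mul_scalar_mx -scalemxAr !mulmxA -(mulmxA vP _ M) mul_adj_mx.
  rewrite mul_mx_scalar -scalemxAl mxE [in X in _ + X]mxE.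
  by rewrite !mxE -/(char_poly A) ; congr (_ - _); rewrite -[RHS]mulr1 -vP1 mxE.
rewrite coefD mulrDr coefCM coefB coefXM -/(char_poly A).
have -> : (n - i == 0)%N = false by rewrite subn_eq0 leqNgt ilt.
rewrite /elsym; set q : R := (_ 0 0 : {poly R})`_ _.
have -> : qform v (newton i A) = (-1) ^+ i * q.
  rewrite qformE /q mxE coef_sum big_distrr /=; apply: eq_bigr => j _.
  rewrite !mxE coefMC coef_sum big_distrl /= big_distrr /=; apply: eq_bigr => k _.
  rewrite !mxE coefCM -/M.
  have -> : (n.-1 - i = (n - i).-1)%N by rewrite -!subn1 subnAC.
  by ring.
ring.
Qed.

(** The two matrices are similar through S. The left one inherits symmetry and positivity from A
    when S is symmetric; the right one is the rank-one product. *)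
Lemma elsym_conj i A S : S \in unitmx -> elsym i (S *m A *m S) = elsym i (A *m (S *m S)).
Proof.
move=> uS; suff h : char_poly (S *m A *m S) = char_poly (A *m (S *m S)) by rewrite /elsym h.
rewrite /char_poly; set s := map_mx polyC S.
have ds : \det s != 0.
  by rewrite /s det_map_mx polyC_eq0 -unitfE -unitmxE.
apply: (mulfI ds); rewrite -[RHS]det_mulmx [LHS]mulrC -[LHS]det_mulmx; congr (\det _).
rewrite /char_poly_mx mulmxBl mulmxBr !map_mxM /= -/s !mulmxA.
by rewrite scalar_mxC.
Qed.

(* If B >= 0 implies [B]_i >= 0, then contracting A by 1 - d in the
   direction v gives 0 <= tau + d^2 (w - tau) for all nonzero d. *)
Lemma newton_bounds i A v : (i < n)%N ->
  (forall B : 'M[R]_n, B^T = B -> (forall u, 0 <= qform u B) -> 0 <= elsym i B) ->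
  A^T = A -> (forall u, 0 <= qform u A) -> qform v 1%:M = 1 ->
  0 <= qform v (newton i A) <= elsym i A.
Proof.
move=> ilt H sA pA v1.
have main (d : R) : d != 0 ->
    0 <= qform v (newton i A) + d ^+ 2 * (elsym i A - qform v (newton i A)).
  move=> d0; pose S : 'M[R]_n := 1%:M - (1 - d) *: (v^T *m v).
  have sS : S^T = S by rewrite /S linearB /= linearZ /= trmx1 trmx_mul trmxK.
  have SS : S *m S = 1%:M - (1 - d ^+ 2) *: (v^T *m v).
    rewrite /S mulmxBl mul1mx mulmxBr mulmx1 -scalemxAl -scalemxAr scalerA.
    have -> : v^T *m v *m (v^T *m v) = v^T *m v.
      rewrite mulmxA -(mulmxA v^T) (_ : v *m v^T = 1%:M) ?mulmx1 //.
      apply/matrixP => a b; rewrite !ord1 [RHS]mxE eqxx.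
      by move: v1; rewrite /qform mulmx1.
    rewrite opprB -addrA -[in LHS]scalerBl opprB addrA; apply/eqP.
    rewrite -subr_eq0 opprB addrA; apply/eqP/matrixP => a b; rewrite !mxE; ring.
  have uS : S \in unitmx.
    rewrite unitmxE /S -scaleNr scalemxAl det_rank1 ?det1 ?oner_eq0 //.
    rewrite adj1 mulmx1 -scalemxAr mxE.
    have -> : (v *m v^T) 0 0 = 1 by move: v1; rewrite /qform mulmx1.
    by rewrite mulr1 opprB addrCA addrN addr0 unitfE.
  have := H (S *m A *m S); rewrite elsym_conj // SS elsym_rank1 //.
  have -> : elsym i A + (1 - d ^+ 2) * (qform v (newton i A) - elsym i A) =
    qform v (newton i A) + d ^+ 2 * (elsym i A - qform v (newton i A)) by ring.
  apply; first by rewrite !trmx_mul sS sA mulmxA.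
  by move=> u; have := pA (u *m S); rewrite /qform trmx_mul sS !mulmxA.
move: main; set t : R := qform _ _; set w : R := elsym i A; move=> main {H sA pA v1}.
apply/andP; split.
- rewrite leNgt; apply/negP => t0.
  have h1 := main 1 (oner_neq0 _).
  have wt : 0 < w - t by lra.
  (* Chosen so that d2 (w - t) = - t / 2. After capping at 1 the square is no larger, and t + d^2 (w
     - t) <= t / 2 < 0. *)
  pose d2 : R := (- t) / (2 * (w - t) ).
  have := main (Num.min 1 d2).
  have d20 : 0 < d2 by apply: divr_gt0; lra.
  have m0 : 0 < Num.min 1 d2 by rewrite lt_min d20 ltr01.
  move=> /(_ (lt0r_neq0 m0)).
  have m1 : Num.min 1 d2 <= 1 by rewrite ge_min lexx.
  have m2 : Num.min 1 d2 <= d2 by rewrite ge_min lexx orbT.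
  have m3 : Num.min 1 d2 ^+ 2 * (w - t) <= d2 * (w - t).
    rewrite ler_pM2r // expr2; apply: le_trans m2.
    by rewrite ler_piMr // ltW.
  have e : d2 * (w - t) = - t / 2 by rewrite /d2; field; lra.
  lra.
- rewrite leNgt; apply/negP => t0.
  have h1 := main 1 (oner_neq0 _).
  have tp : 0 <= t.
    rewrite leNgt; apply/negP => tn; lra.
  (* Since d >= 1, d^2 (t - w) >= d (t - w) = (t - w) + t > t, which contradicts [main]. *)
  pose d : R := 1 + t / (t - w).
  have d1 : 1 <= d by rewrite lerDl divr_ge0 //; lra.
  have /main : d != 0 by lra.
  have : d <= d ^+ 2 by rewrite expr2 ler_peMr //; lra.
  have e : d * (t - w) = t - w + t by rewrite /d; field; lra.
  have : 0 < t - w by lra.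
  nra.
Qed.

End Rank1.

Lemma horner_cofactor (R : comNzRingType) n (A : 'M[R]_n) (l : R) j k :
  (cofactor (char_poly_mx A) j k).[l] = cofactor (l%:M - A) j k.
Proof.
rewrite -[LHS]/(horner_eval l _) -cofactor_map_mx; congr (cofactor _ j k).
apply/matrixP => a b; rewrite !mxE /=.
by rewrite rmorphB rmorphMn /= !horner_evalE hornerC hornerX.
Qed.

(** The crude bound n + 1 suffices: it only fixes how many coefficients are kept when a polynomial
    is recovered from its values. *)
Lemma size_cofactor_char_poly (R : idomainType) n (A : 'M[R]_n) j k :
  (size (cofactor (char_poly_mx A) j k) <= n.+1)%N.
Proof.
rewrite expand_cofactor; apply: leq_trans (size_sum _ _ _) _.
apply/bigmax_leqP => s _.
rewrite size_Msign; apply: leq_trans (size_poly_prod_leq _ _) _.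
apply: (@leq_trans ((\sum_(i | j != i) 2).+1 - #|[pred i | j != i]|)).
  apply: leq_sub => //; rewrite ltnS; apply: leq_sum => a _.
  rewrite !mxE; apply: leq_trans (size_polyD _ _) _.
  rewrite size_polyN geq_max; apply/andP; split.
    by case: eqP => _; rewrite ?mulr1n ?size_polyX // mulr0n size_poly0.
  by apply: leq_trans (size_polyC_leq1 _) _.
rewrite sum_nat_const muln2 -addnn -addSn addnK ltnS.
by apply: leq_trans (max_card _) _; rewrite card_ord.
Qed.

(** * Continuity and compact support on row vectors *)

Section RowNorm.
Variables (R : realType) (n : nat).
Implicit Types x y : 'rV[R]_n.

Lemma rV_coord_le x j : `|x 0 j| <= `|x|.
Proof.
rewrite [leRHS]/Num.norm /= mx_normrE; apply/bigmax_geP; right => /=.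
by exists (0, j) => //; rewrite mem_enum.
Qed.

Lemma rV_norm_le x (c : R) : 0 <= c -> (forall j, `|x 0 j| <= c) -> `|x| <= c.
Proof.
move=> c0 h; rewrite [leLHS]/Num.norm /= mx_normrE; apply/bigmax_leP; split => //= -[i j] _.
by rewrite ord1 h.
Qed.

Lemma rV_norm_lt x (c : R) : 0 < c -> (forall j, `|x 0 j| < c) -> `|x| < c.
Proof.
move=> c0 h; rewrite [ltLHS]/Num.norm /= mx_normrE; apply/bigmax_ltP; split => //= -[i j] _.
by rewrite ord1 h.
Qed.

Lemma rV_continuousP (f : 'rV[R]_n -> R) :
  continuous f <-> forall x (e : R), 0 < e ->
    exists2 d : R, 0 < d & forall y, `|x - y| < d -> `|f x - f y| < e.
Proof.
split=> [cf x e e0|h x].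
  have /cvgrPdist_lt/(_ e e0) := cf x.
  by move=> /nbhs_ballP[d /= d0 hd]; exists d => // y xy; apply: hd; rewrite -ball_normE.
apply/(@cvgrPdist_lt _ _ _ (nbhs x)) => e e0; have [d d0 hd] := h x e e0.
by apply/nbhs_ballP; exists d => //= y; rewrite -ball_normE /= => xy; exact: hd.
Qed.

Lemma compact_rV_ball (r : R) : compact [set x : 'rV[R]_n | `|x| <= r].
Proof.
apply: bounded_closed_compact.
  by exists r; split; [exact: num_real|move=> M rM x /= /le_trans -> //; exact: ltW].
apply: (@closed_comp _ _ (fun x : 'rV[R]_n => `|x|) [set t | t <= r]).
  by move=> x _; exact: norm_continuous.
exact: closed_le.
Qed.

(** Only x is confined to the ball and y is any nearby point, so a small shift that leaves the ball
    needs no separate case. *)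
Lemma ucont (f : 'rV[R]_n -> R) : continuous f -> forall r e : R, 0 < e ->
  exists2 d : R, 0 < d & forall x y, `|x| <= r -> `|x - y| < d -> `|f x - f y| < e.
Proof.
move=> /rV_continuousP cf r e e0.
have /compact_near_coveringP := @compact_rV_ball r.
move=> /(_ R (0:R)^'+ (fun d x => forall y, `|x - y| < d -> `|f x - f y| < e) _).
case.
  move=> x /= _; have [d d0 hd] := cf x (e / 2) ltac:(lra).
  exists (ball x (d / 2), [set t | t < d / 2]) => /=.
    split; first by apply: nbhsx_ballx; lra.
    by apply: nbhs_right_lt; lra.
  move=> [x' t] /= [xx' td] y x'y.
  have h1 : `|f x - f x'| < e / 2 by apply: hd; move: xx'; rewrite -ball_normE /=; lra.
  have h2 : `|f x - f y| < e / 2.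
    apply: hd; move: xx'; rewrite -ball_normE /= => xx'.
    have := ler_normD (x - x') (x' - y); rewrite addrA subrK; lra.
  have := ler_normD (f x' - f x) (f x - f y); rewrite addrA subrK (distrC (f x') (f x)); lra.
move=> d /= d0 hd; exists (d / 2); first by rewrite divr_gt0.
move=> x y xr xy; apply: (hd (d / 2)) => //=; rewrite ?divr_gt0 //.
by rewrite /ball /= sub0r normrN gtr0_norm ?divr_gt0 //; lra.
Qed.

Lemma bounded_on_ball (f : 'rV[R]_n -> R) : continuous f -> forall r : R,
  exists2 M : R, 0 < M & forall x, `|x| <= r -> `|f x| <= M.
Proof.
move=> cf r.
have cf' : {within [set x : 'rV[R]_n | `|x| <= r], continuous f}.
  by apply: continuous_subspaceT.
have /compact_bounded[M [_ hM]] := continuous_compact cf' (@compact_rV_ball r).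
exists (`|M| + 1) => [|x xr]; first by rewrite ltr_pwDr.
by apply: (hM (`|M| + 1)); [rewrite ltr_pwDr // ler_norm|exists x].
Qed.

End RowNorm.

(** The norm of a row vector is the supremum norm. It passes to slices without constants, which
    suits an integral iterated over the coordinates. *)
Definition Cc (R : realType) n (F : 'rV[R]_n -> R) :=
  continuous F /\ exists r : R, forall x, r < `|x| -> F x = 0.

(** * Integrals of compactly supported continuous functions on the line *)

Section Line.
Variable R : realType.
Local Notation mu := (@lebesgue_measure R).
Implicit Types f g : R -> R.

Definition Cc1 f := continuous f /\ exists r : R, forall x, r < `|x| -> f x = 0.

Definition lineint f : R := Rintegral mu setT f.

Lemma Cc1_patch f r : (forall x, r < `|x| -> f x = 0) ->
  (f \_ `[- r, r]%classic)%R = f.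
Proof.
move=> h; apply/funext => x; rewrite patchE.
case: ifPn => // /negP xr; apply/esym/h; rewrite ltNge; apply/negP => hx; apply: xr.
by rewrite inE /= in_itv /= -ler_norml.
Qed.

Lemma Cc1_integrable f : Cc1 f -> mu.-integrable setT (EFin \o f).
Proof.
move=> [cf [r hr]].
have : mu.-integrable `[- r, r] (EFin \o f).
  apply: continuous_compact_integrable; first exact: segment_compact.
  exact: continuous_subspaceT.
move/integrable_mkcond => /(_ (measurable_itv _)).
by rewrite restrict_EFin Cc1_patch.
Qed.

Lemma lineint_integral f : Cc1 f -> (\int[mu]_x (f x)%:E = (lineint f)%:E)%E.
Proof.
move=> cf; rewrite /lineint /Rintegral fineK //.
by apply: integrable_fin_num => //; exact: Cc1_integrable.
Qed.

Lemma Cc1D f g a : Cc1 f -> Cc1 g -> Cc1 (fun x => a * f x + g x).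
Proof.
move=> [cf [r hr]] [cg [s hs]]; split.
  by move=> x; apply: cvgD; [apply: cvgM; [exact: cvg_cst|exact: cf]|exact: cg].
exists (Num.max r s) => x; rewrite gt_max => /andP[xr xs].
by rewrite hr // hs // mulr0 addr0.
Qed.

Lemma lineintD f g a : Cc1 f -> Cc1 g ->
  lineint (fun x => a * f x + g x) = a * lineint f + lineint g.
Proof.
move=> cf cg; have caf : mu.-integrable setT (EFin \o (fun x => a * f x)).
  have := integrableZl measurableT a (Cc1_integrable cf).
  by apply: eq_integrable => // x _; rewrite /= EFinM.
rewrite /lineint RintegralD //; last exact: Cc1_integrable.
by rewrite RintegralZl //; exact: Cc1_integrable.
Qed.

Lemma lineint_ge0 f : (forall x, 0 <= f x) -> 0 <= lineint f.
Proof. by move=> h; apply: Rintegral_ge0 => x _. Qed.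

Lemma lineint_le f r M : 0 <= r -> Cc1 f -> (forall x, r < `|x| -> f x = 0) ->
  (forall x, `|f x| <= M) -> `|lineint f| <= 2 * r * M.
Proof.
move=> r0 cf hr hM; rewrite /lineint -(Cc1_patch hr) -Rintegral_mkcond.
have iI (g : R -> R) : continuous g -> mu.-integrable `[- r, r] (EFin \o g).
  move=> cg; apply: continuous_compact_integrable; first exact: segment_compact.
  exact: continuous_subspaceT.
apply: le_trans (le_normr_Rintegral _ _) _ => //; first by apply: iI; case: cf.
apply: le_trans (_ : \int[mu]_(x in `[- r, r]) M <= _).
  apply: le_Rintegral => //; apply: iI => x; last exact: cvg_cst.
  by apply: continuous_comp; [case: cf => + _; apply|exact: norm_continuous].
rewrite Rintegral_cst //; have := lebesgue_measure_itv `[- r, r]; rewrite /= => ->.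
rewrite lte_fin; case: ltP => h.
  by rewrite -EFinB /= opprK le_eqVlt; apply/orP; left; apply/eqP; ring.
by rewrite mulr0 mulr_ge0 // ?mulr_ge0 //; apply: le_trans (hM 0).
Qed.

Lemma Cc1_shift f a : Cc1 f -> Cc1 (fun x => f (x + a)).
Proof.
move=> [cf [r hr]]; split.
  move=> x; apply: (@continuous_comp _ _ _ (fun x => x + a) f); last exact: cf.
  by apply: cvgD; [exact: cvg_id|exact: cvg_cst].
exists (r + `|a|) => x h; apply: hr.
by have := ler_normD (x + a) (- a); rewrite addrK normrN; lra.
Qed.

(** Substitution is applied to nonnegative functions; f is the difference of max(f, 0) and max(f, 0)
    - f, both of which stay in the class. *)
Lemma lineint_shift f a : Cc1 f -> lineint (fun x => f (x + a)) = lineint f.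
Proof.
have pos g : Cc1 g -> (forall x, 0 <= g x) -> lineint (fun x => g (x + a)) = lineint g.
  move=> [cg _] g0; rewrite /lineint /Rintegral; congr fine; apply/esym.
  have d1 : derive1 (fun x : R => x + a) = cst 1.
    apply/funext => x; rewrite derive1E deriveD // derive_id derive_cst addr0 //.
  rewrite (@increasing_ge0_integration_by_substitutionT _ (fun x => x + a)) //.
  - by apply: eq_integral => x _; rewrite d1 /= mulr1.
  - by move=> x y; rewrite ltrD2r.
  - by rewrite d1; exact: cst_continuous.
  - by rewrite d1; exact: is_cvg_cst.
  - by rewrite d1; exact: is_cvg_cst.
  - apply/cvgrNyPle => A; near=> x.
    by rewrite -lerBrDr; near: x; exact: nbhs_ninfty_le (num_real _).
  - apply/cvgryPge => A; near=> x.
    by rewrite -lerBlDr; near: x; exact: nbhs_pinfty_ge (num_real _).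
move=> cf.
have cmax : Cc1 (fun x => Num.max (f x) 0).
  case: cf => cf [r hr]; split; last by exists r => x /hr ->; rewrite maxxx.
  by move=> x; apply: (@continuous_max _ _ f (cst 0)); [exact: cf|exact: cvg_cst].
have cdif : Cc1 (fun x => -1 * f x + Num.max (f x) 0) by exact: Cc1D.
have h1 := pos _ cmax (fun x => ltac:(by rewrite le_max lexx orbT)).
have h2 : lineint (fun x => -1 * f (x + a) + Num.max (f (x + a)) 0) = 
    lineint (fun x => -1 * f x + Num.max (f x) 0).
  apply: (pos _ cdif) => x; rewrite mulN1r addrC subr_ge0 le_max lexx //.
have h3 := lineintD (-1) (Cc1_shift a cf) (Cc1_shift a cmax).
have h4 := lineintD (-1) cf cmax.
by move: h2; rewrite /= in h3 *; rewrite h3 h4 h1; lra.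
Unshelve. all: end_near. Qed.

End Line.

Section ContinuityRules.
Variables (R : realType) (T : topologicalType).
Implicit Types f g : T -> R.

Lemma rV_contD f g : continuous f -> continuous g -> continuous (fun x => f x + g x).
Proof. by move=> cf cg x; apply: continuousD; [exact: cf|exact: cg]. Qed.

Lemma rV_contB f g : continuous f -> continuous g -> continuous (fun x => f x - g x).
Proof. by move=> cf cg x; apply: continuousB; [exact: cf|exact: cg]. Qed.

Lemma rV_contM f g : continuous f -> continuous g -> continuous (fun x => f x * g x).
Proof. by move=> cf cg x; apply: continuousM; [exact: cf|exact: cg]. Qed.

Lemma rV_contN f : continuous f -> continuous (fun x => - f x).
Proof. by move=> cf x; apply: continuousN; exact: cf. Qed.

Lemma rV_cont_cst (c : R) : continuous (fun _ : T => c).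
Proof. by move=> x; exact: cst_continuous. Qed.

Lemma rV_cont_max f g : continuous f -> continuous g ->
  continuous (fun x => Num.max (f x) (g x)).
Proof. by move=> cf cg x; apply: continuous_max; [exact: cf|exact: cg]. Qed.

Lemma rV_cont_comp f (h : R -> R) : continuous f -> continuous h ->
  continuous (fun x => h (f x)).
Proof. by move=> cf ch x; apply: (@continuous_comp _ _ _ f h); [exact: cf|exact: ch]. Qed.

Lemma rV_cont_sum (I : Type) (s : seq I) (P : pred I) (F : I -> T -> R) :
  (forall i, continuous (F i)) -> continuous (fun x => \sum_(i <- s | P i) F i x).
Proof.
move=> cF; elim: s => [|i s IH].
  by under eq_fun do rewrite big_nil; exact: rV_cont_cst.
under eq_fun do rewrite big_cons; case: (P i) => //; exact: rV_contD.
Qed.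

Lemma rV_contX f k : continuous f -> continuous (fun x => f x ^+ k).
Proof.
move=> cf; elim: k => [|k IH]; first by under eq_fun do rewrite expr0; exact: rV_cont_cst.
by under eq_fun do rewrite exprS; exact: rV_contM.
Qed.

Lemma rV_contV f : (forall x, f x != 0) -> continuous f -> continuous (fun x => (f x)^-1).
Proof. by move=> f0 cf x; apply: (@continuousV _ _ f); [exact: f0|exact: cf]. Qed.

End ContinuityRules.

Section RowContinuity.
Variables (R : realType) (n : nat).
Implicit Types f : 'rV[R]_n -> R.

Lemma rV_cont_coord j : continuous (fun x : 'rV[R]_n => x 0 j).
Proof. by move=> x; exact: coord_continuous. Qed.

Lemma rV_cont_shift f (b : 'rV[R]_n) : continuous f -> continuous (fun x : 'rV[R]_n => f (x + b)).
Proof.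
move=> cf x; apply: (@continuous_comp _ _ _ (fun x : 'rV[R]_n => x + b) f); last exact: cf.
by apply: continuousD; [move=> A; exact|exact: cst_continuous].
Qed.

End RowContinuity.

(** * The iterated Lebesgue integral on compactly supported functions *)

Section Functional.
Variable R : realType.

Definition II n (F : 'rV[R]_n -> R) : R := fine (leb_int (fun x => (F x)%:E)).

Definition rcons0 m (t : R) (v : 'rV[R]_m) : 'rV[R]_m.+1 :=
  row_mx (t%:M : 'M[R]_1) v.

Definition slice m (F : 'rV[R]_m.+1 -> R) (t : R) (v : 'rV[R]_m) := F (rcons0 t v).

Lemma rcons0_0 m t (v : 'rV[R]_m) : rcons0 t v 0 0 = t.
Proof.
transitivity ((t%:M : 'M[R]_1) 0 0); last by rewrite mxE eqxx mulr1n.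
by rewrite -(row_mxEl (t%:M : 'M[R]_1) v 0 0); congr (rcons0 _ _ _ _); exact: val_inj.
Qed.

Lemma rcons0_S m t (v : 'rV[R]_m) j : rcons0 t v 0 (lift 0 j) = v 0 j.
Proof.
by rewrite -(row_mxEr (t%:M : 'M[R]_1) v 0 j); congr (rcons0 _ _ _ _); exact: val_inj.
Qed.

Lemma rcons0_surj m (x : 'rV[R]_m.+1) : x = rcons0 (x 0 0) (\row_j x 0 (lift 0 j)).
Proof.
by apply/rowP => j; case: (unliftP 0 j) => [k ->|->]; rewrite ?rcons0_S ?rcons0_0 ?mxE.
Qed.

Lemma rcons0B m t s (v u : 'rV[R]_m) : rcons0 t v - rcons0 s u = rcons0 (t - s) (v - u).
Proof.
apply/rowP => j; rewrite [LHS]mxE [X in _ + X]mxE.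
by case: (unliftP 0 j) => [k ->|->]; rewrite ?rcons0_S ?rcons0_0 ?mxE.
Qed.

Lemma rcons0D m t s (v u : 'rV[R]_m) : rcons0 t v + rcons0 s u = rcons0 (t + s) (v + u).
Proof.
apply/rowP => j; rewrite [LHS]mxE.
by case: (unliftP 0 j) => [k ->|->]; rewrite ?rcons0_S ?rcons0_0 ?mxE.
Qed.

Lemma rcons0_norm_lt m t (v : 'rV[R]_m) (c : R) : `|t| < c -> `|v| < c -> `|rcons0 t v| < c.
Proof.
move=> tc vc; have c0 : 0 < c by apply: le_lt_trans tc.
apply: rV_norm_lt => // j; case: (unliftP 0 j) => [k ->|->]; last by rewrite rcons0_0.
by rewrite rcons0_S; apply: le_lt_trans vc; exact: rV_coord_le.
Qed.

Lemma rcons0_norm1 m t (v : 'rV[R]_m) : `|t| <= `|rcons0 t v|.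
Proof. by rewrite -{1}(rcons0_0 t v); exact: rV_coord_le. Qed.

Lemma rcons0_norm2 m t (v : 'rV[R]_m) : `|v| <= `|rcons0 t v|.
Proof.
by apply: rV_norm_le => // j; rewrite -(rcons0_S t v); exact: rV_coord_le.
Qed.

Lemma Cc_slice m (F : 'rV[R]_m.+1 -> R) t : Cc F -> Cc (slice F t).
Proof.
move=> [/rV_continuousP cF [r hr]]; split.
  apply/rV_continuousP => x e e0; have [d d0 hd] := cF (rcons0 t x) e e0.
  exists d => // y xy; apply: hd; rewrite rcons0B subrr.
  by apply: rcons0_norm_lt; rewrite ?normr0.
exists r => v rv; apply: hr; apply: lt_le_trans rv _; exact: rcons0_norm2.
Qed.

Lemma CcD n (F G : 'rV[R]_n -> R) a : Cc F -> Cc G -> Cc (fun x => a * F x + G x).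
Proof.
move=> [cf [r hr]] [cg [s hs]]; split.
  by apply: rV_contD => //; apply: rV_contM => //; exact: rV_cont_cst.
exists (Num.max r s) => x; rewrite gt_max => /andP[xr xs].
by rewrite hr // hs // mulr0 addr0.
Qed.

Lemma Cc_supp n (F : 'rV[R]_n -> R) : Cc F ->
  exists2 r : R, 0 <= r & forall x, r < `|x| -> F x = 0.
Proof.
move=> [_ [r hr]]; exists (Num.max r 0) => [|x]; first by rewrite le_max lexx orbT.
by rewrite gt_max => /andP[/hr].
Qed.

(** Finiteness, linearity and the supremum bound go through the induction on the dimension together:
    the integral over slices is continuous in t because linearity and the bound apply to the
    difference of two slices, and this continuity gives finiteness one dimension up. *)
Definition II_spec n :=
 (forall F : 'rV[R]_n -> R, Cc F -> leb_int (fun x => (F x)%:E) = (II F)%:E) /\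
 (forall a (F G : 'rV[R]_n -> R), Cc F -> Cc G ->
    II (fun x => a * F x + G x) = a * II F + II G) /\
 (forall (F : 'rV[R]_n -> R) (r M : R), 0 <= r -> Cc F ->
    (forall x, r < `|x| -> F x = 0) -> (forall x, `|F x| <= M) ->
    `|II F| <= (2 * r) ^+ n * M).

Section Step.
Variables (m : nat).
Hypothesis spec : II_spec m.

Lemma slice_int_Cc1 (F : 'rV[R]_m.+1 -> R) : Cc F -> Cc1 (fun t => II (slice F t)).
Proof.
move=> cF; have [_ [lin bnd]] := spec; split; last first.
  have [r r0 hr] := Cc_supp cF; exists r => t rt.
  have := bnd (slice F t) r 0 r0 (Cc_slice t cF).
  rewrite mulr0 normr_le0 => h; apply/eqP/h => x.
    by move=> rx; apply: hr; apply: lt_le_trans rt _; exact: rcons0_norm1.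
  by rewrite /slice hr ?normr0 //; apply: lt_le_trans rt _; exact: rcons0_norm1.
move=> t; apply/(@cvgrPdist_lt _ _ _ (nbhs t)) => e e0.
have [r r0 hr] := Cc_supp cF.
pose C : R := (2 * r) ^+ m; have C0 : 0 <= C by rewrite exprn_ge0 // mulr_ge0.
have e1 : 0 < e / (C + 1) by rewrite divr_gt0 // ltr_wpDl.
have [d d0 hd] := ucont (proj1 cF) (Num.max (`|t|) r + 1) e1.
apply/nbhs_ballP; exists d => //= s; rewrite -ball_normE /= => ts.
have -> : II (slice F t) - II (slice F s) = II (fun v => -1 * slice F s v + slice F t v).
  by rewrite lin; [ring|exact: Cc_slice..].
apply: le_lt_trans (bnd _ r (e / (C + 1)) r0 _ _ _) _.
- by apply: CcD; exact: Cc_slice.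
- move=> x rx; have h u : r < `|rcons0 u x| by apply: lt_le_trans rx (rcons0_norm2 _ _).
  by rewrite /slice !hr // mulr0 addr0.
- move=> x; rewrite mulN1r addrC; have [xr|xr] := leP `|x| r.
    apply/ltW/hd.
      apply/ltW; apply: rcons0_norm_lt; first by rewrite ltr_pwDr // le_max lexx.
      by rewrite ltr_pwDr // le_max xr orbT.
    by rewrite rcons0B subrr; apply: rcons0_norm_lt; rewrite ?normr0.
  have h u : r < `|rcons0 u x| by apply: lt_le_trans xr (rcons0_norm2 _ _).
  by rewrite /slice !hr // subrr normr0 ltW.
rewrite -/C mulrCA -[ltRHS]mulr1 ltr_pM2l // ltr_pdivrMr ?ltr_wpDl // mul1r.
by rewrite ltrDl.
Qed.

Lemma leb_intS (F : 'rV[R]_m.+1 -> R) : Cc F ->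
  leb_int (fun x => (F x)%:E) = (lineint (fun t => II (slice F t)))%:E.
Proof.
move=> cF; have [fin _] := spec.
rewrite -(lineint_integral (slice_int_Cc1 cF)) /=; apply: eq_integral => t _.
by rewrite -fin //; exact: Cc_slice.
Qed.

Lemma II_S (F : 'rV[R]_m.+1 -> R) : Cc F -> II F = lineint (fun t => II (slice F t)).
Proof. by move=> cF; rewrite /II leb_intS. Qed.

Lemma II_specS : II_spec m.+1.
Proof.
have [fin [lin bnd]] := spec; split; first by move=> F cF; rewrite /II leb_intS.
split=> [a F G cF cG|F r M r0 cF hr hM].
  rewrite !II_S //; last exact: CcD.
  rewrite -lineintD; [|exact: slice_int_Cc1..].
  by congr lineint; apply/funext => t; rewrite -lin //; exact: Cc_slice.
rewrite II_S // exprS -mulrA; apply: lineint_le => //.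
- exact: slice_int_Cc1.
- move=> t rt; have := bnd (slice F t) r 0 r0 (Cc_slice t cF).
  have h x : r < `|rcons0 t x| by apply: lt_le_trans rt _; exact: rcons0_norm1.
  rewrite mulr0 normr_le0 => h1; apply/eqP/h1 => x; first by rewrite /slice hr.
  by rewrite /slice hr ?normr0.
- move=> t; apply: bnd => //; [exact: Cc_slice| |by move=> x; exact: hM].
  by move=> x rx; apply: hr; apply: lt_le_trans rx _; exact: rcons0_norm2.
Qed.

End Step.

Lemma II_specP n : II_spec n.
Proof.
elim: n => [|m IH]; last exact: II_specS.
split=> [//|]; split=> [//|F r M r0 cF _ hM].
by rewrite expr0 mul1r; exact: hM.
Qed.

Lemma leb_intE n (F : 'rV[R]_n -> R) : Cc F -> leb_int (fun x => (F x)%:E) = (II F)%:E.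
Proof. by have [h _] := II_specP n; exact: h. Qed.

Lemma II_lin n (F G : 'rV[R]_n -> R) a : Cc F -> Cc G ->
  II (fun x => a * F x + G x) = a * II F + II G.
Proof. by have [_ [h _]] := II_specP n; exact: h. Qed.

Lemma II_bound n (F : 'rV[R]_n -> R) (r M : R) : 0 <= r -> Cc F ->
    (forall x, r < `|x| -> F x = 0) -> (forall x, `|F x| <= M) ->
    `|II F| <= (2 * r) ^+ n * M.
Proof. by have [_ [_ h]] := II_specP n; exact: h. Qed.

Lemma II_ge0 n (F : 'rV[R]_n -> R) : Cc F -> (forall x, 0 <= F x) -> 0 <= II F.
Proof.
elim: n F => [|n IH] F cF h; first exact: h.
rewrite (II_S (II_specP n)) //; apply: lineint_ge0 => t.
by apply: IH => [|x]; [exact: Cc_slice|exact: h].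
Qed.

Lemma II_shift n (F : 'rV[R]_n -> R) a : Cc F -> II (fun x => F (x + a)) = II F.
Proof.
have cs k (G : 'rV[R]_k -> R) b : Cc G -> Cc (fun x => G (x + b)).
  move=> [cf [r hr]]; split.
    exact: rV_cont_shift.
  exists (r + `|b|) => x h; apply: hr.
  by have := ler_normD (x + b) (- b); rewrite addrK normrN; lra.
elim: n F a => [|n IH] F a cF.
  by rewrite /II /= (_ : 0 + a = 0) //; apply/rowP; case.
rewrite !(II_S (II_specP n)) //; last exact: cs.
rewrite [a]rcons0_surj; set b := a 0 0; set c := \row_j _.
rewrite -[RHS](lineint_shift b); last by apply: slice_int_Cc1 => //; exact: II_specP.
congr lineint; apply/funext => t; rewrite -[RHS](IH _ c); last exact: Cc_slice.
by congr II; apply/funext => v; rewrite /slice rcons0D.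
Qed.

Lemma Cc0 n : Cc (fun _ : 'rV[R]_n => 0 : R).
Proof. by split; [exact: rV_cont_cst|exists 0]. Qed.

Lemma II0 n : II (fun _ : 'rV[R]_n => 0) = 0.
Proof.
have := II_lin 1 (Cc0 n) (Cc0 n); rewrite mulr0 addr0 mul1r.
by move/eqP; rewrite -subr_eq subrr eq_sym => /eqP.
Qed.

Lemma IIZ n (F : 'rV[R]_n -> R) a : Cc F -> II (fun x => a * F x) = a * II F.
Proof.
move=> cF; have := II_lin a cF (Cc0 n); rewrite II0 addr0 => <-.
by congr II; apply/funext => x; rewrite addr0.
Qed.

Lemma IID n (F G : 'rV[R]_n -> R) : Cc F -> Cc G -> II (fun x => F x + G x) = II F + II G.
Proof.
move=> cF cG; have := II_lin 1 cF cG; rewrite mul1r => <-.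
by congr II; apply/funext => x; rewrite mul1r.
Qed.

Lemma IIB n (F G : 'rV[R]_n -> R) : Cc F -> Cc G -> II (fun x => F x - G x) = II F - II G.
Proof.
move=> cF cG; have := II_lin (-1) cG cF; rewrite mulN1r addrC => <-.
by congr II; apply/funext => x; rewrite mulN1r addrC.
Qed.

Lemma CcZ n (F : 'rV[R]_n -> R) a : Cc F -> Cc (fun x => a * F x).
Proof.
move=> cF; have := CcD a cF (Cc0 n).
by congr Cc; apply/funext => x; rewrite addr0.
Qed.

Lemma CcA n (F G : 'rV[R]_n -> R) : Cc F -> Cc G -> Cc (fun x => F x + G x).
Proof.
move=> cF cG; have := CcD 1 cF cG.
by congr Cc; apply/funext => x; rewrite mul1r.
Qed.

Lemma CcB n (F G : 'rV[R]_n -> R) : Cc F -> Cc G -> Cc (fun x => F x - G x).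
Proof.
move=> cF cG; have := CcD (-1) cG cF.
by congr Cc; apply/funext => x; rewrite mulN1r addrC.
Qed.

Lemma Cc_mul n (F G : 'rV[R]_n -> R) : Cc F -> continuous G -> Cc (fun x => F x * G x).
Proof.
move=> [cf [r hr]] cg; split; first exact: rV_contM.
by exists r => x /hr ->; rewrite mul0r.
Qed.

Lemma Cc_shift n (G : 'rV[R]_n -> R) b : Cc G -> Cc (fun x => G (x + b)).
Proof.
move=> [cf [r hr]]; split.
  exact: rV_cont_shift.
exists (r + `|b|) => x h; apply: hr.
by have := ler_normD (x + b) (- b); rewrite addrK normrN; lra.
Qed.

Lemma Cc_sum n (I : Type) (s : seq I) (F : I -> 'rV[R]_n -> R) :
  (forall i, Cc (F i)) -> Cc (fun x => \sum_(i <- s) F i x).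
Proof.
move=> cF; elim: s => [|i s IH].
  by have := Cc0 n; congr Cc; apply/funext => x; rewrite big_nil.
by have := CcA (cF i) IH; congr Cc; apply/funext => x; rewrite big_cons.
Qed.

Lemma II_sum n (I : Type) (s : seq I) (F : I -> 'rV[R]_n -> R) :
  (forall i, Cc (F i)) -> II (fun x => \sum_(i <- s) F i x) = \sum_(i <- s) II (F i).
Proof.
move=> cF; elim: s => [|i s IH].
  by rewrite big_nil -[RHS](II0 n); congr II; apply/funext => x; rewrite big_nil.
rewrite big_cons -IH -IID //; last exact: Cc_sum.
by congr II; apply/funext => x; rewrite big_cons.
Qed.

Lemma le_II n (F G : 'rV[R]_n -> R) : Cc F -> Cc G -> (forall x, F x <= G x) -> II F <= II G.
Proof.
move=> cF cG h; rewrite -subr_ge0 -IIB //; apply: II_ge0; first exact: CcB.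
by move=> x; rewrite subr_ge0.
Qed.

Lemma II_norm_le n (F G : 'rV[R]_n -> R) : Cc F -> Cc G -> (forall x, `|F x| <= G x) ->
  `|II F| <= II G.
Proof.
move=> cF cG h; rewrite ler_norml; apply/andP; split.
  rewrite -[leLHS]mulN1r -IIZ //; apply: le_II => //; first exact: CcZ.
  by move=> x; have := h x; rewrite ler_norml mulN1r => /andP[].
by apply: le_II => // x; have := h x; rewrite ler_norml => /andP[].
Qed.

End Functional.

(** * Differentiability classes and convolution *)

Section Calculus.
Variables (R : realType) (n : nat).
Local Notation V := 'rV[R]_n.
Local Notation e_ j := (@evec R n j).
Implicit Types (f g Y : V -> R) (x v : V).

Lemma line_is_derive f x v (s : R) : derivable f (x + s *: v) v ->
  is_derive s (1 : R) (fun t : R => f (x + t *: v)) ('D_v f (x + s *: v)).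
Proof.
move=> df.
have E : (fun h : R => h^-1 *: (f (x + (h *: (1 : R) + s) *: v) - f (x + s *: v))) =
  (fun h : R => h^-1 *: (f (h *: v + (x + s *: v)) - f (x + s *: v))).
  apply/funext => h; congr (_ *: (f _ - _)).
  by rewrite scalerDl [h *: 1]mulr1 addrCA.
by split; rewrite /derivable /derive /= E //.
Qed.

Lemma mvt_line f x v (h : R) : (forall y, derivable f y v) -> 0 < h ->
  exists2 t : R, 0 < t < h & f (x + h *: v) - f x = h * 'D_v f (x + t *: v).
Proof.
move=> df h0.
have [||t /andP[t0 th]] := @MVT R (fun t => f (x + t *: v)) (fun t => 'D_v f (x + t *: v)) 0 h h0.
- by move=> t _; exact: line_is_derive.
- apply: derivable_within_continuous => t _.
  by have [] := line_is_derive (df (x + t *: v)).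
rewrite subr0 scale0r addr0 mulrC => ->.
by exists t => //; move: t0 th; rewrite !bnd_simp => -> ->.
Qed.

Lemma mvt_line_norm f x v (h : R) : (forall y, derivable f y v) ->
  exists2 t : R, `|t| <= `|h| & f (x + h *: v) - f x = h * 'D_v f (x + t *: v).
Proof.
move=> df; have [h0|h0|->] := ltrgtP h 0.
- have nh0 : 0 < - h by rewrite oppr_gt0.
  have [t /andP[t0 th] e] := mvt_line (x + h *: v) df nh0.
  exists (h + t); first by rewrite (ltr0_norm h0) ler_norml; apply/andP; split; lra.
  move: e; rewrite scaleNr addrK -addrA -scalerDl mulNr => /eqP.
  by rewrite -eqr_opp opprB opprK => /eqP.
- have [t /andP[t0 th] e] := mvt_line x df h0; exists t => //.
  by rewrite !gtr0_norm // ltW.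
- by exists 0 => //; rewrite scale0r addr0 subrr mul0r.
Qed.

Definition der1 f v := (forall x, derivable f x v) /\ continuous ('D_v f).

Lemma Cc_derive Y v : Cc Y -> der1 Y v -> Cc ('D_v Y).
Proof.
move=> [cY [r hr]] [dY cdY]; split => //; exists r => x rx.
have : (\forall y \near x, Y y = 0).
  have : (\forall y \near x, r < `|y|).
    by apply: (@cvgr_norm_gt _ _ _ (nbhs x) _ id x) => //.
  by apply: filterS => y /hr.
move=> /(near_eq_derive v) ->; exact: derive_cst.
Qed.

(** By the mean value theorem the quotient is a value of ['D_v Y] near x, and this derivative is
    uniformly continuous because its support is compact. *)
Lemma diff_quot Y v : Cc Y -> der1 Y v -> forall e : R, 0 < e ->
  exists2 d : R, 0 < d & forall h : R, h != 0 -> `|h| < d -> forall x,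
    `|h^-1 * (Y (x + h *: v) - Y x) - 'D_v Y x| <= e.
Proof.
move=> cY dY e e0; have cD := Cc_derive cY dY.
have [r r0 hr] := Cc_supp cD; case: (dY) => dY1 cdY.
have [d d0 hd] := ucont cdY (r + 1) e0.
pose d' := Num.min d 1 / (`|v| + 1).
have v1 : 0 < `|v| + 1 by rewrite ltr_wpDl.
exists d' => [|h h0 hd' x]; first by rewrite divr_gt0 // lt_min d0 ltr01.
have [t th ->] := mvt_line_norm x h dY1.
rewrite mulKf //.
have tv : `|t *: v| < Num.min d 1.
  rewrite normrZ; apply: le_lt_trans (_ : `|h| * (`|v| + 1) < _).
    by apply: ler_pM => //; rewrite lerDl.
  by rewrite -ltr_pdivlMr.
move: tv; rewrite lt_min => /andP[tvd tv1].
have [xr|xr] := leP `|x| (r + 1).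
  rewrite distrC; apply/ltW/hd => //.
  by rewrite opprD addrA subrr sub0r normrN.
rewrite !hr ?subrr ?normr0 ?ltW //; first by apply: lt_trans xr; rewrite ltrDl.
by have := ler_normB (x + t *: v) (t *: v); rewrite addrK; lra.
Qed.

(** Difference quotients have integral 0 by translation invariance, and they converge uniformly with
    supports in a fixed ball. *)
Lemma II_derive Y v : Cc Y -> der1 Y v -> II ('D_v Y) = 0.
Proof.
move=> cY dY; have cD := Cc_derive cY dY.
have [r r0 hr] := Cc_supp cD; have [s s0 hs] := Cc_supp cY.
apply/eqP; rewrite -normr_le0; apply/ler_addgt0Pr => e e0; rewrite add0r.
pose K : R := (2 * (r + s + 1)) ^+ n.
have K0 : 0 <= K by apply: exprn_ge0; lra.
have e1 : 0 < e / (K + 1) by rewrite divr_gt0 // ltr_wpDl.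
have [d d0 hd] := diff_quot cY dY e1.
pose h := Num.min (d / 2) (1 / (`|v| + 1)).
have v1 : 0 < `|v| + 1 by rewrite ltr_wpDl.
have h0 : 0 < h by rewrite lt_min divr_gt0 //= divr_gt0.
have hd2 : h <= d / 2 by rewrite ge_min lexx.
have hv : `|h *: v| <= 1.
  rewrite normrZ gtr0_norm //; apply: le_trans (_ : h * (`|v| + 1) <= _).
    by rewrite ler_pM2l // lerDl.
  by rewrite -ler_pdivlMr // ge_min lexx orbT.
have cq : Cc (fun x => h^-1 * (Y (x + h *: v) - Y x)).
  by apply: CcZ; apply: CcB => //; exact: Cc_shift.
have IIq : II (fun x => h^-1 * (Y (x + h *: v) - Y x)) = 0.
  rewrite IIZ; last by apply: CcB => //; exact: Cc_shift.
  by rewrite IIB //; [rewrite II_shift // subrr mulr0|exact: Cc_shift].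
rewrite -normrN -[- _]add0r -IIq -IIB //.
apply: le_trans (_ : K * (e / (K + 1)) <= _).
  apply: II_bound => [|||x]; first by lra.
  - exact: CcB.
  - move=> x rsx; rewrite !hs ?hr ?subrr ?mulr0 ?subr0 //; try lra.
    by have := ler_normB (x + h *: v) (h *: v); rewrite addrK; lra.
  - by apply: hd; rewrite ?gt_eqF // gtr0_norm //; lra.
by rewrite mulrCA ger_pMr // ler_pdivrMr ?ltr_wpDl // mul1r lerDl.
Qed.

(* For even eta this is the convolution of eta and g. *)
Definition conv (eta : V -> R) g x := II (fun y => eta (x - y) * g y).

Lemma Cc_refl (eta : V -> R) x : Cc eta -> Cc (fun y => eta (x - y)).
Proof.
move=> [ce [r hr]]; split.
  move=> y; apply: (@continuous_comp _ _ _ (fun y : V => x - y) eta); last exact: ce.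
  by apply: continuousB; [exact: cst_continuous|move=> A; exact].
exists (r + `|x|) => y h; apply: hr.
by have := ler_normB (x - y) x; rewrite addrAC subrr sub0r normrN; lra.
Qed.

Lemma Cc_conv eta g x : Cc eta -> continuous g -> Cc (fun y => eta (x - y) * g y).
Proof. by move=> ce cg; apply: Cc_mul => //; exact: Cc_refl. Qed.

Lemma conv_bound eta g x (r e M : R) : 0 <= r -> 0 <= M -> Cc eta -> continuous g ->
  (forall y, r < `|y| -> eta y = 0) -> (forall y, `|eta y| <= e) ->
  (forall y, `|y| <= `|x| + r -> `|g y| <= M) ->
  `|conv eta g x| <= (2 * (`|x| + r)) ^+ n * (e * M).
Proof.
move=> r0 M0 ce cg hr he hM; apply: II_bound; first by apply: addr_ge0.
- exact: Cc_conv.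
- move=> y h; rewrite hr ?mul0r //.
  by have := ler_normB (x - y) x; rewrite addrAC subrr sub0r normrN; lra.
- move=> y; have [h|h] := leP `|y| (`|x| + r).
    by rewrite normrM ler_pM // hM.
  rewrite hr ?mul0r ?normr0; first by rewrite mulr_ge0 //; exact: le_trans (he 0).
  by have := ler_normB (x - y) x; rewrite addrAC subrr sub0r normrN; lra.
Qed.

Lemma conv_linl (eta1 eta2 : V -> R) g x a : Cc eta1 -> Cc eta2 -> continuous g ->
  conv (fun y => a * eta1 y + eta2 y) g x = a * conv eta1 g x + conv eta2 g x.
Proof.
move=> c1 c2 cg; rewrite /conv -II_lin; [|exact: Cc_conv..].
by congr II; apply/funext => y; ring.
Qed.

Lemma conv_continuous (eta : V -> R) g : Cc eta -> continuous g -> continuous (conv eta g).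
Proof.
move=> ce cg; apply/rV_continuousP => x e e0.
have [r r0 hr] := Cc_supp ce.
have [M M0 hM] := bounded_on_ball cg (`|x| + r + 1).
pose K := (2 * (`|x| + (r + 1))) ^+ n * M + 1.
have K0 : 0 < K.
  rewrite ltr_wpDl //; apply: mulr_ge0; last exact: ltW.
  by apply: exprn_ge0; have := normr_ge0 x; lra.
have e1 : 0 < e / K by rewrite divr_gt0.
have [d d0 hd] := ucont (proj1 ce) (r + 1) e1.
exists (Num.min d 1) => [|x']; first by rewrite lt_min d0 ltr01.
rewrite lt_min => /andP[xd x1].
have -> : conv eta g x - conv eta g x' =
    conv (fun y => -1 * eta (y + (x' - x)) + eta y) g x.
  rewrite conv_linl //; last exact: Cc_shift.
  rewrite mulN1r [RHS]addrC; congr (_ - _); rewrite /conv; congr II; apply/funext => y.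
  by congr (eta _ * _); rewrite [RHS]addrC addrA subrK.
apply: le_lt_trans (@conv_bound _ _ _ (r + 1) (e / K) M _ _ _ _ _ _ _) _ => //.
- lra.
- exact: ltW.
- by apply: CcD => //; exact: Cc_shift.
- move=> y ry; have h2 : r < `|y + (x' - x)|.
    by have := ler_normB (y + (x' - x)) (x' - x); rewrite addrK (distrC x'); lra.
  by rewrite !hr ?mulr0 ?addr0 //; lra.
- move=> y; rewrite mulN1r addrC; have [h|h] := leP `|y| (r + 1).
    by apply/ltW/hd => //; rewrite opprD addrA subrr sub0r opprB.
  have h2 : r < `|y + (x' - x)|.
    by have := ler_normB (y + (x' - x)) (x' - x); rewrite addrK (distrC x'); lra.
  by rewrite !hr ?subrr ?normr0 ?ltW //; lra.
- by move=> y h; apply: hM; lra.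
set P := (2 * _) ^+ n; have -> : P * (e / K * M) = e * (P * M) / K by ring.
by rewrite ltr_pdivrMr // ltr_pM2l // /K ltrDl.
Qed.

(** The difference quotient is moved onto the kernel, where it converges uniformly with supports in
    a fixed ball; g need only be continuous. *)
Lemma conv_derive (eta : V -> R) g v x : Cc eta -> der1 eta v -> continuous g ->
  is_derive x v (conv eta g) (conv ('D_v eta) g x).
Proof.
move=> ce de cg; have cD := Cc_derive ce de.
have [r r0 hr] := Cc_supp ce; have [s s0 hs] := Cc_supp cD.
have [M M0 hM] := bounded_on_ball cg (`|x| + (r + s + 1)).
pose K := (2 * (`|x| + (r + s + 1))) ^+ n * M + 1.
have K0 : 0 < K.
  rewrite ltr_wpDl //; apply: mulr_ge0; last exact: ltW.
  by apply: exprn_ge0; have := normr_ge0 x; lra.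
have v1 : 0 < `|v| + 1 by rewrite ltr_wpDl.
suff lim : h^-1 *: (conv eta g (h *: v + x) - conv eta g x) @[h --> (0 : R)^'] --> conv ('D_v eta) g x.
  split; first by apply/cvg_ex; exists (conv ('D_v eta) g x).
  by rewrite /derive; apply/cvg_lim.
apply/cvgrPdist_le => e e0.
have e1 : 0 < e / K by rewrite divr_gt0.
have [d d0 hd] := diff_quot ce de e1.
near=> h.
have h0 : h != 0 by near: h; exact: nbhs_dnbhs_neq.
have hd1 : `|h| < d by near: h; apply: dnbhs0_lt.
have hv : `|h| < 1 / (`|v| + 1) by near: h; apply: dnbhs0_lt; rewrite divr_gt0.
have hv1 : `|h *: v| <= 1.
  rewrite normrZ; apply: le_trans (_ : `|h| * (`|v| + 1) <= _).
    by rewrite ler_wpM2l // lerDl.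
  by rewrite -ler_pdivlMr // ltW.
rewrite distrC.
pose eta' (y : V) := h^-1 * (-1 * eta y + eta (y + h *: v)).
have ceta' : Cc eta' by apply: CcZ; apply: CcD => //; exact: Cc_shift.
have -> : h^-1 *: (conv eta g (h *: v + x) - conv eta g x) - conv ('D_v eta) g x =
    conv (fun y => -1 * ('D_v eta) y + eta' y) g x.
  rewrite conv_linl // mulN1r [RHS]addrC; congr (_ - _).
  rewrite /conv /eta' -IIB; [|exact: Cc_conv..].
  rewrite [LHS]/GRing.scale /= -IIZ; last by apply: CcB; exact: Cc_conv.
  congr II; apply/funext => y.
  have -> : h *: v + x - y = x - y + h *: v by rewrite [RHS]addrC addrA.
  by ring.
apply: le_trans (@conv_bound _ _ _ (r + s + 1) (e / K) M _ _ _ _ _ _ _) _ => //.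
- by rewrite !addr_ge0.
- exact: ltW.
- exact: CcD.
- move=> y ry; have h2 : r < `|y + h *: v|.
    by have := ler_normB (y + h *: v) (h *: v); rewrite addrK; lra.
  have ry' : r < `|y| by lra.
  have sy' : s < `|y| by lra.
  by rewrite /eta' hs // (hr _ h2) (hr _ ry') !mulr0 addr0 mulr0 addr0.
- move=> y; rewrite mulN1r addrC /eta' mulN1r [- _ + _]addrC; exact: hd.
set P := (2 * _) ^+ n; have -> : P * (e / K * M) = e * (P * M) / K by ring.
by rewrite ler_pdivrMr // ler_pM2l // /K lerDl.
Unshelve. all: end_near. Qed.

(** Class C^k through iterated derivatives along basis vectors only, in the style of [C2]; being
    recursive, it loses one order under each derivation by mere unfolding. *)
Fixpoint CK k f : Prop := continuous f /\
  match k with 0 => True | k'.+1 => forall j,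
    (forall x, derivable f x (e_ j)) /\ CK k' ('D_(e_ j) f) end.

Lemma CK_cont k f : CK k f -> continuous f.
Proof. by case: k => [|k] []. Qed.

Lemma CK_der1 k f j : CK k.+1 f -> der1 f (e_ j).
Proof. by move=> [_ /(_ j)[df /CK_cont cD]]. Qed.

Lemma CK_derive k f j : CK k.+1 f -> CK k ('D_(e_ j) f).
Proof. by move=> [_ /(_ j)[]]. Qed.

Lemma CK_S k f : CK k.+1 f -> CK k f.
Proof.
elim: k f => [|k IH] f [cf h]; first by split.
split=> // j; have [df cD] := h j; split=> //; exact: IH.
Qed.

Lemma CK_conv k eta g : Cc eta -> continuous g -> CK k eta -> CK k (conv eta g).
Proof.
move=> + cg; elim: k eta => [|k IH] eta ce ck; first by split=> //; exact: conv_continuous.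
split; first exact: conv_continuous.
move=> j; have dj := CK_der1 j ck; split.
  by move=> x; have [] := conv_derive x ce dj cg.
have -> : 'D_(e_ j) (conv eta g) = conv ('D_(e_ j) eta) g.
  by apply/funext => x; have [_] := conv_derive x ce dj cg.
by apply: IH; [exact: Cc_derive|exact: CK_derive].
Qed.

Lemma CK_C2 f : CK 2 f -> C2 f.
Proof.
move=> ck; split; first by move=> x j; have [] := CK_der1 j ck.
split=> [j k x|j k]; first by have [] := CK_der1 j (CK_derive k ck).
exact: CK_cont (CK_derive j (CK_derive k ck)).
Qed.

Lemma CK_cst k (c : R) : CK k (fun _ => c).
Proof.
elim: k c => [|k IH] c; first by split=> //; exact: rV_cont_cst.
split; first exact: rV_cont_cst.
move=> j; split; first by move=> x; exact: derivable_cst.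
have -> : 'D_(e_ j) (fun=> c) = (fun=> 0) by apply/funext => x; exact: derive_cst.
exact: IH.
Qed.

Lemma CKD k f g : CK k f -> CK k g -> CK k (fun x => f x + g x).
Proof.
elim: k f g => [|k IH] f g [cf hf] [cg hg]; split; try exact: rV_contD; first by [].
move=> j; have [df Df] := hf j; have [dg Dg] := hg j; split.
  by move=> x; exact: derivableD.
have -> : 'D_(e_ j) (fun x => f x + g x) = (fun x => 'D_(e_ j) f x + 'D_(e_ j) g x).
  by apply/funext => x; exact: deriveD.
exact: IH.
Qed.

Lemma CKM k f g : CK k f -> CK k g -> CK k (fun x => f x * g x).
Proof.
elim: k f g => [|k IH] f g ckf ckg; (have cf := CK_cont ckf); (have cg := CK_cont ckg).
  by split=> //; exact: rV_contM.
split; first exact: rV_contM.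
move=> j; have [df _] := CK_der1 j ckf; have [dg _] := CK_der1 j ckg; split.
  by move=> x; exact: derivableM.
have -> : 'D_(e_ j) (fun x => f x * g x) =
    (fun x => f x * 'D_(e_ j) g x + g x * 'D_(e_ j) f x).
  by apply/funext => x; exact: deriveM.
exact: (CKD (IH _ _ (CK_S ckf) (CK_derive j ckg)) (IH _ _ (CK_S ckg) (CK_derive j ckf))).
Qed.

Lemma is_derive_coord x (v : V) j : is_derive x v (fun y : V => y 0 j) (v 0 j).
Proof.
have E : (fun h : R => h^-1 *: ((h *: v + x) 0 j - x 0 j)) @ (0 : R)^' --> v 0 j.
  apply: cvg_near_cst; near=> h; rewrite !mxE addrK [_ *: _]mulKf //.
  by near: h; exact: nbhs_dnbhs_neq.
by split; [apply/cvg_ex; exists (v 0 j)|apply/cvg_lim].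
Unshelve. all: end_near. Qed.

Lemma CK_coord k j : CK k (fun x : V => x 0 j).
Proof.
case: k => [|k]; first by split=> //; exact: rV_cont_coord.
split; first exact: rV_cont_coord.
move=> l; split; first by move=> x; have [] := is_derive_coord x (e_ l) j.
have -> : 'D_(e_ l) (fun x : V => x 0 j) = (fun=> e_ l 0 j).
  by apply/funext => x; have [_] := is_derive_coord x (e_ l) j.
exact: CK_cst.
Qed.

Lemma CK_sum k (I : Type) (s : seq I) (P : pred I) (F : I -> V -> R) :
  (forall i, CK k (F i)) -> CK k (fun x => \sum_(i <- s | P i) F i x).
Proof.
move=> cF; elim: s => [|i s IH].
  by under eq_fun do rewrite big_nil; exact: CK_cst.
under eq_fun do rewrite big_cons; case: (P i) => //; exact: CKD.
Qed.

Lemma CK_prod k (I : Type) (s : seq I) (P : pred I) (F : I -> V -> R) :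
  (forall i, CK k (F i)) -> CK k (fun x => \prod_(i <- s | P i) F i x).
Proof.
move=> cF; elim: s => [|i s IH].
  by under eq_fun do rewrite big_nil; exact: CK_cst.
under eq_fun do rewrite big_cons; case: (P i) => //; exact: CKM.
Qed.

End Calculus.

(** * Chain rule and Hessians of convex functions *)

Section Chain.
Variables (R : realType) (n : nat).
Local Notation V := 'rV[R]_n.
Local Notation e_ j := (@evec R n j).
Implicit Types (f g Y : V -> R) (x v : V).

(** Directions are added one at a time: the mean value theorem along w evaluates the extra
    increment, and continuity of ['D_w f] gives its limit. Partial derivatives thus suffice, without
    a total differential. *)
Lemma is_derive_addr f x v w a c : is_derive x v f a -> der1 f w ->
  is_derive x (v + c *: w) f (a + c * 'D_w f x).
Proof.
move=> [dv av] [dw cdw].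
suff lim : h^-1 *: (f (h *: (v + c *: w) + x) - f x) @[h --> (0 : R)^'] --> a + c * 'D_w f x.
  split; first by apply/cvg_ex; exists (a + c * 'D_w f x).
  by rewrite /derive; apply/cvg_lim.
have lim1 : h^-1 *: (f (h *: v + x) - f x) @[h --> (0 : R)^'] --> a by rewrite -av.
apply/cvgrPdist_le => e e0.
have e1 : 0 < e / 2 / (`|c| + 1) by rewrite !divr_gt0 // ltr_wpDl.
have [d d0 hd] := (proj1 (rV_continuousP _) cdw) x _ e1.
have v1 : 0 < `|v| + `|c *: w| + 1 by rewrite ltr_wpDl // addr_ge0.
near=> h.
have h0 : h != 0 by near: h; exact: nbhs_dnbhs_neq.
have hd1 : `|h| < d / (`|v| + `|c *: w| + 1) by near: h; apply: dnbhs0_lt; rewrite divr_gt0.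
have hl : `|a - h^-1 *: (f (h *: v + x) - f x)| <= e / 2.
  near: h; move/cvgrPdist_le: lim1; apply; lra.
have [t th E] := mvt_line_norm (h *: v + x) (h * c) dw.
have -> : f (h *: (v + c *: w) + x) - f x =
    h * c * 'D_w f (h *: v + x + t *: w) + (f (h *: v + x) - f x).
  rewrite -E addrA subrK; congr (f _ - _).
  by rewrite scalerDr scalerA -!addrA; congr (_ + _); rewrite addrC.
rewrite scalerDr [_ *: (h * c * _)]mulrA mulrA mulVf // mul1r.
have h3 : `|c * 'D_w f x - c * 'D_w f (h *: v + x + t *: w)| <= e / 2.
  rewrite -mulrBr normrM; apply: le_trans (_ : `|c| * (e / 2 / (`|c| + 1)) <= _).
    apply: ler_wpM2l => //; apply/ltW/hd.
    rewrite (_ : x - _ = - (h *: v + t *: w)); last first.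
      by rewrite [h *: v + x]addrC -addrA opprD addrA subrr sub0r.
    rewrite normrN; apply: le_lt_trans (ler_normD _ _) _.
    rewrite ltr_pdivlMr // in hd1; apply: le_lt_trans hd1.
    rewrite normrZ !mulrDr mulr1 -addrA lerD2l.
    apply: le_trans (_ : `|h| * `|c *: w| <= _); last by rewrite lerDl.
    by rewrite !normrZ mulrA -normrM ler_wpM2r.
  by rewrite mulrCA ger_pMr ?ler_pdivrMr ?ltr_wpDl //; lra.
have := ler_normD (a - h^-1 *: (f (h *: v + x) - f x))
  (c * 'D_w f x - c * 'D_w f (h *: v + x + t *: w)).
rewrite addrACA -opprD.
set z := (X in `|X| <= _ -> _); rewrite [X in `|X| <= e](_ : _ = z); first lra.
by rewrite /z; congr (_ - _); rewrite addrC.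
Unshelve. all: end_near. Qed.

Lemma rV_sum_evec v : v = \sum_j v 0 j *: e_ j.
Proof. exact: row_sum_delta. Qed.

Lemma chain_rule f x v : CK 1 f -> is_derive x v f (\sum_j v 0 j * 'D_(e_ j) f x).
Proof.
move=> cf; rewrite {1}[v]rV_sum_evec.
elim: (index_enum _) => [|j s IH]; first by rewrite !big_nil; exact: is_derive0.
rewrite !big_cons addrC [X in is_derive _ _ _ X]addrC.
by apply: is_derive_addr => //; exact: CK_der1 cf.
Qed.

Lemma CK1_der1 f v : CK 1 f -> der1 f v.
Proof.
move=> cf; split; first by move=> x; have [] := chain_rule x v cf.
have -> : 'D_v f = (fun x => \sum_j v 0 j * 'D_(e_ j) f x).
  by apply/funext => x; have [_] := chain_rule x v cf.
apply: rV_cont_sum => j; apply: rV_contM; first exact: rV_cont_cst.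
exact: CK_cont (CK_derive j cf).
Qed.

Lemma derive2 f v x : CK 2 f -> 'D_v ('D_v f) x = \sum_j \sum_k v 0 j * v 0 k * hessian f x j k.
Proof.
move=> cf.
have -> : 'D_v f = (fun x => \sum_k v 0 k * 'D_(e_ k) f x).
  by apply/funext => y; have [_] := chain_rule y v (CK_S cf).
have cD : CK 1 (fun x => \sum_k v 0 k * 'D_(e_ k) f x).
  by apply: CK_sum => k; apply: CKM; [exact: CK_cst|exact: CK_derive].
have [_ ->] := chain_rule x v cD; apply: eq_bigr => j _.
have -> : (fun x => \sum_k v 0 k * 'D_(e_ k) f x) =
    \sum_k (fun x => v 0 k * 'D_(e_ k) f x).
  by apply/funext => y; rewrite fct_sumE.
rewrite derive_sum => [|k]; last first.
  have : CK 1 (fun x => v 0 k * 'D_(e_ k) f x).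
    by apply: CKM; [exact: CK_cst|exact: CK_derive].
  by move/(CK_der1 j) => [].
rewrite mulr_sumr; apply: eq_bigr => k _; rewrite mxE -mulrA; congr (_ * _).
by rewrite (@deriveZ _ _ _ ('D_(e_ k) f)) //; have [] := CK_der1 j (CK_derive k cf).
Qed.

Lemma mvt_is_derive f A x v (h : R) : (forall y, is_derive y v f (A y)) -> 0 < h ->
  exists2 t : R, 0 < t < h & f (x + h *: v) - f x = h * A (x + t *: v).
Proof.
move=> df h0.
have df' y : derivable f y v by have [] := df y.
have [t th ->] := mvt_line x df' h0.
by exists t => //; have [_ ->] := df (x + t *: v).
Qed.

(** Midpoint convexity orders the two slopes on either side of x. The mean value theorem turns their
    difference into a positive multiple of a value of B near x, which would be negative if B x
    were. *)
Lemma convex_derive2_ge0 f A B x v : convex_fun f ->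
  (forall y, is_derive y v f (A y)) -> (forall y, is_derive y v A (B y)) ->
  continuous B -> 0 <= B x.
Proof.
move=> cvf fA AB cB; rewrite leNgt; apply/negP => neg.
have [d d0 hd] := (proj1 (rV_continuousP _) cB) x (- B x) ltac:(lra).
have v1 : 0 < `|v| + 1 by rewrite ltr_wpDl.
pose h := d / 2 / (`|v| + 1); have h0 : 0 < h by rewrite !divr_gt0.
have [t1 /andP[t10 t1h] e1] := mvt_is_derive x fA h0.
have [t2 /andP[t20 t2h] e2] := mvt_is_derive (x - h *: v) fA h0.
have ht : 0 < h + t1 - t2 by lra.
have [t3 /andP[t30 t3h] e3] := mvt_is_derive (x - h *: v + t2 *: v) AB ht.
move: e2; rewrite subrK => e2.
have := cvf (x - h *: v) (x + h *: v) (1 / 2) ltac:(apply/andP; split; lra).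
have -> : (1 - 1 / 2) *: (x - h *: v) + (1 / 2) *: (x + h *: v) = x.
  by apply/rowP => j; rewrite !mxE; field.
move=> mid.
have : A (x - h *: v + t2 *: v + (h + t1 - t2) *: v) = A (x + t1 *: v).
  by congr A; apply/rowP => j; rewrite !mxE; ring.
move=> e4; rewrite e4 in e3.
have g0 : 0 <= A (x + t1 *: v) - A (x - h *: v + t2 *: v).
  by rewrite -(pmulr_rge0 _ h0) mulrBr -e1 -e2; lra.
rewrite e3 pmulr_rge0 // in g0.
have : `|x - (x - h *: v + t2 *: v + t3 *: v)| < d.
  have -> : x - (x - h *: v + t2 *: v + t3 *: v) = (h - t2 - t3) *: v.
    by apply/rowP => j; rewrite !mxE; ring.
  rewrite normrZ; apply: le_lt_trans (_ : h * (`|v| + 1) < _).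
    apply: ler_pM; rewrite ?lerDl //.
    by rewrite ler_norml; apply/andP; split; lra.
  by rewrite /h divfK ?gt_eqF //; lra.
by move/hd; rewrite ltr_norml => /andP[+ _]; lra.
Qed.

Lemma hessian_psd f x v : convex_fun f -> CK 2 f -> 0 <= qform v (hessian f x).
Proof.
move=> cvf cf; rewrite qformE -derive2 //.
have [dv _] := CK1_der1 v (CK_S cf).
have Df : CK 1 ('D_v f).
  have -> : 'D_v f = (fun x => \sum_k v 0 k * 'D_(e_ k) f x).
    by apply/funext => y; have [_] := chain_rule y v (CK_S cf).
  by apply: CK_sum => k; apply: CKM; [exact: CK_cst|exact: CK_derive].
have [dvv cvv] := CK1_der1 v Df.
apply: (@convex_derive2_ge0 f ('D_v f) ('D_v ('D_v f)) x v cvf _ _ cvv) => y.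
  exact: derivableP.
exact: derivableP.
Qed.

Lemma is_derive_prod (I : eqType) (s : seq I) (F : I -> V -> R) (dF : I -> R) x v :
  uniq s -> (forall i, is_derive x v (F i) (dF i)) ->
  is_derive x v (fun y => \prod_(i <- s) F i y)
    (\sum_(a <- s) dF a * \prod_(c <- s | c != a) F c x).
Proof.
move=> + dd; elim: s => [_|a s IH /andP[nas us]].
  by under eq_fun do rewrite big_nil; rewrite big_nil; exact: is_derive_cst.
under eq_fun do rewrite big_cons.
have h1 := dd a; have h2 := IH us.
apply: is_derive_eq (is_deriveM h1 h2) _.
rewrite big_cons big_cons eqxx /= [LHS]addrC /GRing.scale /=; congr (_ + _).
  rewrite mulrC; congr (_ * _); rewrite [in RHS]big_seq_cond [in LHS]big_seq.
  apply: eq_bigl => c; case: (boolP (c \in s)) => //= cs; apply/esym.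
  by apply: contraNneq nas => <-.
rewrite mulr_sumr [LHS]big_seq [RHS]big_seq; apply: eq_bigr => b bs.
rewrite big_cons ifT; last by apply: contraNneq nas => ->.
by rewrite mulrCA.
Qed.

Lemma is_derive_bigsum (I : Type) (s : seq I) (P : pred I) (F : I -> V -> R) (dF : I -> R) x v :
  (forall i, is_derive x v (F i) (dF i)) ->
  is_derive x v (fun y => \sum_(i <- s | P i) F i y) (\sum_(i <- s | P i) dF i).
Proof.
move=> h; elim: s => [|i s IH].
  by under eq_fun do rewrite big_nil; rewrite big_nil; exact: is_derive_cst.
under eq_fun do rewrite big_cons; rewrite big_cons.
case: (P i) => //; exact: (is_deriveD (h i) IH).
Qed.

End Chain.

(** * The divergence-free identity *)

Section CoefCont.
Variables (R : realType) (n : nat).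
Local Notation V := 'rV[R]_n.

(** Coefficientwise continuity is stable under the ring operations of the Leibniz expansion, and the
    quantities of interest are single coefficients. *)
Definition coef_cont (p : V -> {poly R}) := forall l, continuous (fun x => (p x)`_l).

Lemma coef_cont_cst p : coef_cont (fun=> p).
Proof. by move=> l; exact: rV_cont_cst. Qed.

Lemma coef_contC (f : V -> R) : continuous f -> coef_cont (fun x => (f x)%:P).
Proof.
move=> cf l; under eq_fun do rewrite coefC; case: (l == 0)%N => //.
exact: rV_cont_cst.
Qed.

Lemma coef_contD p q : coef_cont p -> coef_cont q -> coef_cont (fun x => p x + q x).
Proof. by move=> cp cq l; under eq_fun do rewrite coefD; exact: rV_contD. Qed.

Lemma coef_contN p : coef_cont p -> coef_cont (fun x => - p x).
Proof. by move=> cp l; under eq_fun do rewrite coefN; exact: rV_contN. Qed.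

Lemma coef_contM p q : coef_cont p -> coef_cont q -> coef_cont (fun x => p x * q x).
Proof.
move=> cp cq l; under eq_fun do rewrite coefM.
by apply: rV_cont_sum => i; exact: rV_contM.
Qed.

Lemma coef_cont_sum (I : Type) (s : seq I) (P : pred I) (F : I -> V -> {poly R}) :
  (forall i, coef_cont (F i)) -> coef_cont (fun x => \sum_(i <- s | P i) F i x).
Proof.
move=> cF; elim: s => [|i s IH].
  by under eq_fun do rewrite big_nil; exact: coef_cont_cst.
under eq_fun do rewrite big_cons; case: (P i) => //; exact: coef_contD.
Qed.

Lemma coef_cont_prod (I : Type) (s : seq I) (P : pred I) (F : I -> V -> {poly R}) :
  (forall i, coef_cont (F i)) -> coef_cont (fun x => \prod_(i <- s | P i) F i x).
Proof.
move=> cF; elim: s => [|i s IH].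
  by under eq_fun do rewrite big_nil; exact: coef_cont_cst.
under eq_fun do rewrite big_cons; case: (P i) => //; exact: coef_contM.
Qed.

Variable A : V -> 'M[R]_n.
Hypothesis cA : forall j k, continuous (fun x => A x j k).

Lemma coef_cont_char_poly_mx j k : coef_cont (fun x => char_poly_mx (A x) j k).
Proof.
under eq_fun do rewrite !mxE.
by apply: coef_contD; [exact: coef_cont_cst|apply: coef_contN; exact: coef_contC].
Qed.

Lemma coef_cont_cofactor j k : coef_cont (fun x => cofactor (char_poly_mx (A x)) j k).
Proof.
under eq_fun do rewrite expand_cofactor.
apply: coef_cont_sum => s; apply: coef_contM; first exact: coef_cont_cst.
by apply: coef_cont_prod => a; exact: coef_cont_char_poly_mx.
Qed.

Lemma continuous_elsym i : continuous (fun x => elsym i (A x)).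
Proof.
apply: rV_contM; first exact: rV_cont_cst.
have : coef_cont (fun x => char_poly (A x)); last exact.
apply: coef_cont_sum => s; apply: coef_contM; first exact: coef_cont_cst.
by apply: coef_cont_prod => a; exact: coef_cont_char_poly_mx.
Qed.

Lemma continuous_qform_newton i : continuous (fun x => qform x (newton i (A x))).
Proof.
under eq_fun do rewrite qformE.
apply: rV_cont_sum => j; apply: rV_cont_sum => k; apply: rV_contM.
  by apply: rV_contM; exact: rV_cont_coord.
under eq_fun do rewrite mxE.
by apply: rV_contM; [exact: rV_cont_cst|exact: coef_cont_cofactor].
Qed.

End CoefCont.

Lemma poly_eq0_of_horner (R : realFieldType) (p : {poly R}) : (forall l, p.[l] = 0) -> p = 0.
Proof.
move=> h; apply: (@roots_geq_poly_eq0 _ _ [seq k%:R | k <- iota 0 (size p)]).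
- by apply/allP => x _; apply/rootP.
- by rewrite map_inj_uniq ?iota_uniq // => a b /eqP; rewrite eqr_nat => /eqP.
- by rewrite size_map size_iota.
Qed.

Section Divergence.
Variables (R : realType) (n : nat).
Local Notation V := 'rV[R]_n.
Local Notation e_ j := (@evec R n j).
Variable f : V -> R.
Hypothesis f3 : CK 3 f.
Hypothesis fsym : forall j k, 'D_(e_ j) ('D_(e_ k) f) = 'D_(e_ k) ('D_(e_ j) f).
Hypothesis fsym3 : forall b j k, 'D_(e_ j) ('D_(e_ k) ('D_(e_ b) f)) =
  'D_(e_ k) ('D_(e_ j) ('D_(e_ b) f)).

Let H := hessian f.

Lemma CK_hessian j k : CK 1 (fun x => H x j k).
Proof.
under eq_fun do rewrite mxE.
exact: (CK_derive _ (CK_derive _ f3)).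
Qed.

(** The indeterminate is replaced by a real number l, so that entries and cofactors are real
    functions of x to which the calculus above applies. *)
Let M (l : R) x : 'M[R]_n := l%:M - H x.
Let dM (x : V) (j : 'I_n) : 'M[R]_n :=
  \matrix_(a, b) - 'D_(e_ j) ('D_(e_ a) ('D_(e_ b) f)) x.

Lemma CK_Mentry l a b : CK 1 (fun x => M l x a b).
Proof.
have := CKD (CK_cst _ 1 ((l%:M : 'M[R]_n) a b)) (CKM (CK_cst _ 1 (-1)) (CK_hessian a b)).
by congr CK; apply/funext => x; rewrite [RHS]mxE [X in _ = _ + X]mxE mulN1r.
Qed.

Lemma is_derive_Mentry l x j a b : is_derive x (e_ j) (fun y => M l y a b) (dM x j a b).
Proof.
rewrite mxE.
have -> : (fun y => M l y a b) = cst ((l%:M : 'M[R]_n) a b) - 'D_(e_ a) ('D_(e_ b) f).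
  by apply/funext => y; rewrite !mxE.
have h := CK_der1 j (CK_derive a (CK_derive b f3)).
have h1 : is_derive x (e_ j) ('D_(e_ a) ('D_(e_ b) f)) ('D_(e_ j) ('D_(e_ a) ('D_(e_ b) f)) x).
  by apply: derivableP; have [] := h.
by have := is_deriveB (is_derive_cst ((l%:M : 'M[R]_n) a b) x (e_ j)) h1; rewrite sub0r.
Qed.

Lemma CK_cofactor l j k : CK 1 (fun x => cofactor (M l x) j k).
Proof.
under eq_fun do rewrite expand_cofactor.
apply: CK_sum => s; apply: CKM; first exact: CK_cst.
by apply: CK_prod => a; exact: CK_Mentry.
Qed.

Lemma derive_cofactor l x m j k : 'D_(e_ m) (fun y => cofactor (M l y) j k) x =
  \sum_(s : 'S_n | s j == k) (-1) ^+ s *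
    (\sum_(a | j != a) dM x m a (s a) * \prod_(c | (j != c) && (c != a)) M l x c (s c)).
Proof.
under eq_fun do rewrite expand_cofactor.
suff [] : is_derive x (e_ m)
   (fun y => \sum_(s : 'S_n | s j == k) (-1) ^+ s * \prod_(a | j != a) M l y a (s a))
   (\sum_(s : 'S_n | s j == k) (-1) ^+ s *
    (\sum_(a | j != a) dM x m a (s a) * \prod_(c | (j != c) && (c != a)) M l x c (s c))) by [].
apply: is_derive_bigsum => s.
have -> : (fun y => (-1) ^+ s * \prod_(a | j != a) M l y a (s a)) =
  (-1) ^+ s *: (fun y => \prod_(a <- [seq a <- index_enum 'I_n | j != a]) M l y a (s a)).
  by apply/funext => y; rewrite /GRing.scale /= /GRing.scale /= big_filter.
apply: is_derive_eq.
  apply: is_deriveZ; apply: is_derive_prod; first exact/filter_uniq/index_enum_uniq.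
  by move=> a; exact: is_derive_Mentry.
rewrite big_filter; congr (_ * _); apply: eq_bigr => a _; congr (_ * _).
by rewrite big_filter_cond.
Qed.

(** The Piola identity. Commuting third derivatives make [dM] symmetric in the direction of
    differentiation and the row index, which is the symmetry behind the cancellation. *)
Lemma cofactor_divergence_free l x k :
  \sum_j 'D_(e_ j) (fun y => cofactor (M l y) j k) x = 0.
Proof.
under eq_bigr do rewrite derive_cofactor.
apply: (@piola_cancel R n (M l x) (dM x) k) => m a b.
rewrite [LHS]mxE [RHS]mxE.
exact: (congr1 (fun F : V -> R => - F x) (fsym3 b m a)).
Qed.

Variables (g c : V -> R).
Hypotheses (cg : Cc g) (cc : Cc c) (g1 : CK 1 g).
Hypothesis dg : forall j x, 'D_(e_ j) g x = c x * x 0 j.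

(** The divergence theorem for the field with components g times the sum over k of C_jk x_k, C being
    the cofactor matrix. As the gradient of g is c x, the product rule leaves a trace term, a
    quadratic form in x and the vanishing divergence of C. *)
Lemma II_divergence l :
  II (fun x => g x * (\sum_j cofactor (M l x) j j) +
    c x * \sum_j \sum_k x 0 j * x 0 k * cofactor (M l x) j k) = 0.
Proof.
pose C j x := \sum_k cofactor (M l x) j k * x 0 k.
have C1 j : CK 1 (C j).
  by apply: CK_sum => k; apply: CKM; [exact: CK_cofactor|exact: CK_coord].
pose Y j x := g x * C j x.
have CY j : Cc (Y j) by apply: Cc_mul => //; exact: CK_cont (C1 j).
have Y1 j : der1 (Y j) (e_ j) by apply: (@CK_der1 _ _ 0); exact: CKM.
have DY j x : 'D_(e_ j) (Y j) x = c x * (\sum_k x 0 j * x 0 k * cofactor (M l x) j k) +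
    g x * (cofactor (M l x) j j + \sum_k 'D_(e_ j) (fun y => cofactor (M l y) j k) x * x 0 k).
  have := @deriveM _ _ g (C j) x (e_ j); rewrite -/(Y j) => ->; last first.
  - by have [] := CK_der1 j (C1 j).
  - by have [] := CK_der1 j g1.
  rewrite dg /GRing.scale /= addrC; congr (_ + _ * _).
    by rewrite /C mulrC -mulrA mulr_sumr mulr_sumr mulr_sumr; apply: eq_bigr => k _; ring.
  suff [_ ->] : is_derive x (e_ j) (C j) (\sum_k (cofactor (M l x) j k * e_ j 0 k +
       x 0 k * 'D_(e_ j) (fun y => cofactor (M l y) j k) x)).
    rewrite big_split /=; congr (_ + _); last by apply: eq_bigr => k _; rewrite mulrC.
    rewrite (bigD1 j) //= big1 ?addr0; first by rewrite mxE !eqxx mulr1.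
    by move=> k kj; rewrite mxE eqxx /= (negbTE kj) mulr0.
  apply: is_derive_bigsum => k.
  have h : is_derive x (e_ j) (fun y => cofactor (M l y) j k)
     ('D_(e_ j) (fun y => cofactor (M l y) j k) x).
    by apply: derivableP; have [] := CK_der1 j (CK_cofactor l j k).
  exact: (is_deriveM h (is_derive_coord x (e_ j) k)).
have : \sum_j II ('D_(e_ j) (Y j)) = 0 by rewrite big1 // => j _; exact: II_derive.
rewrite -II_sum; last by move=> j; exact: Cc_derive.
move=> h0; apply: etrans h0; congr II; apply/funext => x.
under [RHS]eq_bigr do rewrite DY.
rewrite big_split /= -!mulr_sumr addrC big_split /=; congr (_ + _ * _).
congr (_ * _); rewrite exchange_big /= [X in _ = _ + X]big1 ?addr0 // => k _.
by rewrite -mulr_suml cofactor_divergence_free mul0r.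
Qed.

(* Both sides of II_divergence are polynomials in l; compare coefficients. *)
Lemma II_newton i : (i < n)%N ->
  II (fun x => (n - i)%:R * (g x * elsym i (H x)) + c x * qform x (newton i (H x))) = 0.
Proof.
move=> ilt.
pose P x : {poly R} := g x *: (\sum_j cofactor (char_poly_mx (H x)) j j) +
  c x *: \sum_j \sum_k (x 0 j * x 0 k) *: cofactor (char_poly_mx (H x)) j k.
have cH j k : continuous (fun x => H x j k) by exact: CK_cont (CK_hessian j k).
have cP l : Cc (fun x => (P x)`_l).
  under eq_fun do rewrite coefD !coefZ.
  apply: CcA; apply: Cc_mul => //.
    under eq_fun do rewrite coef_sum.
    by apply: rV_cont_sum => j; exact: coef_cont_cofactor.
  under eq_fun do rewrite coef_sum.
  apply: rV_cont_sum => j; under eq_fun do rewrite coef_sum.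
  apply: rV_cont_sum => k; under eq_fun do rewrite coefZ.
  apply: rV_contM; last exact: coef_cont_cofactor.
  by apply: rV_contM; exact: rV_cont_coord.
have sP x : (size (P x) <= n.+1)%N.
  apply: leq_trans (size_polyD _ _) _; rewrite geq_max; apply/andP; split.
    apply: leq_trans (size_scale_leq _ _) _; apply: leq_trans (size_sum _ _ _) _.
    by apply/bigmax_leqP => j _; exact: size_cofactor_char_poly.
  apply: leq_trans (size_scale_leq _ _) _; apply: leq_trans (size_sum _ _ _) _.
  apply/bigmax_leqP => j _; apply: leq_trans (size_sum _ _ _) _.
  apply/bigmax_leqP => k _; apply: leq_trans (size_scale_leq _ _) _.
  exact: size_cofactor_char_poly.
have : \poly_(l < n.+1) II (fun x => (P x)`_l) = 0.
  apply: poly_eq0_of_horner => l; rewrite horner_poly -[RHS](II_divergence l).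
  under eq_bigr => k _ do rewrite mulrC -IIZ //.
  rewrite -II_sum; last by move=> k; exact: CcZ.
  congr II; apply/funext => x.
  transitivity (P x).[l].
    rewrite (horner_coef_wide _ (sP x)); apply: eq_bigr => k _; exact: mulrC.
  rewrite hornerD !hornerZ !horner_sum; congr (_ * _ + _ * _).
    by apply: eq_bigr => j _; rewrite horner_cofactor.
  apply: eq_bigr => j _; rewrite horner_sum; apply: eq_bigr => k _.
  by rewrite hornerZ horner_cofactor.
move=> /(congr1 (fun p : {poly R} => (-1) ^+ i * p`_(n.-1 - i))).
rewrite coef_poly coef0 mulr0 ifT; last by rewrite ltnS; lia.
rewrite -IIZ // => h0; apply: etrans h0; congr II; apply/funext => x; apply: esym.
rewrite coefD !coefZ mulrDr; congr (_ + _).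
  have tr : (-1) ^+ i * (\sum_j cofactor (char_poly_mx (H x)) j j)`_(n.-1 - i) =
      \tr (newton i (H x)).
    by rewrite coef_sum mulr_sumr; apply: eq_bigr => j _; rewrite mxE.
  by rewrite mulrCA tr tr_newton // mulrCA.
rewrite qformE mulrCA; congr (_ * _); rewrite coef_sum mulr_sumr; apply: eq_bigr => j _.
rewrite coef_sum mulr_sumr; apply: eq_bigr => k _.
by rewrite coefZ mxE mulrCA.
Qed.

End Divergence.

(** * Mollification *)

Section LebMono.
Import HBNNSimple.
Variable R : realType.
Local Notation mu := (@lebesgue_measure R).

Lemma le_integral_nonmeas (F G : R -> \bar R) : (forall t, 0 <= F t)%E ->
  (forall t, F t <= G t)%E -> (\int[mu]_t F t <= \int[mu]_t G t)%E.
Proof.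
move=> F0 FG; have G0 t : (0 <= G t)%E by apply: le_trans (FG t).
rewrite !ge0_integralTE //; apply: ereal_sup_le => _ [h /= hF <-].
by exists h => //= x; apply: le_trans (FG x).
Qed.

Lemma leb_int_ge0 n (F : 'rV[R]_n -> \bar R) : (forall x, 0 <= F x)%E -> (0 <= leb_int F)%E.
Proof.
elim: n F => [|n IH] F h; first exact: h.
by apply: integral_ge0 => t _; apply: IH => v.
Qed.

Lemma le_leb_int n (F G : 'rV[R]_n -> \bar R) : (forall x, 0 <= F x)%E ->
  (forall x, F x <= G x)%E -> (leb_int F <= leb_int G)%E.
Proof.
elim: n F G => [|n IH] F G F0 FG; first exact: FG.
by apply: le_integral_nonmeas => t; [exact: leb_int_ge0|exact: IH].
Qed.

Definition boxind n (d : R) (x : 'rV[R]_n) : R :=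
  \prod_j \1_(`[0, d]%classic : set R) (x 0 j).

(** The one explicit volume: it gives the mollifier positive mass and evaluates a Hessian measure of
    constant density. *)
Lemma leb_int_box n d c : 0 <= d ->
  leb_int (fun x : 'rV[R]_n => (c * boxind d x)%:E) = (c * d ^+ n)%:E.
Proof.
move=> d0; elim: n c => [|n IH] c.
  by rewrite /= /boxind big_ord0 expr0.
transitivity (\int[mu]_t ((c * d ^+ n) * \1_(`[0, d]%classic : set R) t)%:E)%E.
  apply: eq_integral => t _; rewrite -/leb_int.
  have -> : (fun v : 'rV[R]_n => (c * boxind d (row_mx (t%:M : 'M[R]_1) v : 'rV[R]_n.+1))%:E) =
     (fun v => (c * \1_(`[0, d]%classic : set R) t * boxind d v)%:E).
    apply/funext => v; rewrite /boxind big_ord_recl -/(rcons0 t v) rcons0_0 mulrA.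
    by congr (_ * _)%:E; apply: eq_bigr => j _; rewrite rcons0_S.
  by rewrite IH mulrAC.
under eq_integral do rewrite EFinM.
rewrite integralZl //; last exact: (@integrable_indic_itv R 0 d true false).
rewrite integral_indic // setIT; have := lebesgue_measure_itv `[0, d]; rewrite /= => ->.
rewrite lte_fin -EFinB subr0; case: ltP => d1; first by rewrite -EFinM exprSr mulrA.
have -> : d = 0 by apply/eqP; rewrite eq_le d1 d0.
by rewrite exprS mul0r !mulr0 mule0.
Qed.

Lemma II_gt0 n (F : 'rV[R]_n -> R) d c : Cc F -> (forall x, 0 <= F x) ->
  0 < d -> 0 < c -> (forall x, `|x| <= d -> c <= F x) -> 0 < II F.
Proof.
move=> cF F0 d0 c0 h.
have : (leb_int (fun x : 'rV[R]_n => (c * boxind d x)%:E) <= leb_int (fun x => (F x)%:E))%E.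
  apply: le_leb_int => x; rewrite lee_fin.
    apply: mulr_ge0; first exact: ltW.
    by apply: prodr_ge0 => j _; rewrite indicE.
  have [b|b] := pselect (forall j, x 0 j \in `[0, d]).
    have xd : `|x| <= d.
      apply: rV_norm_le => [|j]; first exact: ltW.
      by have := b j; rewrite in_itv /= => /andP[x0 xd]; rewrite ger0_norm.
    apply: le_trans (h x xd); rewrite ger_pMr // /boxind.
    by rewrite big1 // => j _; rewrite indicE mem_set //=; exact: b.
  move/existsNP: b => [j bj]; rewrite /boxind (bigD1 j) //= indicE memNset ?mul0r ?mulr0 //.
rewrite (leb_int_box _ _ (ltW d0)) (leb_intE cF) lee_fin; apply: lt_le_trans.
by rewrite mulr_gt0 // exprn_gt0.
Qed.

End LebMono.

(** * Symmetry of mixed derivatives and the mollifier *)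

Section Smooth.
Variables (R : realType) (n : nat).
Local Notation V := 'rV[R]_n.
Local Notation e_ j := (@evec R n j).
Implicit Types (f g : V -> R) (x u v w : V).

(** Two uses of the mean value theorem express the second difference by a mixed derivative near x.
    The second difference is symmetric in u and w, so both mixed derivatives take a common value
    arbitrarily near x. *)
Lemma schwarz_aux f u w x h : 0 < h -> der1 f u -> der1 ('D_u f) w ->
  exists2 p, `|x - p| <= h * (`|u| + `|w|) &
    f (x + h *: u + h *: w) - f (x + h *: u) - (f (x + h *: w) - f x) =
    h * (h * 'D_w ('D_u f) p).
Proof.
move=> h0 [du _] [dwu _].
pose G y := f (y + h *: w) - f y.
have dsh y : is_derive y u (fun y => f (y + h *: w)) ('D_u f (y + h *: w)).
  have E : (fun k : R => k^-1 *: (f (k *: u + y + h *: w) - f (y + h *: w))) =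
     (fun k : R => k^-1 *: (f (k *: u + (y + h *: w)) - f (y + h *: w))).
    by apply/funext => k; rewrite addrA.
  have d := du (y + h *: w).
  by split; rewrite /derivable /derive /= E.
have dG y : is_derive y u G ('D_u f (y + h *: w) - 'D_u f y).
  by have := is_deriveB (dsh y) (derivableP (du y)).
have [t /andP[t0 th] e1] := mvt_line x (fun y => let: DeriveDef d _ := dG y in d) h0.
have [s /andP[s0 sh] e2] := mvt_line (x + t *: u) dwu h0.
exists (x + t *: u + s *: w).
  rewrite -addrA opprD addrA subrr sub0r normrN.
  apply: le_trans (ler_normD _ _) _; rewrite !normrZ mulrDr !gtr0_norm //.
  by apply: lerD; rewrite ler_wpM2r // ltW.
rewrite -e2; have [_ <-] := dG (x + t *: u); rewrite -e1 /G.
by rewrite addrAC.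
Qed.

Lemma eq_of_near_values (A B : V -> R) x c : 0 <= c -> continuous A -> continuous B ->
  (forall h, 0 < h -> exists p q, [/\ `|x - p| <= h * c, `|x - q| <= h * c & A p = B q]) ->
  A x = B x.
Proof.
move=> c0 cA cB H; apply/eqP; rewrite -subr_eq0 -normr_le0.
apply/ler_addgt0Pr => e e0; rewrite add0r.
have [d1 d10 h1] := (proj1 (rV_continuousP _) cA) x (e / 2) ltac:(lra).
have [d2 d20 h2] := (proj1 (rV_continuousP _) cB) x (e / 2) ltac:(lra).
pose h := Num.min d1 d2 / (c + 1).
have h0 : 0 < h by rewrite divr_gt0 ?lt_min ?d10 // ltr_wpDl.
have hd : h * c < Num.min d1 d2.
  by rewrite /h mulrAC ltr_pdivrMr ?ltr_wpDl // ltr_pM2l ?lt_min ?d10 ?d20 // ltrDl.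
move: hd; rewrite lt_min => /andP[hd1 hd2].
have [p [q [px qx E]]] := H h h0.
have e1 := h1 p (le_lt_trans px hd1); have e2 := h2 q (le_lt_trans qx hd2).
rewrite E in e1; rewrite distrC in e2.
have := ler_normD (A x - B q) (B q - B x); rewrite addrA subrK => /le_trans; apply.
by rewrite [e]splitr; apply: lerD; exact: ltW.
Qed.

Lemma schwarz f u w : der1 f u -> der1 f w -> der1 ('D_u f) w -> der1 ('D_w f) u ->
  'D_w ('D_u f) = 'D_u ('D_w f).
Proof.
move=> fu fw fuw fwu; apply/funext => x.
have R4 (a b c d : R) : a - b - (c - d) = a - c - (b - d) by ring.
apply: (@eq_of_near_values ('D_w ('D_u f)) ('D_u ('D_w f)) x (`|u| + `|w|)).
- exact: addr_ge0.
- exact: (proj2 fuw).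
- exact: (proj2 fwu).
move=> h h0; have [p px ep] := schwarz_aux x h0 fu fuw.
have [q qx eq] := schwarz_aux x h0 fw fwu.
exists p, q; split; [exact: px|by rewrite [`|u| + _]addrC; exact: qx|].
apply: (mulfI (lt0r_neq0 h0)); apply: (mulfI (lt0r_neq0 h0)).
apply: etrans (esym ep) (etrans _ eq); apply: etrans (R4 _ _ _ _) _.
by rewrite [x + h *: w + h *: u]addrAC.
Qed.

Lemma CK_sym f j k : CK 2 f -> 'D_(e_ j) ('D_(e_ k) f) = 'D_(e_ k) ('D_(e_ j) f).
Proof.
move=> cf; have h l : der1 f (e_ l) := CK_der1 l cf.
by apply: schwarz => //; [exact: (CK_der1 j (CK_derive k cf))|exact: (CK_der1 k (CK_derive j cf))].
Qed.

Lemma is_derive_comp f (phi : R -> R) x v a b : is_derive x v f a ->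
  is_derive (f x) 1 phi b -> is_derive x v (fun y => phi (f y)) (b * a).
Proof.
move=> [df da] dphi.
have E (g : V -> R) : (fun h : R => h^-1 *: (g ((h *: (1 : R) + 0) *: v + x) - g (0 *: v + x))) =
   (fun h : R => h^-1 *: (g (h *: v + x) - g x)).
  by apply/funext => h; rewrite scale0r add0r addr0 [h *: 1]mulr1.
have h1 : is_derive (0 : R) (1 : R) (fun h : R => f (h *: v + x)) a.
  by split; rewrite /derivable /derive /= (E f).
have dphi' : is_derive ((fun h : R => f (h *: v + x)) 0) (1 : R) phi b.
  by rewrite /= scale0r add0r.
have [] := is_derive1_comp dphi' h1.
by rewrite /derivable /derive /= (E (fun y => phi (f y))); split.
Qed.

Lemma is_derive_posX m (t : R) : is_derive t 1 (fun s : R => Num.max 0 s ^+ m.+2)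
  (m.+2%:R * Num.max 0 t ^+ m.+1).
Proof.
have dX (s : R) : is_derive s 1 (fun s : R => s ^+ m.+2) (m.+2%:R * s ^+ m.+1).
  by split; [exact: exprn_derivable|rewrite exp_derive [_ *: _]mulr1].
have [t0|t0|<-] := ltgtP 0 t.
- apply: near_eq_is_derive (dX t); near=> s.
  by rewrite max_r // ltW //; near: s; exact: lt_nbhsr.
- rewrite expr0n /= mulr0.
  apply: near_eq_is_derive (is_derive_cst (0 : R) t 1); near=> s.
  by rewrite max_l ?expr0n // ltW //; near: s; exact: lt_nbhsl.
rewrite expr0n /= mulr0.
have lim : h^-1 *: (Num.max 0 (h *: (1 : R) + 0) ^+ m.+2 - Num.max 0 0 ^+ m.+2) @[h --> (0 : R)^'] --> (0 : R).
  apply/cvgrPdist_le => e e0; near=> h.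
  have h0 : h != 0 by near: h; exact: nbhs_dnbhs_neq.
  have he : `|h| < e by near: h; apply: dnbhs0_lt.
  have h1 : `|h| < 1 by near: h; apply: dnbhs0_lt.
  rewrite addr0 [h *: 1]mulr1 maxxx expr0n /= subr0 sub0r normrN.
  have [hp|hn] := leP 0 h; last by rewrite expr0n scaler0 normr0 ltW.
  rewrite exprS [_ *: _]mulKf // normrX exprS; apply: le_trans (ltW he).
  by rewrite ler_piMr // exprn_ile1 // ltW.
split; first by apply/cvg_ex; exists 0.
by rewrite /derive; apply/cvg_lim.
Unshelve. all: end_near. Qed.

Definition sqnorm x : R := \sum_j x 0 j ^+ 2.

Lemma continuous_sqnorm : continuous sqnorm.
Proof. by apply: rV_cont_sum => j; apply: rV_contX; exact: rV_cont_coord. Qed.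

Lemma sqnormN x : sqnorm (- x) = sqnorm x.
Proof. by apply: eq_bigr => j _; rewrite mxE sqrrN. Qed.

Lemma coord_sq_le x j : x 0 j ^+ 2 <= sqnorm x.
Proof. by rewrite /sqnorm (bigD1 j) //= lerDl sumr_ge0 // => k _; exact: sqr_ge0. Qed.

Lemma sqnorm_ge0 x : 0 <= sqnorm x.
Proof. by apply: sumr_ge0 => j _; exact: sqr_ge0. Qed.

Lemma norm_sqnorm x : `|x| ^+ 2 <= sqnorm x.
Proof.
rewrite -[leRHS]sqr_sqrtr ?sqnorm_ge0 // ler_pXn2r ?nnegrE //.
apply: rV_norm_le => // j.
by rewrite -sqrtr_sqr ler_wsqrtr // coord_sq_le.
Qed.

Lemma is_derive_sqnorm x j : is_derive x (e_ j) sqnorm (2 * x 0 j).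
Proof.
have cN : CK 1 sqnorm.
  by apply: CK_sum => k; have := CKM (CK_coord _ 1 k) (CK_coord _ 1 k).
have h k : is_derive x (e_ j) (fun y : V => y 0 k ^+ 2) (2 * x 0 k * e_ j 0 k).
  apply: (is_derive_eq (is_deriveM (is_derive_coord x (e_ j) k) (is_derive_coord x (e_ j) k))).
  by rewrite /GRing.scale /=; ring.
apply: (is_derive_eq (is_derive_bigsum (index_enum _) xpredT h)).
rewrite (bigD1 j) //= big1 ?addr0; first by rewrite mxE !eqxx mulr1.
by move=> k kj; rewrite mxE eqxx /= (negbTE kj) mulr0.
Qed.

Definition bump (h : R) m x : R := Num.max 0 (h ^+ 2 - sqnorm x) ^+ m.

Lemma continuous_bump h m : continuous (bump h m).
Proof.
apply: rV_contX; apply: rV_cont_max; first exact: rV_cont_cst.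
by apply: rV_contB; [exact: rV_cont_cst|exact: continuous_sqnorm].
Qed.

Lemma CK_bump h k : CK k (bump h k.+1).
Proof.
elim: k => [|k IH]; first by split=> //; exact: continuous_bump.
split; first exact: continuous_bump.
have D x j : is_derive x (e_ j) (bump h k.+2)
    ((k.+2%:R * bump h k.+1 x) * (-2 * x 0 j)).
  have dq : is_derive x (e_ j) (fun y => h ^+ 2 - sqnorm y) (-2 * x 0 j).
    have := is_deriveB (is_derive_cst (h ^+ 2) x (e_ j)) (is_derive_sqnorm x j).
    by rewrite sub0r mulNr.
  exact: (is_derive_comp dq (is_derive_posX k _)).
move=> j; split; first by move=> x; have [] := D x j.
have -> : 'D_(e_ j) (bump h k.+2) = (fun x => (k.+2%:R * bump h k.+1 x) * (-2 * x 0 j)).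
  by apply/funext => x; have [_] := D x j.
by apply: CKM; apply: CKM => //; [exact: CK_cst|exact: CK_cst|exact: CK_coord].
Qed.

Lemma bump_supp h m x : 0 <= h -> h < `|x| -> bump h m.+1 x = 0.
Proof.
move=> h0 hx; rewrite /bump max_l ?expr0n // subr_le0.
by apply: le_trans (norm_sqnorm x); rewrite ler_pXn2r ?nnegrE // ltW.
Qed.

Lemma bump_ge0 h m x : 0 <= bump h m x.
Proof. by rewrite exprn_ge0 // le_max lexx. Qed.

Lemma Cc_bump h m : 0 <= h -> Cc (bump h m.+1).
Proof.
by move=> h0; split; [exact: continuous_bump|exists h => x hx; exact: bump_supp].
Qed.

Lemma bump_gt0 h m : 0 < h -> 0 < II (bump h m.+1).
Proof.
move=> h0; have [d d0 hd] : exists2 d : R, 0 < d & forall x, `|x| <= d -> sqnorm x <= h ^+ 2 / 2.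
  have [|d d0 hd] := (proj1 (rV_continuousP _) continuous_sqnorm) 0 (h ^+ 2 / 2).
    by rewrite divr_gt0 // exprn_gt0.
  exists (d / 2) => [|x xd]; first lra.
  have := hd x; rewrite sub0r normrN => /(_ ltac:(lra)).
  rewrite (_ : sqnorm 0 = 0) ?sub0r ?normrN; last first.
    by rewrite /sqnorm big1 // => j _; rewrite mxE expr0n.
  by rewrite ger0_norm ?sqnorm_ge0 // => /ltW.
apply: (@II_gt0 _ _ _ d ((h ^+ 2 / 2) ^+ m.+1)) => //.
- exact: Cc_bump (ltW h0).
- exact: bump_ge0.
- by rewrite exprn_gt0 // divr_gt0 // exprn_gt0.
move=> x /hd xd; have h2 : 0 < h ^+ 2 by rewrite exprn_gt0.
rewrite /bump; apply: lerXn2r; rewrite ?nnegrE ?le_max ?lexx //; first lra.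
by apply/orP; right; lra.
Qed.

(** The exponent 4 makes the kernel [CK 3], the regularity that the divergence identity asks for,
    since it differentiates the Hessian once. *)
Definition mollifier h x : R := (II (bump h 4))^-1 * bump h 4 x.

Definition moll h g : V -> R := conv (mollifier h) g.

Section Mollify.
Variable h : R.
Hypothesis h0 : 0 < h.

Lemma Cc_mollifier : Cc (mollifier h).
Proof. by apply: CcZ; exact: Cc_bump (ltW h0). Qed.

Lemma CK_mollifier : CK 3 (mollifier h).
Proof. by apply: CKM; [exact: CK_cst|exact: CK_bump]. Qed.

Lemma mollifier_ge0 x : 0 <= mollifier h x.
Proof. by rewrite mulr_ge0 ?bump_ge0 // invr_ge0 ltW // bump_gt0. Qed.

Lemma mollifier_supp x : h < `|x| -> mollifier h x = 0.
Proof. by move=> hx; rewrite /mollifier bump_supp ?mulr0 // ltW. Qed.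

Lemma mollifier_even x : mollifier h (- x) = mollifier h x.
Proof. by rewrite /mollifier /bump sqnormN. Qed.

Lemma II_mollifier : II (mollifier h) = 1.
Proof.
by rewrite IIZ ?mulVf ?gt_eqF ?bump_gt0 //; exact: Cc_bump (ltW h0).
Qed.

Lemma mollE g x : continuous g -> moll h g x = II (fun z => mollifier h z * g (z + x)).
Proof.
move=> cg; rewrite -[LHS](II_shift x); last by apply: Cc_conv => //; exact: Cc_mollifier.
by congr II; apply/funext => z; rewrite opprD addrCA subrr addr0 mollifier_even.
Qed.

Lemma Cc_mollE g x : continuous g -> Cc (fun z => mollifier h z * g (z + x)).
Proof. by move=> cg; apply: Cc_mul; [exact: Cc_mollifier|exact: rV_cont_shift]. Qed.

Lemma CK_moll g : continuous g -> CK 3 (moll h g).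
Proof. by move=> cg; apply: CK_conv => //; [exact: Cc_mollifier|exact: CK_mollifier]. Qed.

(** The kernel is nonnegative, of mass 1 and supported in the ball of radius h. Closeness, locality
    and Lipschitz bounds are all instances, with a suitable choice of the two functions and
    points. *)
Lemma moll_diff g1 g2 x1 x2 e : continuous g1 -> continuous g2 ->
  (forall z, `|z| <= h -> `|g1 (z + x1) - g2 (z + x2)| <= e) ->
  `|moll h g1 x1 - moll h g2 x2| <= e.
Proof.
move=> c1 c2 H; rewrite !mollE // -IIB; [|exact: Cc_mollE..].
rewrite -[e]mulr1 -II_mollifier -IIZ; last exact: Cc_mollifier.
apply: II_norm_le; [by apply: CcB; exact: Cc_mollE|by apply: CcZ; exact: Cc_mollifier|].
move=> z; rewrite -mulrBr normrM ger0_norm ?mollifier_ge0 // mulrC.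
have [zh|zh] := leP `|z| h; last by rewrite mollifier_supp // !mulr0.
by rewrite ler_wpM2r ?mollifier_ge0 // H.
Qed.

Lemma moll_close g x e : continuous g -> 
  (forall z, `|z| <= h -> `|g (z + x) - g x| <= e) -> `|moll h g x - g x| <= e.
Proof.
move=> cg H; have := @moll_diff g (fun=> g x) x x e cg (@rV_cont_cst _ _ _) H.
rewrite (_ : moll h (fun=> g x) x = g x) // mollE; last exact: rV_cont_cst.
under eq_fun do rewrite mulrC.
by rewrite IIZ ?II_mollifier ?mulr1 //; exact: Cc_mollifier.
Qed.

Lemma moll_local g1 g2 x : continuous g1 -> continuous g2 ->
  (forall z, `|z| <= h -> g1 (z + x) = g2 (z + x)) -> moll h g1 x = moll h g2 x.
Proof.
move=> c1 c2 H; apply/eqP; rewrite -subr_eq0 -normr_le0; apply: moll_diff => // z zh.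
by rewrite H // subrr normr0.
Qed.

Lemma moll_convex g : continuous g -> convex_fun g -> convex_fun (moll h g).
Proof.
move=> cg cvg x y t t01; rewrite !mollE // -!IIZ; [|exact: Cc_mollE..].
rewrite -IID; [|by apply: CcZ; exact: Cc_mollE..].
apply: le_II; first exact: Cc_mollE.
  by apply: CcA; apply: CcZ; exact: Cc_mollE.
move=> z; set m := mollifier h z.
have -> : (1 - t) * (m * g (z + x)) + t * (m * g (z + y)) =
  m * ((1 - t) * g (z + x) + t * g (z + y)) by ring.
apply: ler_wpM2l; first exact: mollifier_ge0.
have -> : z + ((1 - t) *: x + t *: y) = (1 - t) *: (z + x) + t *: (z + y).
  by apply/rowP => j; rewrite !mxE; ring.
exact: cvg.
Qed.

End Mollify.

Lemma hessian_local f g (r : R) : (forall x, `|x| < r -> f x = g x) ->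
  forall x, `|x| < r -> hessian f x = hessian g x.
Proof.
move=> fg x xr; have N (y : V) : `|y| < r -> \forall z \near y, `|z| < r.
  by move=> yr; apply: (@cvgr_norm_lt _ _ _ (nbhs y) _ id y).
apply/matrixP => j k; rewrite [LHS]mxE [RHS]mxE.
apply: (@near_eq_derive _ _ _ ('D_(e_ k) f) ('D_(e_ k) g) x (e_ j)).
apply: filterS (N x xr) => y yr; apply: (@near_eq_derive _ _ _ f g y (e_ k)).
by apply: filterS (N y yr) => z; exact: fg.
Qed.

Lemma derive_affine c (p : V) k :
  'D_(e_ k) (fun x : V => c + \sum_j p 0 j * x 0 j) = (fun=> p 0 k).
Proof.
apply/funext => y.
have h l : is_derive y (e_ k) (fun y : V => p 0 l * y 0 l) (p 0 l * e_ k 0 l).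
  exact: (is_deriveZ (p 0 l) (is_derive_coord y (e_ k) l)).
have [_ ->] := is_deriveD (is_derive_cst c y (e_ k)) (is_derive_bigsum (index_enum _) xpredT h).
rewrite add0r (bigD1 k) //= big1 ?addr0; first by rewrite mxE !eqxx mulr1.
by move=> l lk; rewrite mxE eqxx /= (negbTE lk) mulr0.
Qed.

Lemma hessian_affine c (p x : V) : hessian (fun x => c + \sum_j p 0 j * x 0 j) x = 0.
Proof.
by apply/matrixP => j k; rewrite !mxE derive_affine; exact: derive_cst.
Qed.

(** The constant changes by the integral of the linear part against the mollifier; its value is left
    open because Hessians ignore constants. *)
Lemma moll_affine h c (p : V) : 0 < h -> exists c', 
  moll h (fun x => c + \sum_j p 0 j * x 0 j) = (fun x => c' + \sum_j p 0 j * x 0 j).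
Proof.
move=> h0; pose l x : R := \sum_j p 0 j * x 0 j.
have cl : continuous l.
  by apply: rV_cont_sum => j; apply: rV_contM; [exact: rV_cont_cst|exact: rV_cont_coord].
have cf : continuous (fun x => c + l x) by apply: rV_contD => //; exact: rV_cont_cst.
exists (c + II (fun z => mollifier h z * l z)); apply/funext => x.
rewrite mollE // -/(l x) -[LHS]/(II _).
have cm := Cc_mollifier h0; have cml : Cc (fun z => mollifier h z * l z) by exact: Cc_mul.
have -> : (fun z => mollifier h z * (c + l (z + x))) =
   (fun z => (c + l x) * mollifier h z + mollifier h z * l z).
  apply/funext => z; rewrite (_ : l (z + x) = l z + l x); first ring.
  by rewrite /l -big_split; apply: eq_bigr => j _; rewrite !mxE mulrDr.
by rewrite II_lin // II_mollifier // mulr1 addrAC.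
Qed.

End Smooth.

(** * Smooth approximation of convex functions *)

Section Convex.
Variables (R : realType) (n : nat).
Local Notation V := 'rV[R]_n.
Local Notation e_ j := (@evec R n j).
Implicit Types (f g : V -> R) (x y z : V).

Lemma convex_segment f x y t : convex_fun f -> 0 <= t <= 1 ->
  f ((1 - t) *: x + t *: y) <= Num.max (f x) (f y).
Proof.
move=> cf /andP[t0 t1]; apply: le_trans (cf x y t _) _; first by rewrite t0 t1.
set m := Num.max _ _; have h1 : f x <= m by rewrite le_max lexx.
have h2 : f y <= m by rewrite le_max lexx orbT.
have -> : m = (1 - t) * m + t * m by ring.
by apply: lerD; apply: ler_wpM2l => //; lra.
Qed.

(** Induction on the number of coordinates allowed to be nonzero: x is the midpoint of a vector with
    one coordinate fewer and of a multiple of a basis vector, both of twice the size; the latter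
    lies on a fixed segment, where the endpoints bound f. *)
Lemma convex_bounded_above f r : convex_fun f ->
  exists C, forall x, `|x| <= r -> f x <= C.
Proof.
move=> cf.
have P k : forall s : R, 0 < s -> exists C, forall x, `|x| <= s ->
    (forall j : 'I_n, (k <= j)%N -> x 0 j = 0) -> f x <= C.
  elim: k => [|k IH] s s0.
    exists (f 0) => x _ hx; rewrite (_ : x = 0) //.
    by apply/rowP => j; rewrite hx // mxE.
  have [kn|nk] := ltnP k n; last first.
    have [C hC] := IH s s0; exists C => x xs hx; apply: hC => // j kj.
    by have := ltn_ord j; rewrite ltnNge (leq_trans nk kj).
  have [C hC] := IH (2 * s) ltac:(lra).
  pose j0 := Ordinal kn.
  pose D := Num.max (f (- (2 * s) *: e_ j0)) (f ((2 * s) *: e_ j0)).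
  exists (Num.max C D) => x xs hx.
  pose x' : V := \row_j (if j == j0 then 0 else 2 * x 0 j).
  have e1 : x = (1 - 1 / 2) *: x' + (1 / 2) *: ((2 * x 0 j0) *: e_ j0).
    apply/rowP => j; rewrite !mxE eqxx /=; have [->|jj] := eqVneq j j0.
      by rewrite mulr1; field.
    by rewrite mulr0 mulr0 addr0; field.
  have h1 : f x' <= C.
    apply: hC.
      apply: rV_norm_le => [|j]; first lra.
      rewrite mxE; case: ifP => _; first by rewrite normr0; lra.
      by rewrite normrM ger0_norm // ler_pM2l //; apply: le_trans (rV_coord_le _ _) xs.
    move=> j kj; rewrite mxE; case: eqP => // jj; rewrite hx ?mulr0 //.
    by rewrite ltn_neqAle kj andbT; apply/eqP => e; apply: jj; exact: val_inj.
  have h2 : f ((2 * x 0 j0) *: e_ j0) <= D.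
    pose t := (2 * x 0 j0 + 2 * s) / (4 * s).
    have := le_trans (rV_coord_le x j0) xs; rewrite ler_norml => /andP[xa xb].
    have t01 : 0 <= t <= 1.
      by apply/andP; split; [apply: divr_ge0; lra|rewrite ler_pdivrMr; lra].
    have := convex_segment (- (2 * s) *: e_ j0) ((2 * s) *: e_ j0) cf t01.
    rewrite !scalerA -scalerDl.
    by have -> : (1 - t) * - (2 * s) + t * (2 * s) = 2 * x 0 j0 by rewrite /t; field; lra.
  rewrite e1; apply: le_trans (convex_segment _ _ cf _) _; first by apply/andP; split; lra.
  rewrite ge_max; apply/andP; split; first by rewrite le_max h1.
  by rewrite le_max; apply/orP; right.
have [C hC] := P n (`|r| + 1) ltac:(by rewrite ltr_wpDl).
exists C => x xr; apply: hC => [|j]; last by rewrite leqNgt ltn_ord.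
by apply: le_trans xr _; have := ler_norm r; lra.
Qed.

(** As 0 is the midpoint of x and - x, an upper bound C yields f x >= 2 f(0) - C. *)
Lemma convex_bounded f r : convex_fun f ->
  exists2 M, 0 < M & forall x, `|x| <= r -> `|f x| <= M.
Proof.
move=> cf; have [C hC] := convex_bounded_above r cf.
exists (`|C| + 2 * `|f 0| + 1) => [|x xr].
  by rewrite ltr_wpDl // addr_ge0 // mulr_ge0.
have h1 := hC x xr; have h2 : f (- x) <= C by apply: hC; rewrite normrN.
have := cf x (- x) (1 / 2) ltac:(apply/andP; split; lra).
have -> : (1 - 1 / 2) *: x + (1 / 2) *: - x = 0.
  by apply/rowP => j; rewrite !mxE; field.
have := ler_norm C; have := ler_norm (- f 0); rewrite normrN; have := ler_norm (f 0).
by rewrite ler_norml => *; apply/andP; split; lra.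
Qed.

(** The segment from x to y is prolonged by the length d to a point z. Then y has weight a / (a + d)
    on z, where a = |x - y|, and f is bounded by M at x and z. *)
Lemma convex_lipschitz f r d M : convex_fun f -> 0 < d -> 0 <= M ->
  (forall x, `|x| <= r + d -> `|f x| <= M) ->
  forall x y, `|x| <= r -> `|y| <= r -> `|f x - f y| <= 2 * M / d * `|x - y|.
Proof.
move=> cf d0 M0 hM.
have main x y : `|x| <= r -> `|y| <= r -> f y - f x <= 2 * M / d * `|x - y|.
  move=> xr yr; have [->|xy] := eqVneq x y.
    by rewrite !subrr normr0 mulr0.
  have a0 : 0 < `|x - y| by rewrite normr_gt0 subr_eq0.
  set a := `|x - y| in a0 *.
  pose z := y + (d / a) *: (y - x).
  have zr : `|z| <= r + d.
    apply: le_trans (ler_normD _ _) _; apply: lerD => //.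
    by rewrite normrZ distrC -/a ger0_norm ?divfK ?gt_eqF // divr_ge0 // ltW.
  pose t := a / (a + d).
  have t01 : 0 <= t <= 1.
    by apply/andP; split; [rewrite divr_ge0; lra|rewrite ler_pdivrMr; lra].
  have := cf x z t t01.
  have -> : (1 - t) *: x + t *: z = y.
    by apply/rowP => j; rewrite !mxE /t; field; rewrite !gt_eqF //; lra.
  have /andP[t0 t1] := t01.
  have fx : `|f x| <= M by apply: hM; lra.
  have fz := hM z zr.
  have ta : t * (2 * M) <= 2 * M / d * a.
    rewrite mulrC -!mulrA ler_wpM2l // ler_wpM2l // /t mulrC ler_wpM2r ?(ltW a0) //.
    by rewrite lef_pV2 ?posrE; lra.
  move: fx fz; rewrite !ler_norml => /andP[fx1 fx2] /andP[fz1 fz2] h.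
  have : t * (f z - f x) <= t * (2 * M) by apply: ler_wpM2l => //; lra.
  lra.
move=> x y xr yr; rewrite ler_norml; apply/andP; split.
  by have := main x y xr yr; lra.
by rewrite distrC; exact: main.
Qed.

Lemma convex_continuous f : convex_fun f -> continuous f.
Proof.
move=> cf; apply/rV_continuousP => x e e0.
have [M M0 hM] := convex_bounded (`|x| + 1 + 1) cf.
have L0 : 0 < 2 * M / 1 + 1 by lra.
exists (Num.min 1 (e / (2 * M / 1 + 1))) => [|y]; first by rewrite lt_min ltr01 divr_gt0.
rewrite lt_min => /andP[xy1 xye].
apply: le_lt_trans (convex_lipschitz cf ltr01 (ltW M0) hM _ _) _.
- by rewrite lerDl.
- by have := ler_normB x (x - y); rewrite opprB addrCA subrr addr0; lra.
rewrite ltr_pdivlMr // in xye; apply: le_lt_trans xye.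
by rewrite mulrC ler_wpM2l //; lra.
Qed.

Lemma convex_max f g : convex_fun f -> convex_fun g ->
  convex_fun (fun x => Num.max (f x) (g x)).
Proof.
move=> cf cg x y t t01; have /andP[t0 t1] := t01; rewrite ge_max; apply/andP; split.
  apply: le_trans (cf x y t t01) _; apply: lerD; apply: ler_wpM2l; rewrite ?le_max ?lexx //; lra.
apply: le_trans (cg x y t t01) _; apply: lerD; apply: ler_wpM2l; rewrite ?le_max ?lexx ?orbT //; lra.
Qed.

Definition affine c (p : V) x : R := c + \sum_j p 0 j * x 0 j.

Lemma affine_convex c p : convex_fun (affine c p).
Proof.
move=> x y t _; rewrite le_eqVlt /affine; apply/orP; left; apply/eqP.
have -> : \sum_j p 0 j * ((1 - t) *: x + t *: y) 0 j =
  (1 - t) * (\sum_j p 0 j * x 0 j) + t * (\sum_j p 0 j * y 0 j).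
  by rewrite !mulr_sumr -big_split; apply: eq_bigr => j _; rewrite !mxE /=; ring.
ring.
Qed.

Lemma affine_continuous c p : continuous (affine c p).
Proof.
apply: rV_contD; first exact: rV_cont_cst.
by apply: rV_cont_sum => j; apply: rV_contM; [exact: rV_cont_cst|exact: rV_cont_coord].
Qed.

Lemma convex_tangent_le f A x v : convex_fun f -> (forall y, is_derive y v f (A y)) ->
  continuous A -> f x + A x <= f (x + v).
Proof.
move=> cvf fA cA; apply/ler_addgt0Pr => e e0.
have [d d0 hd] := (proj1 (rV_continuousP _) cA) x e e0.
pose h := Num.min 1 (d / (`|v| + 1)).
have v1 : 0 < `|v| + 1 by rewrite ltr_wpDl.
have h0 : 0 < h by rewrite lt_min ltr01 divr_gt0.
have h1 : h <= 1 by rewrite ge_min lexx.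
have [s /andP[s0 sh] E] := mvt_is_derive x fA h0.
have := cvf x (x + v) h ltac:(by rewrite h1 ltW).
have -> : (1 - h) *: x + h *: (x + v) = x + h *: v.
  by rewrite scalerDr addrA -scalerDl subrK scale1r.
move=> cvx.
have : h * A (x + s *: v) <= h * (f (x + v) - f x) by rewrite -E; lra.
rewrite ler_pM2l // => le1.
have := hd (x + s *: v); rewrite opprD addrA subrr sub0r normrN normrZ gtr0_norm //.
have sx : s * `|v| < d.
  apply: le_lt_trans (_ : s * (`|v| + 1) < _); first by rewrite ler_pM2l // lerDl.
  rewrite -ltr_pdivlMr //; apply: lt_le_trans sh _.
  by rewrite ge_min lexx orbT.
by move=> /(_ sx); rewrite ltr_norml => /andP[_]; lra.
Qed.

Lemma subgradient f x : convex_fun f -> CK 1 f ->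
  affine (f 0) (\row_j 'D_(e_ j) f 0) x <= f x.
Proof.
move=> cvf cf; have [dx cdx] := CK1_der1 x cf.
have := @convex_tangent_le f ('D_x f) 0 x cvf (fun y => derivableP (dx y)) cdx.
rewrite add0r; congr (_ + _ <= _).
have [_ ->] := chain_rule 0 x cf.
by apply: eq_bigr => j _; rewrite mxE mulrC.
Qed.

(** Infimal convolution of g, restricted to the ball, with L |.|. Minimising a jointly convex
    expression over a convex ball preserves convexity, and the Lipschitz bound for g makes y = x
    optimal inside the ball. *)
Lemma convex_ext g r d M : convex_fun g -> 0 <= r -> 0 < d -> 0 <= M ->
  (forall x, `|x| <= r + d -> `|g x| <= M) ->
  exists g', [/\ convex_fun g', forall x, `|x| <= r -> g' x = g x &
    forall x y, `|g' x - g' y| <= 2 * M / d * `|x - y|].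
Proof.
move=> cg r0 d0 M0 hM; set L := 2 * M / d.
have L0 : 0 <= L by rewrite divr_ge0 // ?mulr_ge0 // ltW.
pose A x := [set g y + L * `|x - y| | y in [set y | `|y| <= r]].
have Alb x : has_lbound (A x).
  exists (- M) => _ [y /= yr <-].
  have : `|g y| <= M by apply: hM; lra.
  rewrite ler_norml => /andP[h _]; have : 0 <= L * `|x - y| by rewrite mulr_ge0.
  lra.
have A0 x : A x !=set0 by exists (g 0 + L * `|x - 0|), 0 => //=; rewrite normr0.
have Ainf x : has_inf (A x) by split.
pose g' x := inf (A x).
have le1 x y : `|y| <= r -> g' x <= g y + L * `|x - y|.
  by move=> yr; apply: ge_inf => //; exists y.
have near x e : 0 < e -> exists2 y, `|y| <= r & g y + L * `|x - y| < g' x + e.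
  by move=> e0; have [_ [y yr <-] h] := inf_adherent e0 (Ainf x); exists y.
have lip := convex_lipschitz cg d0 M0 hM; rewrite -/L in lip.
exists g'; split.
- move=> x1 x2 t t01; have /andP[t0 t1] := t01; apply/ler_addgt0Pr => e e0.
  have [y1 y1r h1] := near x1 e e0; have [y2 y2r h2] := near x2 e e0.
  have yr : `|(1 - t) *: y1 + t *: y2| <= r.
    apply: le_trans (ler_normD _ _) _; rewrite !normrZ !ger0_norm ?subr_ge0 //.
    have -> : r = (1 - t) * r + t * r by ring.
    by apply: lerD; apply: ler_wpM2l => //; lra.
  apply: le_trans (le1 _ _ yr) _.
  have h3 := cg y1 y2 t t01.
  have h4 : `|(1 - t) *: x1 + t *: x2 - ((1 - t) *: y1 + t *: y2)| <=
      (1 - t) * `|x1 - y1| + t * `|x2 - y2|.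
    have -> : (1 - t) *: x1 + t *: x2 - ((1 - t) *: y1 + t *: y2) =
       (1 - t) *: (x1 - y1) + t *: (x2 - y2).
      by apply/rowP => j; rewrite !mxE; ring.
    by apply: le_trans (ler_normD _ _) _; rewrite !normrZ !ger0_norm ?subr_ge0.
  have := ler_wpM2l L0 h4; have := ler_wpM2l t0 (ltW h2).
  have t1' : 0 <= 1 - t by lra.
  have := ler_wpM2l t1' (ltW h1); lra.
- move=> x xr; apply/eqP; rewrite eq_le; apply/andP; split.
    by have := le1 x x xr; rewrite subrr normr0 mulr0 addr0.
  apply/ler_addgt0Pr => e e0; have [y yr h] := near x e e0.
  by have := lip x y xr yr; rewrite ler_norml => /andP[]; lra.
- have main x y : g' x - g' y <= L * `|x - y|.
    rewrite lerBlDr; apply/ler_addgt0Pr => e e0; have [z zr h] := near y e e0.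
    have := le1 x z zr; have : L * `|x - z| <= L * (`|x - y| + `|y - z|).
      by apply: ler_wpM2l => //; have := ler_normD (x - y) (y - z); rewrite addrA subrK.
    rewrite mulrDr; lra.
  move=> x y; rewrite ler_norml; apply/andP; split; last exact: main.
  by have := main y x; rewrite distrC; lra.
Qed.

(* f is mollified, made affine near 0 by taking the maximum with a raised
   tangent plane, and mollified again; the companion G coincides with F near 0
   and is Lipschitz on the whole space. *)
Lemma smooth_approx f r N M e : convex_fun f -> 0 < r -> r <= N -> 0 < e <= 1 ->
  0 <= M -> (forall x, `|x| <= r -> `|f x| <= M) ->
  exists F G d, [/\ [/\ CK 3 F, convex_fun F, 0 < d &
      forall x, `|x| < d -> hessian F x = 0],
    forall x, `|x| <= N -> `|F x - f x| <= e,
    [/\ CK 3 G, convex_fun G, `|G 0| <= M + 1 &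
      forall x y, `|G x - G y| <= 4 * (M + 1) / r * `|x - y|] &
    forall x, `|x| < r / 4 -> hessian G x = hessian F x].
Proof.
move=> cvf r0 rN /andP[e0 e1] M0 hM.
have cf := convex_continuous cvf.
have [d1 d10 hd1] := ucont cf (N + 1) (e := e / 4) ltac:(lra).
pose h1 := d1 / 2; have h10 : 0 < h1 by rewrite divr_gt0.
pose f1 := moll h1 f.
have f1K : CK 3 f1 by exact: CK_moll.
have cvf1 : convex_fun f1 by exact: moll_convex.
have cf1 := CK_cont f1K.
have f1f x : `|x| <= N + 1 -> `|f1 x - f x| <= e / 4.
  move=> xN; apply: moll_close => // z zh; rewrite distrC; apply/ltW/hd1 => //.
  by rewrite opprD addrCA subrr addr0 normrN; apply: le_lt_trans zh _; rewrite /h1; lra.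
pose p : V := \row_j 'D_(e_ j) f1 0.
(* Raised by e / 4, the tangent plane exceeds [f1] near 0 by continuity, and nowhere by more than e
   / 4 by the subgradient inequality. The maximum is thus affine near 0 and close to [f1]
   everywhere. *)
pose l := affine (f1 0 + e / 4) p.
have cl : continuous l by exact: affine_continuous.
pose g x := Num.max (f1 x) (l x).
have cvg : convex_fun g by apply: convex_max => //; exact: affine_convex.
have cg := convex_continuous cvg.
have lf1 x : l x <= f1 x + e / 4.
  have := subgradient x cvf1 (CK_S (CK_S f1K)); rewrite /l /affine -/p; lra.
have gf x : `|x| <= N + 1 -> `|g x - f x| <= e / 2.
  move=> /f1f; rewrite !ler_norml /g => /andP[a b].
  have := lf1 x; case: (leP (f1 x) (l x)) => *; apply/andP; split; lra.
have [d d0 gl] : exists2 d, 0 < d & forall x, `|x| < d -> g x = l x.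
  have [d d0 hd] := (proj1 (rV_continuousP _) (rV_contB cf1 cl)) 0 (e / 4) ltac:(lra).
  exists d => // x xd; rewrite /g max_r //.
  have := hd x; rewrite sub0r normrN => /(_ xd).
  have -> : l 0 = f1 0 + e / 4.
    by rewrite /l /affine big1 ?addr0 // => j _; rewrite [X in _ * X]mxE mulr0.
  by rewrite ltr_norml => /andP[]; lra.
have [d2 d20 hd2] := ucont cg N (e := e / 2) ltac:(lra).
(* The three bounds keep the second mollification within e / 2 of g, inside the region where g is
   affine, and inside the ball where g equals its extension, as r / 4 + r / 8 < r / 2. *)
pose h := Num.min (d2 / 2) (Num.min (d / 2) (r / 8)).
have h0 : 0 < h by rewrite !lt_min !divr_gt0.
have hd2' : h <= d2 / 2 by rewrite /h ge_min lexx.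
have hd' : h <= d / 2 by rewrite /h !ge_min lexx orbT.
have hr : h <= r / 8 by rewrite /h !ge_min lexx !orbT.
have gM x : `|x| <= r / 2 + r / 2 -> `|g x| <= M + 1.
  move=> xr; have xr' : `|x| <= r by lra.
  have := gf x ltac:(lra); have := hM x xr'.
  have := ler_normD (g x - f x) (f x); rewrite subrK; lra.
have r2 : 0 < r / 2 by lra.
have M1 : 0 <= M + 1 by lra.
(* The ball of radius r is split into a kept ball and a margin of r / 2 each; the Lipschitz constant
   is 2 (M + 1) / (r / 2) = 4 (M + 1) / r. *)
have [G0 [cvG0 G0g G0L]] := convex_ext cvg (ltW r2) r2 M1 gM.
have cG0 := convex_continuous cvG0.
have zl (x z : V) a b : `|x| < a -> `|z| <= b -> `|z + x| < a + b.
  by move=> xa zb; have := ler_normD z x; lra.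
exists (moll h g), (moll h G0), (d / 2); split.
- split; [exact: CK_moll|exact: moll_convex|lra|].
  move=> x xd; have [c' hc'] := moll_affine (f1 0 + e / 4) p h0.
  rewrite -(hessian_affine c' p x); apply: (hessian_local (r := d / 2)) xd => y yd.
  apply: (etrans _ (congr1 (fun F : V -> R => F y) hc')).
  apply: (@moll_local _ _ h h0 g l y) => // z zh; apply: gl.
  by have := zl y z _ _ yd zh; lra.
- move=> x xN; have h3 := gf x ltac:(lra).
  have : `|moll h g x - g x| <= e / 2.
    apply: moll_close => // z zh; rewrite distrC; apply/ltW/hd2 => //.
    by rewrite opprD addrCA subrr addr0 normrN; lra.
  by have := ler_normD (moll h g x - g x) (g x - f x); rewrite addrA subrK; lra.
- split; [exact: CK_moll|exact: moll_convex| |].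
    have := @moll_diff _ _ h h0 G0 (fun=> 0) 0 0 (M + 1) cG0 (@rV_cont_cst _ _ _).
    rewrite [moll h (fun=> 0) 0]mollE //; last exact: rV_cont_cst.
    under eq_fun do rewrite mulr0.
    rewrite II0 subr0; apply => z zh; rewrite addr0 subr0 G0g ?gM; lra.
  move=> x y; apply: moll_diff => // z _.
  have -> : x - y = z + x - (z + y) by rewrite opprD addrACA subrr add0r.
  have -> : 4 * (M + 1) / r = 2 * (M + 1) / (r / 2) by field; lra.
  exact: G0L.
- move=> x xr; apply: (hessian_local (r := r / 4)) xr => y yr.
  apply: moll_local => // z zh; apply: G0g.
  by have := zl y z _ _ yr zh; lra.
Qed.

End Convex.

(** * Radon measures with a continuous density *)

Section Radon.
Variables (R : realType) (n : nat).
Local Notation V := 'rV[R]_n.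
Variable mu : {measure set (Rn R n) -> \bar R}.
Hypothesis mu_fin : forall K : set V, compact K -> (mu K < +oo)%E.

Lemma open_measurable_Rn (U : set V) : open U -> measurable (U : set (Rn R n)).
Proof. by move=> oU; exact: sub_sigma_algebra. Qed.

Lemma closed_measurable_Rn (U : set V) : closed U -> measurable (U : set (Rn R n)).
Proof.
move=> cU; rewrite -[U]setCK; apply: measurableC.
by apply: open_measurable_Rn; exact: closed_openC.
Qed.

Lemma closed_rV_ball (r : R) : closed [set x : V | `|x| <= r].
Proof.
apply: (@closed_comp _ _ (fun x : V => `|x|) [set t | t <= r]).
  by move=> x _; exact: norm_continuous.
exact: closed_le.
Qed.

Lemma open_preimage (f : V -> R) (A : set R) : continuous f -> open A -> open (f @^-1` A).
Proof. by move=> /continuousP cf; exact: cf. Qed.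

Lemma continuous_measurable_Rn (f : V -> R) D : continuous f -> measurable D ->
  measurable_fun D (f : Rn R n -> R).
Proof.
move=> cf mD; apply: (measurability _ (measurable_realfun.RGenOpens.measurableE R)).
move=> _ [_ [a [b ->] <-]]; apply: measurableI => //.
apply: open_measurable_Rn; apply: open_preimage => //; exact: interval_open.
Qed.

Lemma Cc_integrable (f : V -> R) : Cc f -> mu.-integrable setT (EFin \o (f : Rn R n -> R)).
Proof.
move=> cF; have [r r0 hr] := Cc_supp cF; case: cF => cf _.
pose K : set (Rn R n) := [set x : V | `|x| <= r].
have cK : compact (K : set V) := @compact_rV_ball R n r.
have mK : measurable K by apply: closed_measurable_Rn; exact: closed_rV_ball.
have iK : mu.-integrable K (EFin \o (f : Rn R n -> R)).
  apply: measurable_bounded_integrable => //; first exact: mu_fin.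
    exact: continuous_measurable_Rn.
  have [M M0 hM] := bounded_on_ball cf r.
  exists M; split; first exact: num_real.
  by move=> y My x Kx; apply: le_trans (hM x Kx) (ltW My).
move/integrable_mkcond : iK => /(_ mK); rewrite restrict_EFin.
congr (mu.-integrable _ (EFin \o _)); apply/funext => x; rewrite patchE; case: ifPn => // xK.
apply/esym/hr; rewrite ltNge; apply/negP => xr; move/negP: xK; apply.
by rewrite inE.
Qed.

Definition mint (f : V -> R) : R := Rintegral mu setT (f : Rn R n -> R).

Lemma mintE f : Cc f -> (\int[mu]_x (f x)%:E = (mint f)%:E)%E.
Proof.
move=> cf; rewrite /mint /Rintegral fineK //.
by apply: integrable_fin_num => //; exact: Cc_integrable.
Qed.

Lemma mintD f g : Cc f -> Cc g -> mint (fun x => f x + g x) = mint f + mint g.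
Proof. by move=> cf cg; rewrite /mint RintegralD //; exact: Cc_integrable. Qed.

Lemma mintZ f a : Cc f -> mint (fun x => a * f x) = a * mint f.
Proof. by move=> cf; rewrite /mint RintegralZl //; exact: Cc_integrable. Qed.

Lemma mint0 : mint (fun=> 0) = 0.
Proof.
by have := mintZ 0 (Cc0 R n); rewrite !mul0r.
Qed.

Lemma mint_sum (I : Type) (s : seq I) (F : I -> V -> R) : (forall i, Cc (F i)) ->
  mint (fun x => \sum_(i <- s) F i x) = \sum_(i <- s) mint (F i).
Proof.
move=> cF; elim: s => [|i s IH].
  by rewrite big_nil -[RHS]mint0; congr mint; apply/funext => x; rewrite big_nil.
rewrite big_cons -IH -mintD //; last exact: Cc_sum.
by congr mint; apply/funext => x; rewrite big_cons.
Qed.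

Lemma mint_le_meas f (U : set V) : Cc f -> open U -> (mu U < +oo)%E ->
  (forall x, 0 <= f x) -> (forall x, f x <= \1_U x) -> mint f <= fine (mu U).
Proof.
move=> cf oU Ufin f0 fU; have mU := open_measurable_Rn oU.
have Uf : mu U \is a fin_num by rewrite ge0_fin_numE.
rewrite -lee_fin -(mintE cf) (fineK Uf) -{1}(setIT U) -integral_indic //.
apply: ge0_le_integral => //.
- by move=> x _; rewrite lee_fin.
- apply/measurable_realfun.measurable_EFinP; apply: continuous_measurable_Rn => //; exact: (proj1 cf).
- by apply/measurable_realfun.measurable_EFinP.
- by move=> x _; rewrite lee_fin.
Qed.

Lemma meas_le_mint f (U : set V) : Cc f -> open U -> (mu U < +oo)%E ->
  (forall x, \1_U x <= f x) -> fine (mu U) <= mint f.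
Proof.
move=> cf oU Ufin fU; have mU := open_measurable_Rn oU.
have Uf : mu U \is a fin_num by rewrite ge0_fin_numE.
rewrite -lee_fin -(mintE cf) (fineK Uf) -{1}(setIT U) -integral_indic //.
apply: ge0_le_integral => //.
- by apply/measurable_realfun.measurable_EFinP.
- apply/measurable_realfun.measurable_EFinP; apply: continuous_measurable_Rn => //; exact: (proj1 cf).
- by move=> x _; rewrite lee_fin.
Qed.

Lemma clamp_add (a y : R) : 0 <= a ->
  Num.min a (Num.max 0 y) + Num.min 1 (Num.max 0 (y - a)) = Num.min (a + 1) (Num.max 0 y).
Proof.
move=> a0; have [y0|y0] := leP y 0.
  have ya : y - a <= 0 by lra.
  by rewrite (max_l ya) !min_r ?addr0 //; lra.
have [ya|ya] := leP y a.
  have ya' : y - a <= 0 by lra.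
  by rewrite (max_l ya') !min_r ?addr0 //; lra.
have ya' : 0 <= y - a by lra.
rewrite (max_r ya'); have [y1|y1] := leP y (a + 1).
  by rewrite min_r //; lra.
by rewrite min_l //; lra.
Qed.

(** Unit layers of y; for y = f / e they cut f into finitely many continuous layers of height e. *)
Lemma clamp_sum N (y : R) :
  \sum_(k < N) Num.min 1 (Num.max 0 (y - k%:R)) = Num.min N%:R (Num.max 0 y).
Proof.
elim: N => [|N IH].
  by rewrite big_ord0 min_l // le_max lexx.
by rewrite big_ord_recr /= IH -natr1 clamp_add.
Qed.

Variable w : V -> R.
Hypothesis cw : continuous w.
Hypothesis w0 : forall x, 0 <= w x.
Hypothesis mu_w : forall A : set (Rn R n), measurable A ->
  mu A = leb_int (fun x => ((\1_A x : R) * w x)%:E).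

(* The layers psi_k of phi satisfy 1_{phi > (k+1)e} <= psi_k <= 1_{phi > ke}, so
   on both sides their integrals are squeezed between consecutive mu {phi > ke}. *)
Lemma mint_density_ge0 f : Cc f -> (forall x, 0 <= f x) ->
  mint f = II (fun x => f x * w x).
Proof.
move=> cF f0; have [r r0 hr] := Cc_supp cF; have cf := proj1 cF.
have [M M0 hM] := bounded_on_ball cf r.
have hM' x : f x <= M.
  have [xr|xr] := leP `|x| r; first by have := hM x xr; rewrite ger0_norm.
  by rewrite hr // ltW.
pose U a := [set x : V | a < f x].
have oU a : open (U a).
  by apply: (open_preimage (A := [set t | a < t])) => //; exact: open_gt.
have Ufin a : 0 <= a -> (mu (U a) < +oo)%E.
  move=> a0; apply: le_lt_trans (mu_fin (@compact_rV_ball R n r)).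
  apply: le_measure; rewrite ?inE; [exact: open_measurable_Rn|..].
    by apply: closed_measurable_Rn; exact: closed_rV_ball.
  by move=> x /= ax; rewrite leNgt; apply/negP => /hr fx; move: ax; rewrite /U /= fx ltNge a0.
pose m a := fine (mu (U a)).
have m_ge0 a : 0 <= m a by exact: fine_ge0.
suff main N : (0 < N)%N -> `|mint f - II (fun x => f x * w x)| <= M / N%:R * m 0.
  apply/eqP; rewrite -subr_eq0 -normr_le0; apply/ler_addgt0Pr => e e0; rewrite add0r.
  pose N := (Num.truncn (M * m 0 / e)).+1.
  have NP : M * m 0 / e < N%:R by apply: truncnS_gt.
  apply: le_trans (main N isT) _; rewrite mulrAC ler_pdivrMr ?ltr0n //.
  by rewrite ltr_pdivrMr // [_ * e]mulrC in NP; exact: ltW.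
move=> N0; set e := M / N%:R.
have e0 : 0 < e by rewrite divr_gt0 // ltr0n.
pose psi k x := Num.min 1 (Num.max 0 (f x / e - k%:R)).
have cpsi k : Cc (psi k).
  split.
    have -> : psi k = (fun x => - Num.max (-1) (- Num.max 0 (f x / e - k%:R))).
      by apply/funext => x; rewrite /psi oppr_max !opprK.
    apply: rV_contN; apply: rV_cont_max; first exact: rV_cont_cst.
    apply: rV_contN; apply: rV_cont_max; first exact: rV_cont_cst.
    apply: rV_contB; last exact: rV_cont_cst.
    by apply: rV_contM => //; exact: rV_cont_cst.
  exists r => x /hr xr; rewrite /psi xr mul0r sub0r.
  have h : - k%:R <= 0 :> R by rewrite oppr_le0 ler0n.
  by rewrite (max_l h) min_r.
have psi0 k x : 0 <= psi k x by rewrite /psi le_min ler01 le_max lexx.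
have psiU k x : psi k x <= \1_(U (k%:R * e)) x.
  rewrite indicE; case: (boolP (x \in _)) => [_|xU]; first by rewrite /psi ge_min lexx.
  rewrite /psi max_l ?min_r // subr_le0 ler_pdivrMr // leNgt.
  by apply/negP => xU'; move/negP: xU; apply; rewrite inE.
have Upsi k x : \1_(U (k.+1%:R * e)) x <= psi k x.
  rewrite indicE; case: (boolP (x \in _)) => [|_]; last exact: psi0.
  rewrite inE /U /= -ltr_pdivlMr // -natr1 => h.
  by rewrite /psi le_min lexx le_max; apply/orP; right; lra.
have fpsi x : f x = \sum_(k <- enum 'I_N) e * psi k x.
  have N0' : N%:R != 0 :> R by rewrite pnatr_eq0 -lt0n.
  have eN : e * N%:R = M by rewrite /e divfK.
  rewrite -mulr_sumr big_enum /= clamp_sum max_r; last exact: divr_ge0 (f0 x) (ltW e0).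
  rewrite min_r; first by rewrite mulrC divfK // gt_eqF.
  by rewrite ler_pdivrMr // mulrC eN.
have cpw k : Cc (fun x => psi k x * w x) by exact: Cc_mul.
have Ue k : 0 <= k%:R * e by rewrite mulr_ge0 // ltW.
have a_le k : mint (psi k) <= m (k%:R * e) by apply: mint_le_meas => //; exact: Ufin.
have a_ge k : m (k.+1%:R * e) <= mint (psi k) by apply: meas_le_mint => //; exact: Ufin.
have mE a : 0 <= a -> (m a)%:E = leb_int (fun x => ((\1_(U a) x : R) * w x)%:E).
  move=> a0; rewrite /m fineK ?ge0_fin_numE //; last exact: Ufin.
  by rewrite mu_w //; exact: open_measurable_Rn.
have b_le k : II (fun x => psi k x * w x) <= m (k%:R * e).
  rewrite -lee_fin (mE _ (Ue _)) -(leb_intE (cpw k)); apply: le_leb_int.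
    by move=> z; rewrite lee_fin mulr_ge0.
  by move=> z; rewrite lee_fin ler_wpM2r.
have b_ge k : m (k.+1%:R * e) <= II (fun x => psi k x * w x).
  rewrite -lee_fin (mE _ (Ue _)) -(leb_intE (cpw k)); apply: le_leb_int.
    by move=> z; rewrite lee_fin mulr_ge0 // indicE.
  by move=> z; rewrite lee_fin ler_wpM2r.
have -> : mint f = \sum_(k < N) e * mint (psi k).
  transitivity (mint (fun x => \sum_(k <- enum 'I_N) e * psi k x)).
    by congr mint; apply/funext.
  rewrite mint_sum; last by move=> k; exact: CcZ.
  by rewrite big_enum; apply: eq_bigr => k _; rewrite mintZ.
have -> : II (fun x => f x * w x) = \sum_(k < N) e * II (fun x => psi k x * w x).
  transitivity (II (fun x => \sum_(k <- enum 'I_N) e * (psi k x * w x))).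
    by congr II; apply/funext => x; rewrite fpsi mulr_suml; apply: eq_bigr => k _; rewrite mulrA.
  rewrite II_sum; last by move=> k; exact: CcZ.
  by rewrite big_enum; apply: eq_bigr => k _; rewrite IIZ.
rewrite -sumrB; apply: le_trans (ler_norm_sum _ _ _) _.
(* The gaps between consecutive superlevel masses telescope, so the total error is at most e times
   the mass of {f > 0}, which is finite because f has compact support. *)
apply: le_trans (_ : \sum_(k < N) e * (m (k%:R * e) - m (k.+1%:R * e)) <= _).
  apply: ler_sum => k _; rewrite -mulrBr normrM gtr0_norm // ler_pM2l //.
  have := a_le k; have := a_ge k; have := b_le k; have := b_ge k.
  by move=> *; rewrite ler_norml; apply/andP; split; lra.
rewrite -mulr_sumr ler_pM2l //.
rewrite -(big_mkord xpredT (fun k => m (k%:R * e) - m (k.+1%:R * e))) /=.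
under eq_bigr do rewrite -opprB.
rewrite sumrN telescope_sumr // opprB mul0r.
by have := m_ge0 (N%:R * e); lra.
Qed.

Lemma mint_density f : Cc f -> mint f = II (fun x => f x * w x).
Proof.
move=> cf.
have cp : Cc (fun x => Num.max (f x) 0).
  split; first by apply: rV_cont_max; [exact: (proj1 cf)|exact: rV_cont_cst].
  by have [_ [r hr]] := cf; exists r => x /hr ->; rewrite maxxx.
have cm : Cc (fun x => Num.max (f x) 0 + -1 * f x) by apply: CcA => //; exact: CcZ.
have p0 x : 0 <= Num.max (f x) 0 by rewrite le_max lexx orbT.
have m0 x : 0 <= Num.max (f x) 0 + -1 * f x by rewrite mulN1r subr_ge0 le_max lexx.
have h1 := mint_density_ge0 cp p0; have h2 := mint_density_ge0 cm m0.
have := mintD cp (CcZ (-1) cf); rewrite h2 mintZ // h1.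
have -> : II (fun x => (Num.max (f x) 0 + -1 * f x) * w x) =
   II (fun x => Num.max (f x) 0 * w x) + -1 * II (fun x => f x * w x).
  rewrite -IIZ -?IID; [|exact: Cc_mul|apply: CcZ; exact: Cc_mul|exact: Cc_mul].
  by congr II; apply/funext => x; ring.
by move=> h; lra.
Qed.

End Radon.

(** * Hessian measures *)

Lemma horner_char_poly (R : comNzRingType) n (A : 'M[R]_n) (l : R) :
  (char_poly A).[l] = \det (l%:M - A).
Proof.
rewrite -[LHS]/(horner_eval l _) -det_map_mx; congr (\det _).
apply/matrixP => a b; rewrite !mxE /=.
by rewrite rmorphB rmorphMn /= !horner_evalE hornerC hornerX.
Qed.

(** The characteristic polynomial of c A at c l is c^n times that of A at l; comparing coefficients
    in l leaves the power c^i. *)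
Lemma elsymZ (R : realFieldType) n i (A : 'M[R]_n) c : (i <= n)%N -> c != 0 ->
  elsym i (c *: A) = c ^+ i * elsym i A.
Proof.
move=> ilen c0; set P := char_poly (c *: A); set Q := char_poly A.
have : \poly_(k < n.+1) (c ^+ k * P`_k) - c ^+ n *: Q = 0.
  apply: poly_eq0_of_horner => l; rewrite hornerD hornerN hornerZ horner_poly.
  apply/eqP; rewrite subr_eq0; apply/eqP; transitivity P.[c * l].
    have sP : (size P <= n.+1)%N by rewrite size_char_poly.
    rewrite (horner_coef_wide _ sP); apply: eq_bigr => k _.
    by rewrite exprMn mulrA [P`_k * _]mulrC.
  rewrite !horner_char_poly -detZ; congr (\det _).
  by rewrite scalerBr scale_scalar_mx.
move=> /(congr1 (fun p : {poly R} => p`_(n - i))); rewrite coef0 coefB coefZ coef_poly.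
have cn : c ^+ n = c ^+ (n - i) * c ^+ i by rewrite -exprD subnK.
rewrite ltnS leq_subr => /eqP; rewrite subr_eq0 cn -mulrA.
by move/eqP/(mulfI (expf_neq0 _ c0)) => E; rewrite /elsym E mulrCA.
Qed.

Section HessianMeasure.
Variables (R : realType) (n i : nat).
Local Notation V := 'rV[R]_n.
Local Notation e_ j := (@evec R n j).
Variable Phi : (V -> R) -> {measure set (Rn R n) -> \bar R}.
Hypothesis ilt : (i < n)%N.
Hypothesis hm : hessian_measure i Phi.

Lemma qform_convex (B : 'M[R]_n) : (forall u, 0 <= qform u B) ->
  convex_fun (fun x => qform x B).
Proof.
move=> pB x y t /andP[t0 t1].
have E : (1 - t) * qform x B + t * qform y B - qform ((1 - t) *: x + t *: y) B =
    (1 - t) * t * qform (x - y) B.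
  rewrite !qformE !mulr_sumr -sumrN -!big_split; apply: eq_bigr => j _ /=.
  rewrite !mulr_sumr -sumrN -!big_split; apply: eq_bigr => k _ /=.
  by rewrite !mxE; ring.
have : 0 <= (1 - t) * t * qform (x - y) B by rewrite !mulr_ge0 // subr_ge0.
rewrite -E; lra.
Qed.

Lemma CK_qform k (B : 'M[R]_n) : CK k (fun x => qform x B).
Proof.
under eq_fun do rewrite qformE.
apply: CK_sum => a; apply: CK_sum => b; apply: CKM; last exact: CK_cst.
by apply: CKM; exact: CK_coord.
Qed.

Lemma hessian_qform (B : 'M[R]_n) x : B^T = B -> hessian (fun x => qform x B) x = 2 *: B.
Proof.
move=> sB; have D1 k : 'D_(e_ k) (fun x => qform x B) =
    (fun x => 0 + \sum_j (2 *: row k B) 0 j * x 0 j).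
  apply/funext => y; under eq_fun do rewrite qformE.
  have h a b : is_derive y (e_ k) (fun x : V => x 0 a * x 0 b * B a b)
      ((y 0 a * e_ k 0 b + y 0 b * e_ k 0 a) * B a b).
    have h1 := is_deriveM (is_derive_coord y (e_ k) a) (is_derive_coord y (e_ k) b).
    apply: (is_derive_eq (is_deriveM h1 (is_derive_cst (B a b) y (e_ k)))).
    by rewrite /GRing.scale /= mulr0 add0r mulrC.
  have [_ ->] := is_derive_bigsum (index_enum _) xpredT
     (fun a => is_derive_bigsum (index_enum _) xpredT (h a)).
  have ek a : e_ k 0 a = (a == k)%:R by rewrite mxE eqxx.
  under eq_bigr => a _ do under eq_bigr => b _ do rewrite !ek mulrDl.
  under eq_bigr do rewrite big_split /=.
  rewrite big_split /= add0r.
  have -> : \sum_a \sum_b y 0 a * (b == k)%:R * B a b = \sum_a B k a * y 0 a.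
    apply: eq_bigr => a _; rewrite (bigD1 k) //= big1 ?addr0.
      by rewrite eqxx mulr1 -{1}sB mxE mulrC.
    by move=> b bk; rewrite (negbTE bk) mulr0 mul0r.
  have -> : \sum_a \sum_b y 0 b * (a == k)%:R * B a b = \sum_a B k a * y 0 a.
    rewrite (bigD1 k) //= [X in _ + X]big1 ?addr0.
      by apply: eq_bigr => b _; rewrite eqxx mulr1 mulrC.
    by move=> a ak; rewrite big1 // => b _; rewrite (negbTE ak) mulr0 mul0r.
  rewrite -big_split; apply: eq_bigr => a _ /=; rewrite !mxE; ring.
apply/matrixP => j k; rewrite mxE D1.
apply: (etrans (congr1 (fun F : V -> R => F x) (derive_affine 0 (2 *: row k B) j))).
by rewrite !mxE -{1}sB mxE.
Qed.

Definition ubox : set V := [set x | forall j, x 0 j \in `[0, 1]].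

Lemma ubox_measurable : measurable (ubox : set (Rn R n)).
Proof.
apply: closed_measurable_Rn.
have -> : ubox = \bigcap_(j in [set: 'I_n]) [set x : V | x 0 j \in `[0, 1]].
  by apply/seteqP; split => x h; [move=> j _; exact: h|move=> j; exact: (h j)].
apply: closed_bigI => j _.
apply: (@closed_comp _ _ (fun x : V => x 0 j) [set t | t \in `[0, 1]]).
  by move=> x _; exact: rV_cont_coord.
exact: interval_closed.
Qed.

(** The quadratic form of B is convex with constant Hessian 2 B, so the Hessian measure of the unit
    box is [2 B]_i = 2^i [B]_i, and measures are nonnegative. No diagonalisation is involved. *)
Lemma elsym_ge0 (B : 'M[R]_n) : B^T = B -> (forall u, 0 <= qform u B) -> 0 <= elsym i B.
Proof.
move=> sB pB.
have h2 : (2 : R) != 0 by [].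
suff : 0 <= elsym i (2 *: B) by rewrite elsymZ ?(ltnW ilt) // pmulr_rge0 // exprn_gt0.
have [_ [_ hC2]] := hm.
have := hC2 _ (qform_convex pB) (CK_C2 (CK_qform 2 B)) _ ubox_measurable.
have -> : (fun x => ((\1_ubox x : R) * esym_eig i (hessian (fun x => qform x B) x))%:E) =
   (fun x => (elsym i (2 *: B) * boxind 1 x)%:E).
  apply/funext => x; rewrite hessian_qform // mulrC; congr (_ * _)%:E.
  rewrite /boxind; case: (pselect (ubox x)) => h.
    rewrite indicE mem_set // big1 // => j _; rewrite indicE mem_set //=; exact: h.
  rewrite indicE memNset //; move/existsNP: h => [j bj].
  by rewrite (bigD1 j) //= indicE memNset ?mul0r.
rewrite leb_int_box // expr1n mulr1 => E.
by rewrite -lee_fin -E; exact: measure_ge0.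
Qed.

Lemma hessian_sym (F : V -> R) x : CK 2 F -> (hessian F x)^T = hessian F x.
Proof.
move=> cF; apply/matrixP => a b; rewrite mxE [LHS]mxE [RHS]mxE.
exact: (congr1 (fun f : V -> R => f x) (CK_sym b a cF)).
Qed.

Lemma elsym_hessian_ge0 (F : V -> R) x : convex_fun F -> CK 3 F -> 0 <= elsym i (hessian F x).
Proof.
move=> cvF cF; apply: elsym_ge0; first by apply: hessian_sym; exact: CK_S.
by move=> u; apply: hessian_psd => //; exact: CK_S.
Qed.

Lemma continuous_elsym_hessian (F : V -> R) : CK 3 F -> continuous (fun x => elsym i (hessian F x)).
Proof.
by move=> cF; apply: continuous_elsym => j k; exact: CK_cont (CK_hessian cF j k).
Qed.

(** The bridge between the measure side, where weak limits are taken, and the iterated integral,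
    where integration by parts is carried out. *)
Lemma hm_density (F f : V -> R) : convex_fun F -> CK 3 F -> Cc f ->
  mint (Phi F) f = II (fun x => f x * elsym i (hessian F x)).
Proof.
move=> cvF cF cf; have [hfin [_ hC2]] := hm.
apply: mint_density => //.
- by move=> K; exact: hfin.
- exact: continuous_elsym_hessian.
- by move=> x; exact: elsym_hessian_ge0.
- by move=> A mA; rewrite (hC2 _ cvF _ _ mA) //; apply: CK_C2; exact: CK_S.
Qed.

Lemma norm_le_enorm (x : V) : `|x| <= enorm x.
Proof.
rewrite -[`|x|]ger0_norm // -sqrtr_sqr; apply: ler_wsqrtr; exact: norm_sqnorm.
Qed.

Lemma enorm_le_norm (x : V) : enorm x <= n%:R * `|x|.
Proof.
have h0 : 0 <= n%:R * `|x| by apply: mulr_ge0.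
rewrite -[leRHS]ger0_norm // -sqrtr_sqr; apply: ler_wsqrtr.
apply: le_trans (_ : \sum_(j < n) `|x| ^+ 2 <= _).
  apply: ler_sum => j _; rewrite -real_normK ?num_real // lerXn2r ?nnegrE //.
  exact: rV_coord_le.
rewrite sumr_const card_ord -[_ *+ n]mulr_natl exprMn; apply: ler_wpM2r; first exact: sqr_ge0.
have nn k : (k <= k ^ 2)%N by case: k => // k; rewrite -mulnn leq_pmull.
by rewrite -natrX ler_nat.
Qed.

Lemma hm_weak (fk : nat -> V -> R) (f g : V -> R) : (forall k, convex_fun (fk k)) ->
  convex_fun f -> lu_cvg fk f -> Cc g ->
  (fun k => mint (Phi (fk k)) g) @ \oo --> mint (Phi f) g.
Proof.
move=> cfk cf lu cg; have [hfin [hw _]] := hm.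
have supp : exists r : R, forall x, r < enorm x -> g x = 0.
  have [r r0 hr] := Cc_supp cg; exists (n%:R * r) => x rx; apply: hr.
  rewrite ltNge; apply/negP => xr; move: rx; rewrite ltNge => /negP; apply.
  by apply: le_trans (enorm_le_norm x) _; rewrite ler_wpM2l.
have := hw fk f cfk cf lu g (proj1 cg) supp.
by rewrite (mintE (fun K => hfin f cf K) cg) => /fine_cvg.
Qed.

Lemma CK_scale k (F : V -> R) c : CK k F -> CK k (fun x : V => c * F x).
Proof. by move=> cF; apply: CKM => //; exact: CK_cst. Qed.

Lemma hessian_scale (F : V -> R) c x : CK 2 F -> hessian (fun x : V => c * F x) x = c *: hessian F x.
Proof.
move=> cF; have D1 k : 'D_(e_ k) (fun x : V => c * F x) = (fun x => c * 'D_(e_ k) F x).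
  apply/funext => y; apply: (@deriveZ _ _ _ F c y (e_ k)).
  by have [] := CK_der1 k cF.
apply/matrixP => j k; rewrite [LHS]mxE D1 [RHS]mxE [X in _ = _ * X]mxE.
apply: (@deriveZ _ _ _ ('D_(e_ k) F) c x (e_ j)).
by have [] := CK_der1 j (CK_derive k cF).
Qed.

Lemma convex_scale (F : V -> R) c : 0 <= c -> convex_fun F -> convex_fun (fun x : V => c * F x).
Proof.
move=> c0 cF x y t t01; have := ler_wpM2l c0 (cF x y t t01).
by have -> : c * ((1 - t) * F x + t * F y) = (1 - t) * (c * F x) + t * (c * F y) by ring.
Qed.

(* Otherwise suitable rescalings H_k = G_k / (k + 1) converge to 0 while their
   Hessian measures blow up, by homogeneity of degree i. *)
Lemma mass_bound (f : V -> R) L : Cc f -> (forall x, 0 <= f x) -> 0 <= L ->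
  exists C, forall G, CK 3 G -> convex_fun G -> `|G 0| <= L ->
    (forall x y, `|G x - G y| <= L * `|x - y|) ->
    II (fun x => f x * elsym i (hessian G x)) <= C.
Proof.
move=> cf f0 L0; apply: contrapT => neg.
(* Dividing G by k + 1 costs a factor (k + 1)^i, so the exponent i + 1 leaves a mass above k + 1. *)
have ex (k : nat) : exists G, [/\ CK 3 G, convex_fun G, `|G 0| <= L,
    (forall x y, `|G x - G y| <= L * `|x - y|) &
    k.+1%:R ^+ i.+1 < II (fun x => f x * elsym i (hessian G x))].
  apply: contrapT => negG; apply: neg; exists (k.+1%:R ^+ i.+1) => G G3 cG GL Glip.
  by rewrite leNgt; apply/negP => h; apply: negG; exists G.
have [G hG] := choice ex.
pose c k : R := (k.+1%:R)^-1.
have c0 k : 0 < c k by rewrite invr_gt0.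
pose H k x := c k * G k x.
have cvH k : convex_fun (H k).
  by apply: convex_scale; [exact: ltW|case: (hG k)].
have H3 k : CK 3 (H k) by apply: CK_scale; case: (hG k).
have cv0 : convex_fun (fun _ : V => 0 : R) by move=> x y t _; rewrite !mulr0 addr0.
have Gbd k x : `|G k x| <= L + L * `|x|.
  have [_ _ h1 h2 _] := hG k.
  have := h2 x 0; rewrite subr0 => h3.
  by have := ler_normD (G k x - G k 0) (G k 0); rewrite subrK; lra.
have lu : lu_cvg H (fun=> 0).
  move=> r e r0 e0; pose N := Num.truncn ((L + L * r) / e).
  exists N => // k /= Nk x xr; rewrite subr0 /H normrM gtr0_norm // /c.
  have xr' : `|x| <= r by apply: le_trans (norm_le_enorm x) xr.
  rewrite mulrC ltr_pdivrMr //; apply: le_lt_trans (Gbd k x) _.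
  apply: le_lt_trans (_ : L + L * r < _); first by rewrite lerD2l ler_wpM2l.
  rewrite [e * _]mulrC -ltr_pdivrMr //; apply: lt_le_trans (truncnS_gt _) _.
  by rewrite ler_nat ltnS.
have := hm_weak cvH cv0 lu cf.
move/cvgrPdist_lt => /(_ 1 ltr01) [N _ hN].
set a := mint (Phi (fun=> 0)) f in hN.
pose k := maxn N (Num.truncn (a + 1)).
have := hN k (leq_maxl _ _); rewrite hm_density //.
have -> : II (fun x => f x * elsym i (hessian (H k) x)) =
    c k ^+ i * II (fun x => f x * elsym i (hessian (G k) x)).
  have [G3 _ _ _ _] := hG k.
  rewrite -IIZ; last by apply: Cc_mul => //; exact: continuous_elsym_hessian.
  congr II; apply/funext => x.
  rewrite hessian_scale ?elsymZ ?gt_eqF ?(ltnW ilt) //; last exact: CK_S.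
  by rewrite mulrCA.
have [_ _ _ _ big] := hG k.
have k0 : 0 < k.+1%:R :> R by [].
have : k.+1%:R < c k ^+ i * II (fun x => f x * elsym i (hessian (G k) x)).
  rewrite /c exprVn mulrC ltr_pdivlMr ?exprn_gt0 //.
  by rewrite -exprS.
have : a + 1 < k.+1%:R.
  apply: lt_le_trans (truncnS_gt _) _; rewrite ler_nat ltnS leq_maxr //.
move=> h1 h2; rewrite ltr_norml => /andP[h3 _]; lra.
Qed.

End HessianMeasure.

(** * Radial test functions and the key estimate *)

Section Cutoff.
Variable R : realType.

Definition posq (s : R) : R := Num.max 0 s ^+ 2.

Lemma posq_ge0 s : 0 <= posq s. Proof. exact: sqr_ge0. Qed.

Lemma posq0 s : s <= 0 -> posq s = 0.
Proof. by move=> h; rewrite /posq (max_l h) expr0n. Qed.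

Lemma posq_gt0 s : 0 < s -> 0 < posq s.
Proof. by move=> h; rewrite /posq (max_r (ltW h)) exprn_gt0. Qed.

Lemma is_derive_posq (s : R) : is_derive s 1 posq (2 * Num.max 0 s).
Proof. exact: (is_derive_posX 0 s). Qed.

Lemma is_derive_posqB (a t : R) : is_derive t 1 (fun t => posq (a - t)) (- 2 * Num.max 0 (a - t)).
Proof.
have h : is_derive t (1 : R) (fun t : R => a - t) (- 1).
  by have := is_deriveB (is_derive_cst a t (1 : R)) (is_derive_id t (1 : R)); rewrite sub0r.
have [h1 h2] := @is_derive1_comp R posq (fun t => a - t) t _ _ (is_derive_posq (a - t)) h.
by split; [exact: h1|apply: (etrans h2); ring].
Qed.

Lemma is_derive_posqD (b t : R) : is_derive t 1 (fun t => posq (t - b)) (2 * Num.max 0 (t - b)).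
Proof.
have h : is_derive t (1 : R) (fun t : R => t - b) 1.
  by have := is_deriveB (is_derive_id t (1 : R)) (is_derive_cst b t (1 : R)); rewrite subr0.
have [h1 h2] := @is_derive1_comp R posq (fun t => t - b) t _ _ (is_derive_posq (t - b)) h.
by split; [exact: h1|apply: (etrans h2); ring].
Qed.

Definition cutoff_on (b a : R) (P P' : R -> R) :=
  [/\ forall t : R, is_derive t 1 P (P' t), continuous P', forall t, 0 <= P t <= 1 &
    forall t, P' t <= 0] /\
  [/\ forall t, t <= b -> P t = 1, forall t, a <= t -> P t = 0,
    forall t, t <= b -> P' t = 0 & forall t, a <= t -> P' t = 0].

(** The quotient p / (p + q) of squared positive parts p of a - t and q of t - b: squaring makes it
    C^1, and b < a keeps the denominator positive. *)
Lemma cutoff (b a : R) : b < a -> exists P P' : R -> R, cutoff_on b a P P'.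
Proof.
move=> ba; pose p t := posq (a - t); pose q t := posq (t - b).
pose p' t := - 2 * Num.max 0 (a - t); pose q' t := 2 * Num.max 0 (t - b).
have dp (t : R) : is_derive t 1 p (p' t) by exact: is_derive_posqB.
have dq (t : R) : is_derive t 1 q (q' t) by exact: is_derive_posqD.
have p0 t : 0 <= p t by exact: posq_ge0.
have q0 t : 0 <= q t by exact: posq_ge0.
have pq t : 0 < p t + q t.
  have [ta|ta] := ltP t a.
    by apply: ltr_pwDl => //; apply: posq_gt0; lra.
  by apply: ltr_wpDl => //; apply: posq_gt0; lra.
have p'0 t : p' t <= 0.
  by rewrite /p' mulNr oppr_le0 mulr_ge0 // le_max lexx.
have q'0 t : 0 <= q' t by rewrite /q' mulr_ge0 // le_max lexx.
pose P t := p t * (p t + q t)^-1.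
pose P' t := (p' t * q t - p t * q' t) * ((p t + q t)^-1) ^+ 2.
have cp : continuous p.
  by move=> t; have [d _] := dp t; apply: differentiable_continuous; apply/derivable1_diffP.
have cq : continuous q.
  by move=> t; have [d _] := dq t; apply: differentiable_continuous; apply/derivable1_diffP.
have cid : continuous (fun t : R => t) by move=> t A.
have cp' : continuous p'.
  apply: rV_contM; first exact: rV_cont_cst.
  by apply: rV_cont_max; [exact: rV_cont_cst|apply: rV_contB => //; exact: rV_cont_cst].
have cq' : continuous q'.
  apply: rV_contM; first exact: rV_cont_cst.
  by apply: rV_cont_max; [exact: rV_cont_cst|apply: rV_contB => //; exact: rV_cont_cst].
exists P, P'; split; split.
- move=> t; have h := is_deriveD (dp t) (dq t).
  have pqn : (p + q) t != 0 by rewrite gt_eqF // pq.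
  have hV : is_derive t 1 (fun t => (p t + q t)^-1) (- ((p t + q t)^-1) ^+ 2 * (p' t + q' t)).
    have [h1 h2] := h; split; first exact: (derivableV pqn h1).
    by rewrite (deriveV pqn h1) h2 /GRing.scale /= exprVn.
  apply: (is_derive_eq (is_deriveM (dp t) hV)); rewrite /GRing.scale /= /P'.
  by field; rewrite gt_eqF // pq.
- apply: rV_contM; first by apply: rV_contB; exact: rV_contM.
  apply: rV_contX; apply: rV_contV; first by move=> t; rewrite gt_eqF // pq.
  exact: rV_contD.
- move=> t; rewrite /P divr_ge0 ?p0 ?(ltW (pq t)) //=.
  by rewrite ler_pdivrMr ?pq // mul1r lerDl.
- move=> t; rewrite /P'; apply: mulr_le0_ge0; last exact: sqr_ge0.
  have h1 : p' t * q t <= 0 by apply: mulr_le0_ge0.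
  have h2 : 0 <= p t * q' t by apply: mulr_ge0.
  lra.
- move=> t tb; have q00 : q t = 0 by apply: posq0; lra.
  by have := pq t; rewrite /P q00 addr0 => pt; rewrite divff // gt_eqF.
- by move=> t ta; rewrite /P (_ : p t = 0) ?mul0r //; apply: posq0; lra.
- move=> t tb; rewrite /P' (_ : q t = 0); last by apply: posq0; lra.
  by rewrite /q' max_l; [rewrite !mulr0 subr0 mul0r|lra].
- move=> t ta; rewrite /P' (_ : p t = 0); last by apply: posq0; lra.
  by rewrite /p' max_l; [rewrite mulr0 !mul0r subr0 mul0r|lra].
Qed.

End Cutoff.

(** * Radial and tangential parts of the Hessian density *)

Section Radial.
Variables (R : realType) (n : nat).
Local Notation V := 'rV[R]_n.
Local Notation e_ j := (@evec R n j).

Lemma enorm_sq (x : V) : enorm x ^+ 2 = sqnorm x.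
Proof. by rewrite /enorm sqr_sqrtr // sqnorm_ge0. Qed.

Lemma enorm_ge0 (x : V) : 0 <= enorm x.
Proof. exact: sqrtr_ge0. Qed.

Lemma continuous_enorm : continuous (@enorm R n).
Proof.
by apply: (rV_cont_comp (h := Num.sqrt)); [exact: continuous_sqnorm|exact: sqrt_continuous].
Qed.

Lemma is_derive_enorm (x : V) j : 0 < enorm x -> is_derive x (e_ j) (@enorm R n) (x 0 j / enorm x).
Proof.
move=> x0; have s0 : 0 < sqnorm x by rewrite -enorm_sq exprn_gt0.
apply: (is_derive_eq (is_derive_comp (is_derive_sqnorm x j) (is_derive1_sqrt s0))).
by rewrite -/(enorm x); field; rewrite gt_eqF.
Qed.

(* Functions of the Euclidean norm need only be continuous on (0, oo) when
   multiplied by a function vanishing near 0. *)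
Definition cont_pos (G : R -> R) := forall t, 0 < t -> {for t, continuous G}.

(** Replacing |x| by max(|x|, d) keeps the argument of G away from 0 and changes nothing, because f
    vanishes where the two differ. *)
Lemma radial_continuous G (f : V -> R) d : 0 < d -> cont_pos G -> continuous f ->
  (forall x, enorm x < d -> f x = 0) -> continuous (fun x => G (enorm x) * f x).
Proof.
move=> d0 cG cf f0.
have -> : (fun x => G (enorm x) * f x) = (fun x => G (Num.max (enorm x) d) * f x).
  apply/funext => x; have [h|h] := ltP (enorm x) d; first by rewrite f0 // !mulr0.
  by [].
apply: rV_contM => //.
have cm : continuous (fun x : V => Num.max (enorm x) d).
  by apply: rV_cont_max; [exact: continuous_enorm|exact: rV_cont_cst].
move=> x; apply: (@continuous_comp _ _ _ (fun x : V => Num.max (enorm x) d) G).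
  exact: cm.
by apply: cG; rewrite lt_max d0 orbT.
Qed.

Lemma radial_Cc G (f : V -> R) d a : 0 < d -> cont_pos G -> continuous f ->
  (forall x, enorm x < d -> f x = 0) -> (forall t, a <= t -> G t = 0) ->
  Cc (fun x => G (enorm x) * f x).
Proof.
move=> d0 cG cf f0 Ga; split; first exact: (radial_continuous d0).
exists a => x ax; rewrite Ga ?mul0r //; apply: le_trans (ltW ax) _; exact: norm_le_enorm.
Qed.

Lemma cont_pos_derive G G' : (forall t : R, 0 < t -> is_derive t 1 G (G' t)) -> cont_pos G.
Proof.
move=> h t t0; have [d _] := h t t0.
by apply: differentiable_continuous; apply/derivable1_diffP.
Qed.

Variables (i : nat) (F : V -> R) (d : R).
Hypotheses (i_gt0 : (0 < i)%N) (ilt : (i < n)%N).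
Hypotheses (F3 : CK 3 F) (d0 : 0 < d).
Hypothesis esym_pos : forall B : 'M[R]_n, B^T = B -> (forall u, 0 <= qform u B) -> 0 <= elsym i B.
Hypothesis F_psd : forall x u, 0 <= qform u (hessian F x).
Hypothesis F_flat : forall x, `|x| < d -> hessian F x = 0.

Let m := (n - i)%N.
Let w x := elsym i (hessian F x).
Let q x := qform x (newton i (hessian F x)).
(** The Newton form in the unit direction x / |x|. The maximum with [d ^+ 2] makes the quotient
    continuous; it differs from [sqnorm x] only where [|x| < d], and there q vanishes. *)
Let tau x := q x / Num.max (sqnorm x) (d ^+ 2).

Lemma qformZ c (x : V) (A : 'M[R]_n) : qform (c *: x) A = c ^+ 2 * qform x A.
Proof.
rewrite !qformE mulr_sumr; apply: eq_bigr => j _; rewrite mulr_sumr; apply: eq_bigr => k _.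
by rewrite !mxE; ring.
Qed.

Lemma qform1 (x : V) : qform x 1%:M = sqnorm x.
Proof.
rewrite qformE; apply: eq_bigr => j _; rewrite (bigD1 j) //= big1 ?addr0.
  by rewrite mxE eqxx mulr1.
by move=> k kj; rewrite mxE eq_sym (negbTE kj) mulr0.
Qed.

Lemma q_bounds x : 0 <= q x <= sqnorm x * w x.
Proof.
have [x0|x0] := eqVneq (sqnorm x) 0.
  have -> : x = 0.
    apply/rowP => j; rewrite mxE; apply/eqP; rewrite -sqrf_eq0 eq_le sqr_ge0 andbT.
    by rewrite -x0; exact: coord_sq_le.
  have -> : q 0 = 0 by rewrite /q -(scale0r 0) qformZ expr0n mul0r.
  by rewrite lexx mulr_ge0 ?sqnorm_ge0 //; apply: esym_pos => //; apply: hessian_sym; exact: CK_S.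
have s0 : 0 < sqnorm x by rewrite lt_neqAle eq_sym x0 sqnorm_ge0.
have e0 : 0 < enorm x by rewrite -sqrtr0 ltr_sqrt.
have v1 : qform ((enorm x)^-1 *: x) 1%:M = 1.
  by rewrite qformZ qform1 exprVn enorm_sq mulVf.
have sH : (hessian F x)^T = hessian F x by apply: hessian_sym; exact: CK_S.
have := newton_bounds ilt esym_pos sH (F_psd x) v1.
rewrite qformZ exprVn enorm_sq -/(q x) -/(w x) => /andP[h1 h2].
rewrite mulrC pmulr_lge0 ?invr_gt0 // in h1; rewrite h1 /=.
by rewrite mulrC ler_pdivrMr // mulrC in h2.
Qed.

(** Homogeneity with factor 2 forces [0]_i = 0, since 2^i > 1 for i > 0. *)
Lemma w_flat x : `|x| < d -> w x = 0.
Proof.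
move=> xd; rewrite /w F_flat //.
have n2 : (2 : R) != 0 by [].
have := @elsymZ R n i (0 : 'M[R]_n) 2 (ltnW ilt) n2; rewrite scaler0 => E.
have : (2 ^+ i - 1) * elsym i (0 : 'M[R]_n) = 0 by rewrite mulrBl mul1r -E subrr.
move/eqP; rewrite mulf_eq0 => /orP[/eqP h|/eqP //].
have : (1 : R) < 2 ^+ i by rewrite exprn_egt1 ?ltr1n // -lt0n.
by lra.
Qed.

Lemma q_flat x : `|x| < d -> q x = 0.
Proof.
move=> xd; have := q_bounds x; rewrite w_flat // mulr0 => h.
by apply/eqP; rewrite eq_le andbC.
Qed.

Lemma sqnorm_max (x : V) : d <= `|x| -> Num.max (sqnorm x) (d ^+ 2) = sqnorm x.
Proof.
move=> dx; apply: max_l; apply: le_trans (norm_sqnorm x).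
by rewrite lerXn2r ?nnegrE // ltW.
Qed.

Lemma tau_bounds x : 0 <= tau x <= w x.
Proof.
rewrite /tau; have [xd|xd] := ltP `|x| d.
  by rewrite q_flat // w_flat // mul0r lexx.
have s0 : 0 < sqnorm x.
  by apply: lt_le_trans (norm_sqnorm x); rewrite exprn_gt0 //; exact: lt_le_trans xd.
rewrite sqnorm_max //; have /andP[h1 h2] := q_bounds x.
by rewrite divr_ge0 ?(ltW s0) //= ler_pdivrMr // mulrC.
Qed.

Lemma continuous_w : continuous w.
Proof. exact: continuous_elsym_hessian. Qed.

Lemma continuous_tau : continuous tau.
Proof.
apply: rV_contM.
  by apply: continuous_qform_newton => j k; exact: CK_cont (CK_hessian F3 j k).
have cm : continuous (fun x : V => Num.max (sqnorm x) (d ^+ 2)).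
  by apply: rV_cont_max; [exact: continuous_sqnorm|exact: rV_cont_cst].
apply: rV_contV => // x.
by rewrite gt_eqF // lt_max exprn_gt0 ?orbT.
Qed.

Lemma q_tau x : q x = sqnorm x * tau x.
Proof.
rewrite /tau; have [xd|xd] := ltP `|x| d; first by rewrite q_flat // mul0r mulr0.
have s0 : 0 < sqnorm x.
  by apply: lt_le_trans (norm_sqnorm x); rewrite exprn_gt0 //; exact: lt_le_trans xd.
by rewrite sqnorm_max // mulrC divfK // gt_eqF.
Qed.

(** The Newton identity for the radial function G(t) t^(-m). Differentiating the power gives - m G
    t^(-m-1), so that once q = |x|^2 tau is inserted the coefficient of G becomes m |x|^(-m) (w -
    tau). *)
Lemma radial_newton_aux (G G' : R -> R) (b a : R) : 0 < b ->
  (forall t : R, is_derive t 1 G (G' t)) -> continuous G' ->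
  (forall t, t <= b -> G t = 0) -> (forall t, t <= b -> G' t = 0) ->
  (forall t, a <= t -> G t = 0) -> (forall t, a <= t -> G' t = 0) ->
  II (fun x => m%:R * (G (enorm x) * (enorm x)^-1 ^+ m * w x) +
     (G' (enorm x) * (enorm x)^-1 ^+ m.+1 - m%:R * (G (enorm x) * (enorm x)^-1 ^+ m.+2)) * q x) = 0.
Proof.
move=> b0 dG cG' Gb Gb' Ga Ga'.
pose k t := G t * t^-1 ^+ m.
pose k' t := G' t * t^-1 ^+ m - m%:R * (G t * t^-1 ^+ m.+1).
pose c (x : V) := G' (enorm x) * (enorm x)^-1 ^+ m.+1 - m%:R * (G (enorm x) * (enorm x)^-1 ^+ m.+2).
pose g (x : V) := k (enorm x).
have cG : continuous G.
  by move=> t; have [dd _] := dG t; apply: differentiable_continuous; apply/derivable1_diffP.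
have dinv (t : R) : 0 < t -> is_derive t 1 (fun s : R => s^-1 ^+ m) (- m%:R * t^-1 ^+ m.+1).
  move=> t0; have tn : t != 0 by rewrite gt_eqF.
  have hV : is_derive t 1 (fun s : R => s^-1) (- t^-1 ^+ 2).
    have [h1 h2] := is_derive_id t (1 : R); split; first exact: (derivableV (f := id) tn h1).
    by rewrite (deriveV (f := id) tn h1) h2 /GRing.scale /= mulr1 exprVn.
  have -> : (fun s : R => s^-1 ^+ m) = (fun s : R => s^-1) ^+ m by apply/funext => s; rewrite exprfctE.
  apply: (is_derive_eq (is_deriveX m hV)); rewrite /GRing.scale /=.
  have m0 : (0 < m)%N by rewrite subn_gt0.
  have -> : t^-1 ^+ m.+1 = t^-1 ^+ m.-1 * t^-1 ^+ 2 by rewrite -exprD addn2 prednK.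
  by ring.
have dk (t : R) : 0 < t -> is_derive t 1 k (k' t).
  move=> t0; apply: (is_derive_eq (is_deriveM (dG t) (dinv t t0))).
  by rewrite /GRing.scale /= /k'; ring.
have dg x j : is_derive x (e_ j) g (c x * x 0 j).
  have [xb|xb] := ltP 0 (enorm x).
    apply: (is_derive_eq (is_derive_comp (is_derive_enorm j xb) (dk _ xb))).
    by rewrite /k' /c !exprS; ring.
  have -> : c x = 0.
    by rewrite /c Gb ?Gb' ?mul0r ?mulr0 ?subrr //; exact: le_trans xb (ltW b0).
  rewrite mul0r; apply: near_eq_is_derive (is_derive_cst (0 : R) x (e_ j)).
  have : \forall y \near x, enorm y < b.
    have := continuous_enorm (x := x).
    by move/(_ _ (lt_nbhsl (le_lt_trans xb b0))).
  apply: filterS => y yb; by rewrite /g /k Gb ?mul0r // ltW.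
have ccoef (H : R -> R) l : continuous H -> (forall t, t <= b -> H t = 0) ->
    continuous (fun x : V => H (enorm x) * (enorm x)^-1 ^+ l).
  move=> cH H0.
  have -> : (fun x : V => H (enorm x) * (enorm x)^-1 ^+ l) =
      (fun x => (Num.max (enorm x) b)^-1 ^+ l * H (enorm x)).
    apply/funext => x; have [h|h] := leP (enorm x) b; first by rewrite H0 ?mul0r ?mulr0.
    by rewrite mulrC.
  apply: rV_contM; last by apply: rV_cont_comp => //; exact: continuous_enorm.
  apply: rV_contX.
  have cm : continuous (fun x : V => Num.max (enorm x) b).
    by apply: rV_cont_max; [exact: continuous_enorm|exact: rV_cont_cst].
  apply: rV_contV => // x.
  by rewrite gt_eqF // lt_max b0 orbT.
have csupp (f : V -> R) : continuous f -> (forall x, a <= enorm x -> f x = 0) -> Cc f.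
  move=> cf fa; split=> //; exists a => x ax; apply: fa; apply: le_trans (ltW ax) _.
  exact: norm_le_enorm.
have cg : Cc g.
  by apply: csupp; [exact: ccoef|move=> x ax; rewrite /g /k Ga // mul0r].
have cc : Cc c.
  apply: csupp; last by move=> x ax; rewrite /c Ga // Ga' // !mul0r mulr0 subrr.
  apply: rV_contB; first exact: ccoef.
  by apply: rV_contM; [exact: rV_cont_cst|exact: ccoef].
have Dg j x : 'D_(e_ j) g x = c x * x 0 j by have [_] := dg x j.
have g1 : CK 1 g.
  split; first exact: (proj1 cg).
  move=> j; split; first by move=> x; have [] := dg x j.
  split=> //; have -> : 'D_(e_ j) g = (fun x => c x * x 0 j) by apply/funext => x; exact: Dg.
  by apply: rV_contM; [exact: (proj1 cc)|exact: rV_cont_coord].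
apply: (@II_newton R n F F3 _ g c cg cc g1 Dg i ilt).
by move=> u j l; apply: CK_sym; apply: CK_derive.
Qed.

Lemma cont_pos_mul (h P : R -> R) (b : R) : 0 < b -> cont_pos h -> continuous P ->
  (forall t, t <= b -> P t = 0) -> continuous (fun t => h t * P t).
Proof.
move=> b0 ch cP Pb.
have -> : (fun t => h t * P t) = (fun t => h (Num.max t b) * P t).
  by apply/funext => t; have [tb|//] := leP t b; rewrite Pb // !mulr0.
apply: rV_contM => //.
have cm : continuous (fun t : R => Num.max t b).
  have cid : continuous (fun t : R => t) by move=> t A.
  by apply: rV_cont_max => //; exact: rV_cont_cst.
move=> t; apply: (@continuous_comp _ _ _ (fun t : R => Num.max t b) h); first exact: cm.
by apply: ch; rewrite lt_max b0 orbT.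
Qed.

(** A and B are |x|^(-m) (w - tau) and |x|^(1-m) tau, with |x| replaced by max(|x|, d) in the
    weights. They are nonnegative because 0 <= tau <= w. *)
Lemma radial_decomposition : exists A B : V -> R,
  [/\ continuous A, continuous B, forall x, 0 <= A x & forall x, 0 <= B x] /\
  [/\ forall x, enorm x < d -> A x = 0, forall x, enorm x < d -> B x = 0,
    forall x, w x = enorm x ^+ m * A x + enorm x ^+ m.-1 * B x &
    forall (G G' : R -> R) (a : R), (forall t : R, 0 < t -> is_derive t 1 G (G' t)) ->
      cont_pos G' -> (forall t, a <= t -> G t = 0) -> (forall t, a <= t -> G' t = 0) ->
      m%:R * II (fun x => G (enorm x) * A x) + II (fun x => G' (enorm x) * B x) = 0].
Proof.
have m0 : (0 < m)%N by rewrite subn_gt0.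
have xd (x : V) : enorm x < d -> `|x| < d by apply: le_lt_trans; exact: norm_le_enorm.
pose r (x : V) := (Num.max (enorm x) d)^-1.
have r0 x : 0 < Num.max (enorm x) d by rewrite lt_max d0 orbT.
have cr : continuous r.
  apply: rV_contV; first by move=> x; rewrite gt_eqF.
  by apply: rV_cont_max; [exact: continuous_enorm|exact: rV_cont_cst].
pose A x := r x ^+ m * (w x - tau x); pose B x := r x ^+ m.-1 * tau x.
have tau0 x : enorm x < d -> tau x = 0.
  by move=> h; rewrite /tau q_flat ?mul0r //; exact: xd.
have w0 x : enorm x < d -> w x = 0 by move=> h; rewrite w_flat //; exact: xd.
have A0 x : enorm x < d -> A x = 0 by move=> h; rewrite /A w0 // tau0 // subrr mulr0.
have B0 x : enorm x < d -> B x = 0 by move=> h; rewrite /B tau0 // mulr0.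
have cA : continuous A.
  apply: rV_contM; first exact: rV_contX.
  by apply: rV_contB; [exact: continuous_w|exact: continuous_tau].
have cB : continuous B by apply: rV_contM; [exact: rV_contX|exact: continuous_tau].
exists A, B; split; split => //.
- move=> x; have /andP[h1 h2] := tau_bounds x.
  by rewrite mulr_ge0 ?subr_ge0 // exprn_ge0 // invr_ge0 ltW.
- move=> x; have /andP[h1 h2] := tau_bounds x.
  by rewrite mulr_ge0 // exprn_ge0 // invr_ge0 ltW.
- move=> x; have [h|h] := ltP (enorm x) d; first by rewrite A0 // B0 // w0 // !mulr0 addr0.
  have e0 : 0 < enorm x by exact: lt_le_trans h.
  rewrite /A /B /r (max_l h) !mulrA -!exprMn divff ?gt_eqF // !expr1n !mul1r.
  by rewrite subrK.
move=> G G' a dG cG' Ga Ga'.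
have d2 : 0 < d / 2 by rewrite divr_gt0.
have d2d : d / 2 < d by lra.
(* G is differentiable only on the positive axis and may be singular at 0. Multiplying it by 1 - P
   removes a neighbourhood of 0 and alters neither integral: A and B vanish where |x| < d, and P
   vanishes from d on. *)
have [P [P' [[dP cP' _ _] [P1 P0 P'1 P'0]]]] := cutoff d2d.
pose T t := 1 - P t; pose T' t := - P' t.
have dT (t : R) : is_derive t 1 T (T' t).
  have := is_deriveB (is_derive_cst (1 : R) t (1 : R)) (dP t); by rewrite sub0r.
have T0 t : t <= d / 2 -> T t = 0 by move=> h; rewrite /T P1 // subrr.
have T'0 t : t <= d / 2 -> T' t = 0 by move=> h; rewrite /T' P'1 // oppr0.
have Td t : d <= t -> T t = 1 by move=> h; rewrite /T P0 // subr0.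
have T'd t : d <= t -> T' t = 0 by move=> h; rewrite /T' P'0 // oppr0.
have cT : continuous T.
  by move=> t; have [h _] := dT t; apply: differentiable_continuous; apply/derivable1_diffP.
have cT' : continuous T' by exact: rV_contN.
have cG : cont_pos G by exact: cont_pos_derive dG.
pose K t := G t * T t; pose K' t := G' t * T t + G t * T' t.
have dK (t : R) : is_derive t 1 K (K' t).
  have [t0|t0] := ltP 0 t.
    apply: (is_derive_eq (is_deriveM (dG t t0) (dT t))).
    by rewrite /GRing.scale /= /K'; ring.
  have -> : K' t = 0 by rewrite /K' T0 ?T'0 ?mulr0 ?addr0 //; lra.
  apply: near_eq_is_derive (is_derive_cst (0 : R) t 1); near=> s.
  by rewrite /K T0 ?mulr0 // ltW //; near: s; apply: lt_nbhsl; lra.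
have cK' : continuous K' by apply: rV_contD; [exact: (cont_pos_mul d2 cG' cT T0)|exact: (cont_pos_mul d2 cG cT' T'0)].
have aux := @radial_newton_aux K K' (d / 2) a d2 dK cK'.
have CA : Cc (fun x => G (enorm x) * A x) by exact: (radial_Cc d0 cG cA A0 Ga).
have CB : Cc (fun x => G' (enorm x) * B x) by exact: (radial_Cc d0 cG' cB B0 Ga').
rewrite -II_lin //.
apply: (etrans _ (aux _ _ _ _)).
- congr II; apply/funext => x; have [h|h] := ltP (enorm x) d.
    by rewrite A0 // B0 // w0 // (q_flat (xd _ h)) !mulr0 addr0.
  have e0 : 0 < enorm x by exact: lt_le_trans h.
  rewrite /K /K' Td // T'd // !mulr1 mulr0 addr0 q_tau -enorm_sq.
  rewrite /A /B /r (max_l h).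
  have -> : (enorm x)^-1 ^+ m.+1 = (enorm x)^-1 ^+ m.-1 * (enorm x)^-1 ^+ 2.
    by rewrite -exprD addn2 prednK.
  have -> : (enorm x)^-1 ^+ m.+2 = (enorm x)^-1 ^+ m * (enorm x)^-1 ^+ 2.
    by rewrite -exprD addn2.
  have E2 : (enorm x)^-1 ^+ 2 * enorm x ^+ 2 = 1.
    by rewrite -exprMn mulVf ?expr1n // gt_eqF.
  move: ((enorm x)^-1 ^+ 2) (enorm x ^+ 2) E2 => u v uv.
  set s1 := _ ^+ m; set s2 := _ ^+ m.-1; set g := G _; set g' := G' _.
  have -> : (g' * (s2 * u) - m%:R * (g * (s1 * u))) * (v * tau x) =
     (g' * s2 - m%:R * (g * s1)) * (u * v) * tau x by ring.
  by rewrite uv; ring.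
- by move=> t h; rewrite /K T0 // mulr0.
- by move=> t h; rewrite /K' T0 // T'0 // !mulr0 addr0.
- by move=> t h; rewrite /K Ga // mul0r.
- by move=> t h; rewrite /K' Ga // Ga' // !mul0r addr0.
Unshelve. all: end_near. Qed.

End Radial.

(** * Integration by parts against the primitive *)

Section Key.
Variables (R : realType) (n m : nat).
Local Notation V := 'rV[R]_n.
Variables (A B phi w : V -> R) (d : R).
Hypotheses (m0 : (0 < m)%N) (d0 : 0 < d).
Hypotheses (cA : continuous A) (cB : continuous B).
Hypotheses (A0 : forall x, 0 <= A x) (B0 : forall x, 0 <= B x).
Hypotheses (Ad : forall x, enorm x < d -> A x = 0) (Bd : forall x, enorm x < d -> B x = 0).
Hypothesis wE : forall x, w x = enorm x ^+ m * A x + enorm x ^+ m.-1 * B x.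
Hypothesis cw : continuous w.
Hypothesis identity : forall (G G' : R -> R) (a : R),
  (forall t : R, 0 < t -> is_derive t 1 G (G' t)) ->
  cont_pos G' -> (forall t, a <= t -> G t = 0) -> (forall t, a <= t -> G' t = 0) ->
  m%:R * II (fun x => G (enorm x) * A x) + II (fun x => G' (enorm x) * B x) = 0.

Variables (zeta E P0 P0' P1 P1' : R -> R) (b0 a0 e kappa C1 : R).
Hypothesis dP0 : forall t : R, is_derive t 1 P0 (P0' t).
Hypothesis cP0' : continuous P0'.
Hypothesis P0_01 : forall t, 0 <= P0 t <= 1.
Hypothesis P0'_le0 : forall t, P0' t <= 0.
Hypothesis P0_1 : forall t, t <= b0 -> P0 t = 1.
Hypothesis P0_0 : forall t, a0 <= t -> P0 t = 0.
Hypothesis P0'_0 : forall t, a0 <= t -> P0' t = 0.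
Hypothesis dP1 : forall t : R, is_derive t 1 P1 (P1' t).
Hypothesis cP1' : continuous P1'.
Hypothesis P1_01 : forall t, 0 <= P1 t <= 1.
Hypothesis P1'_le0 : forall t, P1' t <= 0.
Hypothesis P1_0 : forall t, e <= t -> P1 t = 0.
Hypothesis P1'_0 : forall t, e <= t -> P1' t = 0.
Hypothesis eb0 : e <= b0.
Hypothesis cz : cont_pos zeta.
Hypothesis dE : forall t : R, 0 < t -> is_derive t 1 E (zeta t * t ^+ m.-1).
Hypothesis kappa0 : 0 <= kappa.
Hypothesis E_le : forall t : R, 0 < t < e -> `|E t| <= kappa.
Hypothesis zeta_le : forall t : R, 0 < t < e -> `|t ^+ m * zeta t| <= kappa.
Hypothesis P0'_C1 : forall t : R, 0 <= t -> - P0' t <= C1 * t ^+ m.-1.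
Hypothesis cphi : Cc phi.
Hypothesis phi0 : forall x, 0 <= phi x.
Hypothesis phi1 : forall x, enorm x <= a0 -> phi x = 1.

Let c_pos (f : R -> R) : continuous f -> cont_pos f. Proof. by move=> cf t _; exact: cf. Qed.

Let cposM (f g : R -> R) : cont_pos f -> cont_pos g -> cont_pos (fun t => f t * g t).
Proof. by move=> cf cg t t0; apply: continuousM; [exact: cf|exact: cg]. Qed.

Let cposX k : cont_pos (fun t : R => t ^+ k).
Proof. by apply: c_pos; apply: rV_contX => t U. Qed.

Let cP0 : cont_pos P0. Proof. by apply: (@cont_pos_derive _ _ P0'). Qed.
Let cP1 : cont_pos P1. Proof. by apply: (@cont_pos_derive _ _ P1'). Qed.
Let cE : cont_pos E. Proof. exact: cont_pos_derive dE. Qed.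

Let m1 : 1 <= m%:R :> R. Proof. by rewrite ler1n. Qed.

(* [identity] is applied to G = P0, P1 and E * P1. *)
Lemma key_bound :
  `|II (fun x => zeta (enorm x) * P1 (enorm x) * w x)| <= 3 * kappa * (C1 * II (fun x => phi x * w x)).
Proof.
set K := C1 * _.
have CcA (G : R -> R) a : cont_pos G -> (forall t, a <= t -> G t = 0) -> Cc (fun x => G (enorm x) * A x).
  by move=> cG Ga; exact: (radial_Cc d0 cG cA Ad Ga).
have CcB (G : R -> R) a : cont_pos G -> (forall t, a <= t -> G t = 0) -> Cc (fun x => G (enorm x) * B x).
  by move=> cG Ga; exact: (radial_Cc d0 cG cB Bd Ga).
have CP0A : Cc (fun x => P0 (enorm x) * A x) by exact: (CcA _ _ cP0 P0_0).
have CP1A : Cc (fun x => P1 (enorm x) * A x) by exact: (CcA _ _ cP1 P1_0).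
have cN (f : R -> R) : cont_pos f -> cont_pos (fun t => - f t).
  by move=> cf t t0; apply: continuousN; exact: cf.
have CP0B : Cc (fun x => - P0' (enorm x) * B x).
  by apply: (CcB (fun t => - P0' t) a0) => [|t /P0'_0 ->]; [exact/cN/c_pos|rewrite oppr0].
have CP1B : Cc (fun x => - P1' (enorm x) * B x).
  by apply: (CcB (fun t => - P1' t) e) => [|t /P1'_0 ->]; [exact/cN/c_pos|rewrite oppr0].
pose S0 := II (fun x => P0 (enorm x) * A x).
pose S1 := II (fun x => - P1' (enorm x) * B x).
have IN (P' : R -> R) : Cc (fun x => - P' (enorm x) * B x) ->
    II (fun x => P' (enorm x) * B x) = - II (fun x => - P' (enorm x) * B x).
  move=> cP'; rewrite -[RHS]mulN1r -IIZ //.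
  by congr II; apply/funext => x; ring.
(* The identity for [P0] makes m S0 the integral of - P0' B, supported where [phi] is 1. There - P0'
   <= C1 |x|^(m-1), and |x|^(m-1) B is at most w. *)
have S0K : m%:R * S0 <= K.
  have h := identity (fun t _ => dP0 t) (c_pos cP0') P0_0 P0'_0.
  rewrite IN // in h; have -> : m%:R * S0 = II (fun x => - P0' (enorm x) * B x) by rewrite /S0; lra.
  rewrite /K -IIZ; last exact: Cc_mul.
  apply: le_II => //; first by apply: CcZ; exact: Cc_mul.
  move=> x; have [xa|xa] := leP (enorm x) a0; last first.
    rewrite P0'_0 ?(ltW xa) // oppr0 mul0r.
    have w0 : 0 <= w x by rewrite wE addr_ge0 // mulr_ge0 // exprn_ge0 // enorm_ge0.
    rewrite mulr_ge0 // ?mulr_ge0 //.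
    have := P0'_C1 (t := 1) ler01; rewrite expr1n mulr1; apply: le_trans.
    by rewrite oppr_ge0.
  rewrite phi1 // mul1r wE.
  apply: le_trans (_ : C1 * enorm x ^+ m.-1 * B x <= _).
    by apply: ler_wpM2r => //; apply: P0'_C1; exact: enorm_ge0.
  have C10 : 0 <= C1.
    have := P0'_C1 (t := 1) ler01; rewrite expr1n mulr1; apply: le_trans.
    by rewrite oppr_ge0.
  by rewrite -mulrA ler_wpM2l // lerDr mulr_ge0 // exprn_ge0 // enorm_ge0.
have P1P0 t : P1 t <= P0 t.
  have [te|te] := leP e t; first by rewrite P1_0 //; case/andP: (P0_01 t).
  by rewrite P0_1 ?(ltW (lt_le_trans te eb0)) //; case/andP: (P1_01 t).
(* The identity for [P1] replaces - P1' B by m P1 A, and P1 <= P0. The bound therefore ignores how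
   steep [P1] is, which later allows it to approach an indicator. *)
have S1A : S1 <= m%:R * S0.
  have idP1 := identity (fun t _ => dP1 t) (c_pos cP1') P1_0 P1'_0.
  rewrite IN // -/S1 in idP1; have -> : S1 = m%:R * II (fun x => P1 (enorm x) * A x) by lra.
  apply: ler_wpM2l; first exact: ler0n.
  by apply: le_II => // x; apply: ler_wpM2r.
have S0_ge0 : 0 <= S0.
  by apply: II_ge0 => // x; rewrite mulr_ge0 //; case/andP: (P0_01 (enorm x)).
have S0_le : S0 <= m%:R * S0 by rewrite ler_peMl.
have S1_ge0 : 0 <= S1 by apply: II_ge0 => // x; rewrite mulr_ge0 // oppr_ge0.
have bdA (f : R -> R) : Cc (fun x => f (enorm x) * P1 (enorm x) * A x) ->
    (forall t, 0 < t < e -> `|f t| <= kappa) ->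
    `|II (fun x => f (enorm x) * P1 (enorm x) * A x)| <= kappa * S0.
  move=> cf fk; rewrite /S0 -IIZ //; apply: II_norm_le => //; first exact: CcZ.
  move=> x; have /andP[p0 _] := P1_01 (enorm x).
  have [xd|xd] := ltP (enorm x) d; first by rewrite Ad // !mulr0 normr0.
  have x0 : 0 < enorm x by exact: lt_le_trans xd.
  rewrite !normrM (ger0_norm (A0 x)) mulrA; apply: ler_wpM2r => //.
  rewrite (ger0_norm p0); have [xe|xe] := leP e (enorm x).
    by rewrite P1_0 // mulr0 mulr_ge0 //; case/andP: (P0_01 (enorm x)).
  by apply: ler_pM => //; apply: fk; rewrite x0.
have CcP1A (f : R -> R) : cont_pos f -> Cc (fun x => f (enorm x) * P1 (enorm x) * A x).
  move=> cf; apply: (CcA (fun t => f t * P1 t) e); first exact: cposM.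
  by move=> t te; rewrite P1_0 // mulr0.
have hEA := bdA E (CcP1A _ cE) E_le.
have cZm : cont_pos (fun t => t ^+ m * zeta t) by exact: cposM.
have hZA := bdA _ (CcP1A _ cZm) zeta_le.
have CEB : Cc (fun x => (E (enorm x) * P1' (enorm x)) * B x).
  apply: (CcB (fun t => E t * P1' t) e); first by apply: cposM => //; exact: c_pos.
  by move=> t te; rewrite P1'_0 // mulr0.
have CZB : Cc (fun x => (zeta (enorm x) * enorm x ^+ m.-1 * P1 (enorm x)) * B x).
  apply: (CcB (fun t => zeta t * t ^+ m.-1 * P1 t) e).
    by apply: cposM => //; exact: cposM.
  by move=> t te; rewrite P1_0 // mulr0.
have hEB : `|II (fun x => (E (enorm x) * P1' (enorm x)) * B x)| <= kappa * S1.
  rewrite /S1 -IIZ //; apply: II_norm_le => //; first exact: CcZ.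
  move=> x; have [xd|xd] := ltP (enorm x) d; first by rewrite Bd // !mulr0 normr0.
  have x0 : 0 < enorm x by exact: lt_le_trans xd.
  rewrite !normrM (ger0_norm (B0 x)) mulrA; apply: ler_wpM2r => //.
  rewrite (ler0_norm (P1'_le0 _)); have [xe|xe] := leP e (enorm x).
    by rewrite P1'_0 // oppr0 !mulr0.
  by apply: ler_wpM2r; [rewrite oppr_ge0|apply: E_le; rewrite x0].
(* The derivative of E P1 contains zeta t^(m-1) P1, so the integral of zeta against B is traded for
   integrals of E, which stay small even if |zeta| t^(m-1) is not integrable at 0. *)
have idE : m%:R * II (fun x => E (enorm x) * P1 (enorm x) * A x) +
   (II (fun x => (zeta (enorm x) * enorm x ^+ m.-1 * P1 (enorm x)) * B x) +
    II (fun x => (E (enorm x) * P1' (enorm x)) * B x)) = 0.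
  rewrite -IID //.
  pose G' t := zeta t * t ^+ m.-1 * P1 t + E t * P1' t.
  rewrite (_ : (fun x => _ + _) = (fun x => G' (enorm x) * B x)); last first.
    by apply/funext => x; rewrite /G' mulrDl.
  apply: (identity (G := fun t => E t * P1 t) (a := e)).
  - move=> t t0; apply: (is_derive_eq (is_deriveM (dE t0) (dP1 t))).
    by rewrite /GRing.scale /= /G'; ring.
  - move=> t t0; apply: (@continuousD _ _ _ (fun t => zeta t * t ^+ m.-1 * P1 t) (fun t => E t * P1' t)).
      have cZP := cposM (cposM cz (@cposX m.-1)) cP1.
      exact: (cZP t t0).
    by apply: continuousM; [exact: cE|exact: cP1'].
  - by move=> t te; rewrite P1_0 // mulr0.
  - by move=> t te; rewrite /G' P1_0 // P1'_0 // !mulr0 addr0.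
have -> : II (fun x => zeta (enorm x) * P1 (enorm x) * w x) =
   II (fun x => (enorm x ^+ m * zeta (enorm x)) * P1 (enorm x) * A x) +
   II (fun x => (zeta (enorm x) * enorm x ^+ m.-1 * P1 (enorm x)) * B x).
  rewrite -IID //; last exact: (CcP1A _ cZm).
  by congr II; apply/funext => x; rewrite wE; ring.
move: hEA hZA hEB idE S0K S1A S0_ge0 S0_le S1_ge0.
clear bdA; clearbody S0 S1 K.
set a := II (fun x => E (enorm x) * P1 (enorm x) * A x).
set b := II (fun x => enorm x ^+ m * zeta (enorm x) * P1 (enorm x) * A x).
set c := II (fun x => E (enorm x) * P1' (enorm x) * B x).
move: a b c (II _) S0 S1 K => a b c dd s0 s1 k ha hb hc id h1 h2 h3 h4 h5.
have mpos : 0 < m%:R :> R by rewrite ltr0n.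
have ma : `|m%:R * a| <= kappa * (m%:R * s0).
  rewrite normrM ger0_norm ?(ltW mpos) // mulrCA; apply: ler_wpM2l => //.
have hs0 : kappa * (m%:R * s0) <= kappa * k by apply: ler_wpM2l.
have hs1 : kappa * s1 <= kappa * k by apply: ler_wpM2l => //; exact: le_trans h1.
have hs2 : kappa * s0 <= kappa * k by apply: ler_wpM2l => //; exact: le_trans h1.
(* Three contributions of at most kappa K each account for the factor 3: t^m zeta against A, m E
   against A, and E P1' against B. *)
rewrite -mulrA.
move: ma hb hc; rewrite !ler_norml => /andP[ma1 ma2] /andP[hb1 hb2] /andP[hc1 hc2].
by apply/andP; split; lra.
Qed.

End Key.

(** * The primitive of the density *)

Section Primitive.
Variables (R : realType) (n i : nat) (zeta : R -> R).
Local Notation leb := (@lebesgue_measure R).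

Lemma near_right (P : R -> Prop) : (\forall t \near 0^'+, P t) ->
  exists2 d : R, 0 < d & forall t, 0 < t < d -> P t.
Proof.
move=> /nbhs_ballP[d /= d0 h]; exists d => // t /andP[t0 td].
by apply: h => //; rewrite -ball_normE /= sub0r normrN gtr0_norm.
Qed.

Let q (s : R) := zeta s * s ^+ (n - i - 1).
Let tail (t : R) := (\int[leb]_(s in `[t, +oo[%classic) (q s)%:E)%E.

Lemma D_class_cont_pos : D_class n i zeta -> cont_pos q.
Proof.
move=> [cz _] t t0; apply: continuousM; first exact: cz.
exact: exprn_continuous.
Qed.

(** Only the values of q from a > 0 on matter; extending them to a continuous compactly supported
    function on the line gives integrability and access to the fundamental theorem of calculus. *)
Lemma tail_local (a : R) : D_class n i zeta -> 0 < a ->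
  exists h : R -> R, [/\ continuous h, leb.-integrable setT (EFin \o h) & forall s, a <= s -> h s = q s].
Proof.
move=> D a0; have cq := D_class_cont_pos D; have [cz [[T zT] _]] := D.
pose p s := Num.max 0 (Num.min 1 (s - a + 1)).
have cid : continuous (fun t : R => t) by move=> t A.
pose h s := q (Num.max s a) * p s; exists h.
have ch : continuous h.
  apply: rV_contM.
    have cm : continuous (fun t : R => Num.max t a) by apply: rV_cont_max => //; exact: rV_cont_cst.
    move=> t; apply: (@continuous_comp _ _ _ (fun t : R => Num.max t a) q); first exact: cm.
    by apply: cq; rewrite lt_max a0 orbT.
  apply: rV_cont_max; first exact: rV_cont_cst.
  have -> : (fun s => Num.min 1 (s - a + 1)) = (fun s : R => - Num.max (- 1) (- (s - a + 1))).
    by apply/funext => s; rewrite oppr_max !opprK.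
  apply: rV_contN; apply: rV_cont_max; first exact: rV_cont_cst.
  apply: rV_contN; apply: rV_contD; last exact: rV_cont_cst.
  by apply: rV_contB => //; exact: rV_cont_cst.
split=> //.
  apply: Cc1_integrable; split=> //.
  exists (Num.max (Num.max T a) (`|a| + 1)) => s; rewrite !gt_max => /andP[/andP[sT sa] s1].
  have [s0|s0] := ltP 0 s.
    rewrite (gtr0_norm s0) in sT sa; rewrite /h (max_l (ltW sa)) /q zT // !mul0r //.
  rewrite /h /p (_ : Num.max 0 _ = 0) ?mulr0 //; apply: max_l.
  rewrite ge_min; apply/orP; right; rewrite (ler0_norm s0) in s1.
  by have := ler_norm (- a); rewrite normrN; lra.
move=> s sa; rewrite /h (max_l sa) /p.
have -> : Num.min 1 (s - a + 1) = 1 by apply: min_l; lra.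
by rewrite max_r ?mulr1.
Qed.

Lemma is_derive_tail (t : R) : D_class n i zeta -> 0 < t -> is_derive t 1 (fine \o tail) (- q t).
Proof.
move=> D t0; have a0 : 0 < t / 2 by rewrite divr_gt0.
have at_ : t / 2 < t by lra.
have [h [ch ih hq]] := tail_local D a0; set a := t / 2 in a0 at_ hq.
have ihS (A : set R) : measurable A -> leb.-integrable A (EFin \o h).
  by move=> mA; apply: (integrableS _ _ _ ih).
have E x : a < x -> fine (tail x) =
    Rintegral leb `[a, +oo[%classic h - Rintegral leb `[a, x]%classic h.
  move=> ax; rewrite Rintegral_itvB //; last 2 first.
    exact: ihS.
    by rewrite bnd_simp ltW.
  rewrite Rintegral_itv_obnd_cbnd; last exact: ihS.
  rewrite /Rintegral; congr fine; apply: eq_integral => s.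
  rewrite inE /= in_itv /= andbT => xs; rewrite hq //.
  exact: le_trans (ltW ax) xs.
have tt1 : t < t + 1 by lra.
have [d1 d2] := @continuous_FTC1_closed R h a t (t + 1) tt1 (ihS _ (measurable_itv _)) at_ (ch t).
have dI : is_derive t 1 (fun x => Rintegral leb `[a, x]%classic h) (q t).
  by split=> //; rewrite -derive1E d2 hq // ltW.
set C := Rintegral leb `[a, +oo[%classic h in E.
have nE : \forall x \near t, C - Rintegral leb `[a, x]%classic h = (fine \o tail) x.
  by near=> x; rewrite /= E //; near: x; exact: lt_nbhsr.
have := is_deriveB (is_derive_cst C t (1 : R)) dI.
by rewrite sub0r => /(near_eq_is_derive nE).
Unshelve. all: end_near. Qed.

Lemma D_class_primitive : D_class n i zeta -> exists E : R -> R,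
  (forall t : R, 0 < t -> is_derive t 1 E (zeta t * t ^+ (n - i).-1)) /\
  forall kappa : R, 0 < kappa -> exists2 d : R, 0 < d &
    forall t : R, 0 < t < d -> `|E t| <= kappa /\ `|t ^+ (n - i) * zeta t| <= kappa.
Proof.
move=> D; have [_ [_ [zl [L tl]]]] := D.
(* L is the limit of the tails at 0, so this is the primitive that tends to 0 there; its existence
   is the integral condition in [D_class]. *)
exists (fun t => L - fine (tail t)); split.
  move=> t t0; have := is_deriveB (is_derive_cst L t (1 : R)) (is_derive_tail D t0).
  by rewrite sub0r opprK /q subn1.
move=> k k0; have fl : (fine \o tail) t @[t --> 0^'+] --> L by exact: fine_cvg tl.
have [d1 d10 h1] := near_right ((cvgrPdist_le _ _).1 fl k k0).
have [d2 d20 h2] := near_right ((cvgrPdist_le _ _).1 zl k k0).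
exists (Num.min d1 d2); first by rewrite lt_min d10.
move=> t; rewrite lt_min => /andP[t0 /andP[td1 td2]]; split.
  by apply: h1; rewrite t0.
by have := h2 t; rewrite t0 td2 sub0r normrN; apply.
Qed.

End Primitive.

(** * Uniform estimates and truncation *)

Section Uniform.
Variables (R : realType) (n i : nat) (zeta : R -> R).
Local Notation V := 'rV[R]_n.
Variables (Phi : (V -> R) -> {measure set (Rn R n) -> \bar R}) (Vz : (V -> R) -> R).
Hypotheses (i_gt0 : (0 < i)%N) (ilt : (i < n)%N).
Hypotheses (D : D_class n i zeta) (hm : hessian_measure i Phi) (hV : fiv i zeta Vz).

Lemma cutoff_continuous (b a : R) P P' : cutoff_on b a P P' -> continuous P.
Proof.
move=> [[dP _ _ _] _] t; have [h _] := dP t.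
by apply: differentiable_continuous; apply/derivable1_diffP.
Qed.

(** Where P' is nonzero, t exceeds b > 0 and t^k is at least b^k; the maximum of - P' divided by b^k
    serves as C. *)
Lemma cutoff_derive_bound (b a : R) P P' k : 0 < b -> cutoff_on b a P P' ->
  exists2 C : R, 0 <= C & forall t : R, 0 <= t -> - P' t <= C * t ^+ k.
Proof.
move=> b0 [[_ cP' _ P'0] [_ _ Pb Pa]].
have [ba|ab] := leP b a; last first.
  exists 0 => // t t0; rewrite mul0r; have [tb|tb] := leP t b; first by rewrite Pb // oppr0.
  by rewrite Pa ?oppr0 //; exact: ltW (lt_trans ab tb).
have [c _ hc] := @EVT_max R (fun t => - P' t) b a ba
  (continuous_subspaceT (rV_contN cP')).
exists (- P' c / b ^+ k).
  by rewrite divr_ge0 ?oppr_ge0 // exprn_ge0 // ltW.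
move=> t t0; have C0 : 0 <= - P' c / b ^+ k * t ^+ k.
  by rewrite mulr_ge0 ?exprn_ge0 // divr_ge0 ?oppr_ge0 // exprn_ge0 // ltW.
have [tb|tb] := leP t b; first by rewrite Pb // oppr0.
have [ta|ta] := leP a t; first by rewrite Pa // oppr0.
apply: le_trans (_ : - P' c <= _); first by apply: hc; rewrite in_itv /= !ltW.
rewrite mulrAC ler_pdivlMr ?exprn_gt0 // ler_wpM2l ?oppr_ge0 //.
by rewrite lerXn2r ?nnegrE // ltW.
Qed.

Let cz : cont_pos zeta. Proof. by case: D. Qed.

(** Uniform convergence rests on the order of the quantifiers: delta is fixed by r, M and eta,
    before F, its flat radius d and the cutoff P. *)
Lemma radial_cutoff_bound (r M eta : R) : 0 < r -> 0 <= M -> 0 < eta ->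
  exists2 delta : R, 0 < delta & forall (F G : V -> R) (d b e : R) (P P' : R -> R),
    CK 3 F -> convex_fun F -> 0 < d -> (forall x, `|x| < d -> hessian F x = 0) ->
    CK 3 G -> convex_fun G -> `|G 0| <= M + 1 ->
    (forall x y, `|G x - G y| <= 4 * (M + 1) / r * `|x - y|) ->
    (forall x, `|x| < r / 4 -> hessian G x = hessian F x) ->
    e <= delta -> cutoff_on b e P P' ->
    `|II (fun x => zeta (enorm x) * P (enorm x) * elsym i (hessian F x))| <= eta.
Proof.
move=> r0 M0 eta0; have b00 : 0 < r / 16 by rewrite divr_gt0.
have ba0 : r / 16 < r / 8 by lra.
have ar : r / 8 < r / 5 by lra.
have r45 : r / 5 <= r / 4 by lra.
(* Nested radii: P vanishes from r / 16 on, [P0] falls from 1 to 0 between r / 16 and r / 8, and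
   [phi] falls between r / 8 and r / 5, inside the ball of radius r / 4 where F and G share their
   Hessian. *)
have [P0 [P0' cut0]] := cutoff ba0.
have [Q [Q' cutQ]] := cutoff ar.
pose phi (x : V) := Q (enorm x).
have Q01 t : 0 <= Q t <= 1 by case: cutQ => [[_ _ h _] _].
have Q1 t : t <= r / 8 -> Q t = 1 by case: cutQ => [_ [h _ _ _]]; exact: h.
have Q0 t : r / 5 <= t -> Q t = 0 by case: cutQ => [_ [_ h _ _]]; exact: h.
have cphi : Cc phi.
  split.
    by apply: (rV_cont_comp (h := Q)); [exact: continuous_enorm|exact: cutoff_continuous cutQ].
  exists (r / 5) => x xr; apply: Q0; apply: le_trans (ltW xr) _; exact: norm_le_enorm.
have phi0 x : 0 <= phi x by case/andP: (Q01 (enorm x)).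
pose L := Num.max (M + 1) (4 * (M + 1) / r).
have M1 : 0 <= M + 1 by lra.
have L0 : 0 <= L by rewrite le_max M1.
have [C hC] := mass_bound ilt hm cphi phi0 L0.
have [C1 C10 hC1] := cutoff_derive_bound (n - i).-1 b00 cut0.
have [E [dE hE]] := D_class_primitive D.
pose S := C1 * Num.max C 0.
have S0 : 0 <= S by rewrite mulr_ge0 // le_max lexx orbT.
(* The summand 1 keeps the quotient meaningful for S = 0 and still gives 3 kappa S <= eta. *)
pose kappa := eta / (3 * S + 1).
have S1 : 0 < 3 * S + 1 by lra.
have k0 : 0 < kappa by rewrite divr_gt0.
have kS : 3 * kappa * S <= eta.
  have -> : 3 * kappa * S = eta * (3 * S) / (3 * S + 1) by rewrite /kappa; ring.
  by rewrite ler_pdivrMr // ler_pM2l //; lra.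
have [d1 d10 hd1] := hE _ k0.
exists (Num.min d1 (r / 16)); first by rewrite lt_min d10.
move=> F G d b e P P' F3 cvF d0 Ff G3 cvG G0 GL HGF; rewrite le_min => /andP[ed1 er] cutP.
have psd x u : 0 <= qform u (hessian F x) by apply: hessian_psd => //; exact: CK_S.
have [A [B [[cA cB A0 B0] [Ad Bd wE id]]]] :=
  radial_decomposition i_gt0 ilt F3 d0 (elsym_ge0 ilt hm)
    psd Ff.
have [[dP0 cP0' P01 P0'0] [P0b P0a _ P0'a]] := cut0.
have [[dP cP' P1 P'0] [_ Pe _ P'e]] := cutP.
have Ek t : 0 < t < e -> `|E t| <= kappa.
  by move=> /andP[t0 te]; have [] := hd1 t; rewrite ?t0 ?(lt_le_trans te ed1).
have zk t : 0 < t < e -> `|t ^+ (n - i) * zeta t| <= kappa.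
  by move=> /andP[t0 te]; have [] := hd1 t; rewrite ?t0 ?(lt_le_trans te ed1).
have m0 : (0 < n - i)%N by rewrite subn_gt0.
have phi1 x : enorm x <= r / 8 -> phi x = 1 by exact: Q1.
have := key_bound m0 d0 cA cB A0 B0 Ad Bd wE (continuous_elsym_hessian (i := i) F3) id
  dP0 cP0' P01 P0'0 P0b P0a P0'a dP cP' P1 P'0 Pe P'e er cz dE (ltW k0) Ek zk hC1 cphi phi0 phi1.
move/le_trans; apply; apply: le_trans kS; apply: ler_wpM2l; first by rewrite mulr_ge0 // ltW.
apply: ler_wpM2l => //; rewrite le_max; apply/orP; left.
rewrite (_ : (fun x => _) = (fun x => phi x * elsym i (hessian G x))).
  apply: hC => //; first by rewrite /L le_max G0.
  move=> x y; apply: le_trans (GL x y) _; apply: ler_wpM2r => //.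
  by rewrite /L le_max lexx orbT.
apply/funext => x; have [xr|xr] := ltP `|x| (r / 4); first by rewrite HGF.
have Qx : Q (enorm x) = 0.
  by apply: Q0; apply: le_trans (norm_le_enorm x); exact: le_trans r45 xr.
have z (u v : R) : 0 * u = 0 * v by rewrite !mul0r.
by rewrite /phi Qx; exact: z.
Qed.

End Uniform.

(** * From smooth to arbitrary convex functions *)

Section Limit.
Variables (R : realType) (n i : nat) (zeta : R -> R).
Local Notation V := 'rV[R]_n.
Variables (Phi : (V -> R) -> {measure set (Rn R n) -> \bar R}) (Vz : (V -> R) -> R).
Hypotheses (i_gt0 : (0 < i)%N) (ilt : (i < n)%N).
Hypotheses (D : D_class n i zeta) (hm : hessian_measure i Phi) (hV : fiv i zeta Vz).

Let cz : cont_pos zeta. Proof. by case: D. Qed.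

Definition outer (P : R -> R) (x : V) : R := zeta (enorm x) * (1 - P (enorm x)).

Lemma zeta_supp : exists a : R, forall t, a <= t -> zeta t = 0.
Proof.
have [_ [[T hT] _]] := D; exists (T + 1) => t Tt; apply: hT.
by apply: lt_le_trans Tt; rewrite ltrDl.
Qed.

Lemma outer_Cc (b a : R) P P' : 0 < b -> cutoff_on b a P P' -> Cc (outer P).
Proof.
move=> b0 cP; have [T hT] := zeta_supp; have [_ [Pb _ _ _]] := cP.
apply: (radial_Cc b0 cz _ _ hT).
  apply: rV_contB; first exact: rV_cont_cst.
  by apply: (rV_cont_comp (h := P)); [exact: continuous_enorm|exact: cutoff_continuous cP].
by move=> x xb; rewrite Pb ?subrr // ltW.
Qed.

(** Since the Hessian of F vanishes near 0, zeta(|x|) w is continuous with compact support; V F is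
    then an ordinary integral, and what remains is the part that the cutoff keeps near 0. *)
Lemma fiv_sub_outer F d (b a : R) P P' : CK 3 F -> convex_fun F -> 0 < d ->
  (forall x, `|x| < d -> hessian F x = 0) -> 0 < b -> cutoff_on b a P P' ->
  Vz F - mint (Phi F) (outer P) =
    II (fun x => zeta (enorm x) * P (enorm x) * elsym i (hessian F x)).
Proof.
move=> F3 cvF d0 Ff b0 cP; have [T hT] := zeta_supp.
pose w x := elsym i (hessian F x).
have cw : continuous w by exact: continuous_elsym_hessian.
have w0 x : enorm x < d -> w x = 0.
  move=> xd; apply: (@w_flat _ _ _ F d i_gt0 ilt Ff).
  by apply: le_lt_trans xd; exact: norm_le_enorm.
have czw : Cc (fun x => zeta (enorm x) * w x) by exact: (radial_Cc d0 cz cw w0 hT).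
have cg := outer_Cc b0 cP.
have cgw : Cc (fun x => outer P x * w x) by exact: Cc_mul.
have VE : Vz F = II (fun x => zeta (enorm x) * w x).
  have [_ [_ [_ [_ [_ h]]]]] := hV; have := h F cvF (CK_C2 (CK_S F3)).
  by rewrite leb_intE // => -[].
rewrite VE (hm_density ilt hm cvF F3 cg) -/w -IIB //.
congr II; apply/funext => x; rewrite -/(w x) /outer; move: (w x) => u; ring.
Qed.

Lemma smooth_approx_seq (f : V -> R) (r M : R) : convex_fun f -> 0 < r -> 0 <= M ->
  (forall x, `|x| <= r -> `|f x| <= M) ->
  exists F G : nat -> V -> R, exists d : nat -> R,
    [/\ lu_cvg F f, forall k, convex_fun (F k) &
      forall k, [/\ [/\ CK 3 (F k), 0 < d k & forall x, `|x| < d k -> hessian (F k) x = 0],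
        [/\ CK 3 (G k), convex_fun (G k), `|G k 0| <= M + 1 &
          forall x y, `|G k x - G k y| <= 4 * (M + 1) / r * `|x - y|] &
        forall x, `|x| < r / 4 -> hessian (G k) x = hessian (F k) x]].
Proof.
move=> cvf r0 M0 fM.
have ex k : exists FGd : (V -> R) * (V -> R) * R,
    [/\ [/\ CK 3 FGd.1.1, convex_fun FGd.1.1, 0 < FGd.2 & forall x, `|x| < FGd.2 -> hessian FGd.1.1 x = 0],
      forall x, `|x| <= k%:R + r -> `|FGd.1.1 x - f x| <= k.+1%:R^-1,
      [/\ CK 3 FGd.1.2, convex_fun FGd.1.2, `|FGd.1.2 0| <= M + 1 &
      forall x y, `|FGd.1.2 x - FGd.1.2 y| <= 4 * (M + 1) / r * `|x - y|] &
    forall x, `|x| < r / 4 -> hessian FGd.1.2 x = hessian FGd.1.1 x].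
  (* The radius k + r respects the lower bound r demanded by the approximation and exhausts the
     space, as locally uniform convergence requires. *)
  have rk : r <= k%:R + r by rewrite lerDr.
  have k01 : 0 < (k.+1%:R^-1 : R) <= 1.
    by apply/andP; split; [rewrite invr_gt0 ltr0Sn|rewrite -[leRHS]invr1 lef_pV2 ?posrE ?ltr0Sn // ler1n].
  have [F [G [d h]]] := smooth_approx cvf r0 rk k01 M0 fM.
  by exists (F, G, d).
have [S hS] := choice ex.
exists (fun k => (S k).1.1), (fun k => (S k).1.2), (fun k => (S k).2); split.
- move=> r' e _ e0.
  near=> k => x xr; have [_ h _ _] := hS k.
  apply: (@le_lt_trans _ _ k.+1%:R^-1).
    apply: h; apply: le_trans (norm_le_enorm x) _; apply: le_trans xr _.
    rewrite -[leLHS]addr0; apply: lerD; last exact: ltW.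
    by near: k; exact: nbhs_infty_ger.
  rewrite invf_plt ?posrE //; apply: lt_le_trans (_ : k%:R <= _); last by rewrite ler_nat.
  by near: k; exact: nbhs_infty_gtr.
- by move=> k; have [[]] := hS k.
- by move=> k; have [[h1 h2 h3 h4] _ h5 h6] := hS k.
Unshelve. all: end_near. Qed.

(** For a fixed cutoff, [outer P] is an admissible test function, so continuity of V and weak
    convergence of the Hessian measures carry the bound to f; delta is the same along the whole
    approximating sequence. *)
Lemma fiv_outer_bound (r M eta : R) : 0 < r -> 0 <= M -> 0 < eta ->
  exists2 delta : R, 0 < delta & forall (f : V -> R) (b e : R) (P P' : R -> R),
    convex_fun f -> (forall x, `|x| <= r -> `|f x| <= M) ->
    0 < b -> e <= delta -> cutoff_on b e P P' ->
    `|Vz f - mint (Phi f) (outer P)| <= eta.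
Proof.
move=> r0 M0 eta0; have [delta d0 hd] := radial_cutoff_bound i_gt0 ilt D hm r0 M0 eta0.
exists delta => // f b e P P' cvf fM b0 ed cP.
have [F [G [d [luF cvF hF]]]] := smooth_approx_seq cvf r0 M0 fM.
have cg := outer_Cc b0 cP.
have cV : Vz (F k) @[k --> \oo] --> Vz f.
  by have [_ [_ [_ [_ [h _]]]]] := hV; exact: h.
have cm := hm_weak hm cvF cvf luF cg.
have cd : `|Vz (F k) - mint (Phi (F k)) (outer P)| @[k --> \oo] -->
    `|Vz f - mint (Phi f) (outer P)|.
  by apply: cvg_norm; exact: cvgB.
apply: (cvgr_to_le cd); apply: nearW => k.
have [[F3 dk Fd] [G3 cvG G0 GL] FG] := hF k.
rewrite (fiv_sub_outer F3 (cvF k) dk Fd b0 cP).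
exact: (hd _ _ _ _ _ _ _ F3 (cvF k) dk Fd G3 cvG G0 GL FG ed cP).
Qed.

End Limit.

(** * From smooth cutoffs to the sharp truncation *)

Section Truncation.
Variables (R : realType) (n i : nat) (zeta : R -> R).
Local Notation V := 'rV[R]_n.
Variables (Phi : (V -> R) -> {measure set (Rn R n) -> \bar R}).
Hypotheses (ilt : (i < n)%N) (D : D_class n i zeta) (hm : hessian_measure i Phi).

(** The assumed bound holds for every inner radius b with the same eta, so it survives the limit in
    which the cutoffs tend to the indicator of the open ball. *)
Lemma trunc_int_bound (f : V -> R) (eps c eta : R) : convex_fun f -> 0 < eps ->
  (forall b P P', 0 < b -> cutoff_on b eps P P' ->
    `|c - mint (Phi f) (outer zeta P)| <= eta) ->
  (`|trunc_int zeta (Phi f) eps - c%:E| <= eta%:E)%E.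
Proof.
move=> cvf eps0 hc; have mu_fin := proj1 hm f cvf.
have [cz _] := D; have [T zT] := zeta_supp D.
(* Tends to eps from below; with l + 2 in the denominator b l >= eps / 2, so that one dominating
   function serves all l. *)
pose b (l : nat) : R := eps * (1 - l.+2%:R^-1).
have l2 l : 0 < (l.+2%:R^-1 : R) <= 2^-1.
  by apply/andP; split; [rewrite invr_gt0 ltr0Sn|rewrite lef_pV2 ?posrE ?ltr0Sn // ler_nat].
have b_lt l : b l < eps.
  by rewrite /b gtr_pMr // ltrBlDr ltrDl; case/andP: (l2 l).
have b_ge l : eps / 2 <= b l.
  have e2 : 1 = 2^-1 + 2^-1 :> R by field.
  by rewrite /b ler_pM2l // lerBrDr [leRHS]e2 lerD2l; case/andP: (l2 l).
have e20 : 0 < eps / 2 by rewrite divr_gt0.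
have b0 l : 0 < b l by exact: lt_le_trans (b_ge l).
have ex l : exists PP : (R -> R) * (R -> R), cutoff_on (b l) eps PP.1 PP.2.
  by have [P [P' h]] := cutoff (b_lt l); exists (P, P').
have [PP hPP] := choice ex; pose P l := (PP l).1.
have Cg l : Cc (outer zeta (P l) : V -> R) by exact: (outer_Cc D (b0 l) (hPP l)).
pose dom (x : V) : R := `|zeta (Num.max (enorm x) (eps / 2))|.
have Cdom : Cc dom.
  split; last first.
    exists (Num.max T 0) => x; rewrite gt_max => /andP[Tx _]; rewrite /dom zT ?normr0 //.
    by rewrite le_max (le_trans (ltW Tx)) //; exact: norm_le_enorm.
  apply: (rV_cont_comp (h := fun t : R => `|t|)); last by move=> t; exact: norm_continuous.
  have cm : continuous (fun x : V => Num.max (enorm x) (eps / 2)).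
    by apply: rV_cont_max; [exact: continuous_enorm|exact: rV_cont_cst].
  move=> x; apply: (@continuous_comp _ _ _ (fun x : V => Num.max (enorm x) (eps / 2)) zeta).
    exact: cm.
  by apply: cz; rewrite lt_max e20 orbT.
pose A : set (Rn R n) := ~` @eball0 R n eps.
pose lim_ : Rn R n -> \bar R := (fun x : Rn R n => (zeta (enorm x))%:E) \_ A.
pose F_ (l : nat) := EFin \o (outer zeta (P l) : Rn R n -> R).
have mF l := measurable_int _ (Cc_integrable mu_fin (Cg l)).
have F_lim x : setT x -> F_ ^~ x @ \oo --> lim_ x.
  move=> _; rewrite /lim_ patchE; case: ifPn => xA.
    (* The sphere |x| = eps belongs to this case: each cutoff is already 0 there, which matches the
       complement of the open ball. *)
    apply: cvg_near_cst; apply: nearW => l; rewrite /F_ /= /outer /P.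
    have [_ [_ h _ _]] := hPP l; rewrite h ?subr0 ?mulr1 //.
    by move: xA; rewrite inE /A /eball0 /= => /negP; rewrite -leNgt.
  have xe : enorm x < eps.
    move: xA; rewrite notin_setE /A /eball0 /= => h; apply: contrapT => hn; exact: h.
  have q0 : 0 < 1 - enorm x / eps by rewrite subr_gt0 ltr_pdivrMr // mul1r.
  apply: cvg_near_cst; near=> l; rewrite /F_ /= /outer /P.
  have [_ [h _ _ _]] := hPP l; rewrite h ?subrr ?mulr0 //.
  have h1 : l.+2%:R^-1 <= 1 - enorm x / eps.
    rewrite invf_ple ?posrE ?ltr0Sn //; apply: le_trans (_ : l%:R <= _).
      by near: l; exact: nbhs_infty_ger.
    by rewrite ler_nat -addn2 leq_addr.
  have : enorm x / eps <= 1 - l.+2%:R^-1 by rewrite lerBrDr addrC -lerBrDr.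
  by rewrite ler_pdivrMr // mulrC.
have domE x : setT x -> (dom x)%:E \is a fin_num by [].
have idom := Cc_integrable mu_fin Cdom.
have F_dom l (x : Rn R n) : setT x -> (`|F_ l x| <= (dom x)%:E)%E.
  move=> _; rewrite /F_ /= /outer /P /dom lee_fin normrM.
  have [[_ _ h01 _] [h _ _ _]] := hPP l; have /andP[P0 P1] := h01 (enorm x).
  have [xb|xb] := leP (eps / 2) (enorm x).
    by rewrite ler_piMr // ger0_norm ?subr_ge0 // lerBlDr lerDl.
  by rewrite h ?subrr ?normr0 ?mulr0 //; exact: le_trans (ltW xb) (b_ge l).
have mlim := measurable_realfun.emeasurable_fun_cvg F_ lim_ mF F_lim.
have [intl _ cvgI] := dominated_convergence measurableT mF mlim (aeW _ F_lim) idom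
  (aeW _ (fun x l (Dx : setT x) => F_dom l x Dx)).
have TE : trunc_int zeta (Phi f) eps = (\int[Phi f]_x lim_ x)%E by rewrite /trunc_int integral_mkcond.
have := integrable_fin_num measurableT intl; rewrite -TE.
rewrite -TE in cvgI; case: (trunc_int _ _ _) cvgI => // r cvgI _.
have cr : mint (Phi f) (outer zeta (P l)) @[l --> \oo] --> r by exact: fine_cvg cvgI.
rewrite lee_fin.
have cd : `|mint (Phi f) (outer zeta (P l)) - c| @[l --> \oo] --> `|r - c|.
  by apply: cvg_norm; apply: cvgB => //; exact: cvg_cst.
apply: (cvgr_to_le cd); apply: nearW => l; rewrite distrC.
exact: (hc _ _ _ (b0 l) (hPP l)).
Unshelve. all: end_near. Qed.

End Truncation.

(** Each f in K is bounded on the ball, and the functions within 1 of f there form a neighbourhood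
    of f; compactness makes one bound serve them all. *)
Lemma compact_family_bounded (R : realType) (n : nat)
    (K : set {family compact, 'rV[R]_n -> R}) (r : R) :
  (forall f, K f -> convex_fun f) -> compact K ->
  exists2 M : R, 0 < M & forall f, K f -> forall x : 'rV[R]_n, `|x| <= r -> `|f x| <= M.
Proof.
move=> cvK /compact_near_coveringP cK.
have h := cK R (+oo%R) (fun M f => forall x : 'rV[R]_n, `|x| <= r -> `|f x| <= M) _ _.
have : \forall M \near +oo%R, K `<=` (fun f => forall x : 'rV[R]_n, `|x| <= r -> `|f x| <= M).
  apply: h => f Kf; have [M M0 hM] := convex_bounded r (cvK f Kf).
  pose E : set (R * R) := [set ab | ball ab.1 1 ab.2].
  pose B := [set x : 'rV[R]_n | `|x| <= r].
  have entE : entourage E by exact: entourage_ball (PosNum ltr01).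
  exists ([set g : {family compact, 'rV[R]_n -> R} | forall y, B y -> E (f y, g y)], [set N | M + 1 <= N]).
    split; first by apply: fam_nbhs => //; exact: compact_rV_ball.
    exact: (nbhs_pinfty_ge (num_real _)).
  move=> [g N] /= [gE MN] x xr; have := gE x xr; rewrite /E -ball_normE /= => fg.
  have := hM x xr; have := ler_normB (f x) (f x - g x); rewrite subKr.
  by move=> h1 h2; apply: le_trans h1 _; apply: le_trans MN; apply: lerD => //; exact: ltW.
move=> hn; have [M [M0 hM]] := @filter_ex _ _ _ _ (filterI (nbhs_pinfty_gt (num_real 0)) hn).
by exists M => // f Kf; exact: hM.
Qed.

Lemma trunc_int_uniform (R : realType) (n i : nat) (zeta : R -> R)
    (Phi : ('rV[R]_n -> R) -> {measure set (Rn R n) -> \bar R}) (V : ('rV[R]_n -> R) -> R)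
    (r M eta : R) :
  (0 < i)%N -> (i < n)%N -> D_class n i zeta -> hessian_measure i Phi -> fiv i zeta V ->
  0 < r -> 0 <= M -> 0 < eta ->
  exists2 delta : R, 0 < delta & forall f, convex_fun f ->
    (forall x, `|x| <= r -> `|f x| <= M) -> forall eps : R, 0 < eps < delta ->
    (`| trunc_int zeta (Phi f) eps - (V f)%:E | < eta%:E)%E.
Proof.
move=> i0 ilt D hm hV r0 M0 eta0; have h0 : 0 < eta / 2 by rewrite divr_gt0.
have [delta d0 hd] := fiv_outer_bound i0 ilt D hm hV r0 M0 h0.
exists delta => // f cvf fM eps /andP[e0 ed].
(* Passing to the limit preserves only a weak inequality; working with eta / 2 restores the strict
   one. *)
apply: (@le_lt_trans _ _ (eta / 2)%:E); last by rewrite lte_fin; lra.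
apply: (trunc_int_bound D hm cvf e0) => b P P' b0 cP.
exact: (hd f b eps P P' cvf fM b0 (ltW ed) cP).
Qed.

Lemma cvg_at_right_dist (R : realType) (u : R -> \bar R) (l : R) :
  (forall eta : R, 0 < eta -> exists2 delta : R, 0 < delta &
     forall eps : R, 0 < eps < delta -> (`|u eps - l%:E| < eta%:E)%E) ->
  u @ 0^'+ --> l%:E.
Proof.
move=> h.
have h' eta : 0 < eta -> \forall eps \near 0^'+, (`|u eps - l%:E| < eta%:E)%E.
  move=> eta0; have [delta d0 hd] := h _ eta0; near=> eps; apply: hd.
  by apply/andP; split; near: eps; [exact: nbhs_right_gt|exact: nbhs_right_lt].
have fin x eta : (`|x - l%:E| < eta%:E)%E -> x \is a fin_num by case: x.
apply: cvg_EFin; first by apply: filterS (h' 1 ltr01) => eps; exact: fin.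
apply/cvgrPdist_lt => eta eta0; apply: filterS (h' eta eta0) => eps he.
move: (he) (fin _ _ he) => /=; case: (u eps) => // x; rewrite lte_fin distrC.
by [].
Unshelve. all: end_near. Qed.

Theorem theorem6p10 (R : realType) (n i : nat) (zeta : R -> R)
  (Phi : ('rV[R]_n -> R) -> {measure set (Rn R n) -> \bar R})
  (V : ('rV[R]_n -> R) -> R) :
  (2 <= n)%N -> (1 <= i <= n - 1)%N ->
  D_class n i zeta -> hessian_measure i Phi -> fiv i zeta V ->
  (* pointwise limit *)
  (forall f : 'rV[R]_n -> R, convex_fun f ->
     trunc_int zeta (Phi f) @ 0^'+ --> (V f)%:E) /\
  (* uniform convergence on {f : sup_{|x|<r} |f x| <= M}, r > 1, M > 0 *)
  (forall r M : R, 1 < r -> 0 < M -> forall eta : R, 0 < eta ->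
     exists delta : R, 0 < delta /\
       forall f : 'rV[R]_n -> R, convex_fun f ->
         (forall x, enorm x < r -> `|f x| <= M) ->
         forall eps : R, 0 < eps < delta ->
           (`| trunc_int zeta (Phi f) eps - (V f)%:E | < eta%:E)%E) /\
  (* uniform convergence on compact subsets of Conv(R^n,R), with the topology
     of compact (= locally uniform) convergence, i.e. epi-convergence *)
  (forall K : set {family compact, 'rV[R]_n -> R},
     (forall f, K f -> convex_fun f) -> compact K ->
     forall eta : R, 0 < eta ->
     exists delta : R, 0 < delta /\
       forall f, K f -> forall eps : R, 0 < eps < delta ->
         (`| trunc_int zeta (Phi f) eps - (V f)%:E | < eta%:E)%E).
Proof.
move=> n2 /andP[i0 i_n] D hm hV; have ilt : (i < n)%N by lia.
have unif r M eta := @trunc_int_uniform R n i zeta Phi V r M eta i0 ilt D hm hV.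
split; [|split].
- move=> f cvf; have [M M0 hM] := convex_bounded 1 cvf.
  apply: cvg_at_right_dist => eta eta0.
  have [delta d0 hd] := unif 1 M eta ltr01 (ltW M0) eta0.
  by exists delta => //; exact: hd.
- move=> r M r1 M0 eta eta0.
  have n0 : (0 : R) < n%:R by rewrite ltr0n; lia.
  (* The estimate is stated for supremum-norm balls. The one of radius 1 / n lies in the Euclidean
     ball of radius r, because [enorm x] is at most n times the supremum norm and r > 1. *)
  have r0 : 0 < n%:R^-1 :> R by rewrite invr_gt0.
  have [delta d0 hd] := unif _ M eta r0 (ltW M0) eta0.
  exists delta; split=> // f cvf fM; apply: hd => // x xr; apply: fM.
  apply: le_lt_trans (enorm_le_norm x) _; apply: le_lt_trans r1.
  by rewrite mulrC -ler_pdivlMr // mul1r.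
- move=> K cvK cK eta eta0; have [M M0 hM] := compact_family_bounded 1 cvK cK.
  have [delta d0 hd] := unif 1 M eta ltr01 (ltW M0) eta0.
  by exists delta; split=> // f Kf; apply: hd; [exact: cvK|exact: hM].
Qed.
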